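(* Let $\mathcal{X}\subset\mathbb{R}^d$ be convex and compact, and consider the problem of minimizing $f(x)=\mathbb{E}[F(x;\omega)]$ over $x\in\mathcal{X}$, with solution set $\mathcal{X}^*$. Assume the regularity assumptions (R1)–(R3), mean variational coherence (VC), and the reciprocity assumption (RC), all given in the context. Let $(X_n)_{n\ge0}$ be generated by distributed asynchronous stochastic gradient descent (DASGD) with projection: $Y_0\in\mathbb{R}^d$ and, for $n\ge 0$, $$X_n=\mathrm{pr}_{\mathcal{X}}(Y_n),\qquad Y_{n+1}=Y_n-\alpha_{n+1}\nabla F(X_{s(n)};\omega_{n+1}),$$ where the step-sizes $(\alpha_n)$ and the delays $(d_n)$ induced by $s$ satisfy one of the four delay/step-size conditions (D1)–(D4) given in the context. Then $X_n$ converges to the solution set $\mathcal{X}^*$ almost surely, i.e. $\mathrm{dist}(X_n,\mathcal{X}^* )\to0$ as $n\to\infty$ with probability $1$.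
   Context: Setting. $(\Omega,\mathcal{F},\mathbb{P})$ is a complete probability space, $F:\mathcal{X}\times\Omega\to\mathbb{R}$ is a random function ($F(x;\cdot)$ is measurable for each $x$), and $f(x)=\mathbb{E}[F(x;\omega)]$ is a real-valued function on $\mathcal X$. $\nabla F(x;\omega)$ denotes the gradient in $x$ only. $\mathcal{X}^*=\arg\min_{x\in\mathcal{X}}f(x)$. $\mathrm{pr}_{\mathcal{X}}$ is Euclidean projection onto $\mathcal{X}$. A sequence $x_n$ converges to a set $S$ ($x_n\to S$) if $\mathrm{dist}(x_n,S)=\inf_{s\in S}\|x_n-s\|_2\to0$. Regularity assumptions. (R1) $F(x;\omega)$ is differentiable in $x$ for $\mathbb{P}$-almost all $\omega$. (R2) $\sup_{x\in\mathcal{X}}\mathbb{E}[\|\nabla F(x;\omega)\|_2^2]<\infty$. (R3) $x\mapsto \mathbb{E}[\nabla F(x;\omega)]$ is Lipschitz on $\mathcal{X}$. Under these assumptions $f$ is differentiable with $\nabla f(x)=\mathbb{E}[\nabla F(x;\omega)]$. (VC) Mean variational coherence: $\mathbb{E}[\langle\nabla F(x;\omega),x-x^*\rangle]\ge0$ for all $x^*\in\mathcal{X}^*$ and all $x\in\mathcal{X}$, with equality only if $x\in\mathcal{X}^*$. Energy function: for $x^*\in\mathcal{X}^*$ and $y\in\mathbb{R}^d$, $E_{x^*}(y)=\|x^*\|_2^2-\|\mathrm{pr}_{\mathcal{X}}(y)\|_2^2+2\langle y,\mathrm{pr}_{\mathcal{X}}(y)-x^*\rangle$, and $E(y)=\inf_{x^*\in\mathcal{X}^*}E_{x^*}(y)$.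 (RC) Reciprocity: for every sequence $(y_n)$ in $\mathbb{R}^d$, if $\mathrm{pr}_{\mathcal{X}}(y_n)\to\mathcal{X}^*$ as $n\to\infty$, then $\lim_{n\to\infty}E(y_n)=0$. Samples. $\omega_1,\omega_2,\dots$ are i.i.d. samples from $\mathbb{P}$. Delays. $s:\{0,1,2,\dots\}\to\{0,1,2,\dots\}$ is a function with $s(n)\le n$; $s(n)$ is the iteration from which the gradient received at iteration $n$ originated ($s$ need not be one-to-one). The delay of a gradient requested at iteration $k$ and received at iteration $n$ (so $s(n)=k$) is $n-s(n)$; put $d_k:=\sup\{n-k: s(n)=k\}$ ($d_k:=0$ if there is no such $n$), which is required to be finite. Delay/step-size conditions (step-sizes $\alpha_n>0$); one of the following holds: (D1) Bounded delays: $\sup_n d_n\le D$ for some positive number $D$, and $\sum_{n=1}^\infty\alpha_n^2<\infty$, $\sum_{n=1}^\infty\alpha_n=\infty$. (D2) Sublinearly growing delays: $d_n=O(n^p)$ for some $0<p<1$, and $\alpha_n\propto 1/n$. (D3) Linearly growing delays: $d_n=O(n)$, and $\alpha_n\propto 1/(n\log n)$. (D4) Polynomially growing delays: $d_n=O(n^q)$ for some $q\ge 1$, and $\alpha_n\propto 1/(n\log n\log\log n)$. Here $\alpha_n\propto g(n)$ means that there is a constant $c>0$ with $\alpha_n=c\,g(n)$ for all $n$ large enough that $g(n)$ is defined and positive (the finitely many other step-sizes being arbitrary positive numbers). *)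

(* Defs.v *)
From HB Require Import structures.
From mathcomp Require Import all_boot all_order all_algebra finmap.
From mathcomp Require Import all_classical all_reals all_analysis.

Set Implicit Arguments.
Unset Strict Implicit.
Unset Printing Implicit Defensive.

Import Order.TTheory GRing.Theory Num.Theory.
Import numFieldNormedType.Exports.

Local Open Scope classical_set_scope.
Local Open Scope ring_scope.

(* The library norm on row vectors is the sup norm, hence the explicit
   Euclidean structure. *)
Definition dotp (R : realType) (d : nat) (u v : 'rV[R]_d) : R :=
  \sum_(i < d) u 0 i * v 0 i.

Definition enorm (R : realType) (d : nat) (u : 'rV[R]_d) : R :=
  Num.sqrt (dotp u u).

(* Extended-real valued, so that the distance to the empty set is +oo. *)
Definition edist_to (R : realType) (d : nat) (x : 'rV[R]_d)
    (S : set 'rV[R]_d) : \bar R :=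
  ereal_inf [set (enorm (x - s))%:E | s in S].

(* The default value 0 is only reached when there is no nearest point, which
   does not happen for X nonempty, convex and compact. *)
Definition proj (R : realType) (d : nat) (X : set 'rV[R]_d) (y : 'rV[R]_d) :
    'rV[R]_d :=
  xget 0 [set x | X x /\ forall z, X z -> enorm (y - x) <= enorm (y - z)].

Definition argmin (R : realType) (d : nat) (X : set 'rV[R]_d)
    (f : 'rV[R]_d -> R) : set 'rV[R]_d :=
  [set x | X x /\ forall z, X z -> f x <= f z].

(* First-order expansion of h at x along points of X only: the values of h
   outside X play no role. A gradient on a neighbourhood of x is a gradient
   within X; conversely g is unique when X has nonempty interior, while for a
   lower-dimensional X it is determined up to a vector orthogonal to X - x. *)
Definition gradient_within (R : realType) (d : nat) (X : set 'rV[R]_d)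
    (h : 'rV[R]_d -> R) (x g : 'rV[R]_d) : Prop :=
  (h y - h x - dotp g (y - x)) / enorm (y - x) @[y --> within X x^'] --> (0 : R).

Definition Evec (R : realType) (d : nat) (dO : measure_display)
    (Omega : measurableType dO) (P : probability Omega R)
    (g : Omega -> 'rV[R]_d) : 'rV[R]_d :=
  \row_(i < d) fine ('E_P[(fun o => g o 0 i)%R])%E.

Definition objective (R : realType) (d : nat) (dO : measure_display)
    (Omega : measurableType dO) (P : probability Omega R)
    (F : 'rV[R]_d -> Omega -> R) (x : 'rV[R]_d) : R :=
  fine ('E_P[F x])%E.

Definition elipschitz_on (R : realType) (d : nat) (X : set 'rV[R]_d)
    (g : 'rV[R]_d -> 'rV[R]_d) : Prop :=
  exists L : R, forall x y, X x -> X y -> enorm (g x - g y) <= L * enorm (x - y).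

Definition variationally_coherent (R : realType) (d : nat)
    (dO : measure_display) (Omega : measurableType dO)
    (P : probability Omega R) (X Xs : set 'rV[R]_d)
    (G : 'rV[R]_d -> Omega -> 'rV[R]_d) : Prop :=
  forall xs x, Xs xs -> X x ->
    (0 <= 'E_P[(fun o => dotp (G x o) (x - xs))%R])%E /\
    (('E_P[(fun o => dotp (G x o) (x - xs))%R])%E = 0%E -> Xs x).

Definition energy_at (R : realType) (d : nat) (X : set 'rV[R]_d)
    (xs y : 'rV[R]_d) : R :=
  enorm xs ^+ 2 - enorm (proj X y) ^+ 2 + 2 * dotp y (proj X y - xs).

Definition energy (R : realType) (d : nat) (X Xs : set 'rV[R]_d)
    (y : 'rV[R]_d) : \bar R :=
  ereal_inf [set (energy_at X xs y)%:E | xs in Xs].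

Definition reciprocity (R : realType) (d : nat) (X Xs : set 'rV[R]_d) : Prop :=
  forall y : nat -> 'rV[R]_d,
    edist_to (proj X (y n)) Xs @[n --> \oo] --> 0%E ->
    energy X Xs (y n) @[n --> \oo] --> 0%E.

Definition mutually_independent (R : realType) (dO dS : measure_display)
    (Omega : measurableType dO) (S : measurableType dS)
    (Q : probability S R) (w : nat -> {mfun S >-> Omega}) : Prop :=
  forall (J : {fset nat}) (A : nat -> set Omega),
    (forall i, measurable (A i)) ->
    Q (\bigcap_(i in [set` J]) (w i @^-1` A i)) =
    (\prod_(i <- J) Q (w i @^-1` A i))%E.

Definition iid_from (R : realType) (dO dS : measure_display)
    (Omega : measurableType dO) (S : measurableType dS)
    (P : probability Omega R) (Q : probability S R)
    (w : nat -> {mfun S >-> Omega}) : Prop :=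
  (forall i (A : set Omega), measurable A -> distribution Q (w i) A = P A) /\
  mutually_independent Q w.

Definition delays (R : realType) (s : nat -> nat) (k : nat) : set R :=
  [set (n - k)%N%:R | n in [set n | s n = k]].
Arguments delays : clear implicits.

(* The real supremum of the empty set is 0 in the library, so the delay is 0
   when no gradient originates from iteration k. *)
Definition delay (R : realType) (s : nat -> nat) (k : nat) : R :=
  sup (delays R s k).

(* The guard 0 < g n selects exactly the n for which g n is defined and
   positive in the three uses below: ln is 0 on nonpositive reals and
   0^-1 = 0, so the junk values of g n are nonpositive. *)
Definition propto (R : realType) (alpha g : nat -> R) : Prop :=
  exists2 c : R, 0 < c & forall n, 0 < g n -> alpha n = c * g n.

Definition bounded_delays (R : realType) (s : nat -> nat) (alpha : nat -> R) :
    Prop :=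
  [/\ exists2 D : R, 0 < D & forall k, delay R s k <= D,
      cvgn (series (fun n => alpha n.+1 ^+ 2)) &
      series (fun n => alpha n.+1) @ \oo --> +oo].

Definition sublinear_delays (R : realType) (s : nat -> nat)
    (alpha : nat -> R) : Prop :=
  (exists p : R, [/\ 0 < p, p < 1 &
     (delay R s : nat -> R^o) =O_\oo (fun k => k%:R `^ p : R^o)]) /\
  propto alpha (fun n => n%:R^-1).

Definition linear_delays (R : realType) (s : nat -> nat)
    (alpha : nat -> R) : Prop :=
  (delay R s : nat -> R^o) =O_\oo (fun k => k%:R : R^o) /\
  propto alpha (fun n => (n%:R * ln n%:R)^-1).

Definition polynomial_delays (R : realType) (s : nat -> nat)
    (alpha : nat -> R) : Prop :=
  (exists2 q : R, 1 <= q &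
     (delay R s : nat -> R^o) =O_\oo (fun k => k%:R `^ q : R^o)) /\
  propto alpha (fun n => (n%:R * ln n%:R * ln (ln n%:R))^-1).

Definition delay_step_condition (R : realType) (s : nat -> nat)
    (alpha : nat -> R) : Prop :=
  [\/ bounded_delays s alpha, sublinear_delays s alpha,
      linear_delays s alpha | polynomial_delays s alpha].

Definition dasgd (R : realType) (d : nat) (dO dS : measure_display)
    (Omega : measurableType dO) (S : measurableType dS)
    (X : set 'rV[R]_d) (G : 'rV[R]_d -> Omega -> 'rV[R]_d)
    (s : nat -> nat) (alpha : nat -> R) (w : nat -> S -> Omega)
    (y0 : 'rV[R]_d) (Xn Yn : nat -> S -> 'rV[R]_d) : Prop :=
  forall o : S,
    [/\ Yn 0%N o = y0,
        forall n, Xn n o = proj X (Yn n o) &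
        forall n, Yn n.+1 o =
          Yn n o - alpha n.+1 *: G (Xn (s n) o) (w n.+1 o)].

(* Main.v *)
(* For minimizers [p], the energy [inf_p E_p] is a Lyapunov function of the dual
   iterates [Y]. Replacing the stale point [X_(s n)] by [X_n] in the mean gradient
   costs at most a constant times E|X_(s n) - X_n|, hence a constant times the sum
   of the step-sizes over the window [s n, n); each of the four delay/step-size
   conditions makes these costs, weighted by the step-sizes, summable. So the
   energies form an almost supermartingale. Summing the decrease of a single [E_p]
   shows that <E grad F(X_n), X_n - p> comes arbitrarily close to 0 infinitely
   often; by compactness, coherence and reciprocity so does the energy, and a
   maximal inequality then forces it to converge to 0.
   The gradient within [X] need not be jointly measurable in the point and the
   sample. Its projection onto the directions of [X] is, being determined by [F],
   and using it instead does not change the projected iterates. *)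

Require Import Defs.
From HB Require Import structures.
From mathcomp Require Import all_boot all_order all_algebra finmap.
From mathcomp Require Import all_classical all_reals all_analysis.
From mathcomp Require Import measurable_realfun ring lra.

Import Order.TTheory GRing.Theory Num.Theory.
Import numFieldNormedType.Exports.

Local Open Scope classical_set_scope.
Local Open Scope ring_scope.

(** Gradients have bounded second moments only, so the distance between a stale and a current
    iterate is controlled in expectation, not along a sample path. This shapes the drift inequality:
    it is integrated over an arbitrary event of the past, with an error that is a number not
    depending on that event, and no conditional expectation appears. The error is also the same for
    all minimizers [p], which is why the infimum of the energies inherits the inequality. The
    infimum is needed because the iterates may approach different minimizers for different samples,
    and because reciprocity speaks of it. The existence of a minimizer is part of what must be
    proved. It follows from continuity of the objective, but the derivatives of a sample function
    need not be continuous in the point, and only their moments at each single point are bounded.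
    Hence a mean value inequality with a Lebesgue integral in place of a supremum, which can be
    averaged over the samples by Tonelli's theorem. *)

(** * Euclidean inner product, norm and topology *)

Section euclid.
Context {R : realType} {d : nat}.
Implicit Types (u v w x y z : 'rV[R]_d).

Lemma dotpC u v : dotp u v = dotp v u.
Proof. by apply: eq_bigr => i _; rewrite mulrC. Qed.

Lemma dotpDl u v w : dotp (u + v) w = dotp u w + dotp v w.
Proof. by rewrite -big_split; apply: eq_bigr => i _; rewrite mxE mulrDl. Qed.

Lemma dotpZl (a : R) u v : dotp (a *: u) v = a * dotp u v.
Proof. by rewrite mulr_sumr; apply: eq_bigr => i _; rewrite mxE mulrA. Qed.

Lemma dotpDr u v w : dotp u (v + w) = dotp u v + dotp u w.
Proof. by rewrite !(dotpC u) dotpDl. Qed.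

Lemma dotpZr (a : R) u v : dotp u (a *: v) = a * dotp u v.
Proof. by rewrite !(dotpC u) dotpZl. Qed.

Lemma dotpNl u v : dotp (- u) v = - dotp u v.
Proof. by rewrite -scaleN1r dotpZl mulN1r. Qed.

Lemma dotpNr u v : dotp u (- v) = - dotp u v.
Proof. by rewrite !(dotpC u) dotpNl. Qed.

Lemma dotpBl u v w : dotp (u - v) w = dotp u w - dotp v w.
Proof. by rewrite dotpDl dotpNl. Qed.

Lemma dotpBr u v w : dotp u (v - w) = dotp u v - dotp u w.
Proof. by rewrite dotpDr dotpNr. Qed.

Definition dotpE := (dotpDl, dotpDr, dotpNl, dotpNr, dotpZl, dotpZr).

Lemma dotp0l u : dotp 0 u = 0.
Proof. by rewrite -(scale0r u) dotpZl mul0r. Qed.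

Lemma dotp_ge0 u : 0 <= dotp u u.
Proof. by apply: sumr_ge0 => i _; rewrite -expr2 sqr_ge0. Qed.

Lemma dotp_eq0 u : dotp u u = 0 -> u = 0.
Proof.
move=> /eqP; rewrite psumr_eq0; last by move=> i _; rewrite -expr2 sqr_ge0.
move=> /allP u0; apply/rowP => i; rewrite mxE; apply/eqP.
by have := u0 i (mem_index_enum i); rewrite mulf_eq0 orbb.
Qed.

Lemma dotp_mxE u v : dotp u v = (u *m v^T) 0 0.
Proof. by rewrite mxE; apply: eq_bigr => i _; rewrite mxE. Qed.

Lemma dotp_mulmx u v (A : 'M[R]_d) : dotp (u *m A) v = dotp u (v *m A^T).
Proof. by rewrite !dotp_mxE trmx_mul trmxK mulmxA. Qed.

Lemma enorm_ge0 u : 0 <= enorm u.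
Proof. exact: sqrtr_ge0. Qed.

Lemma enorm_sqr u : enorm u ^+ 2 = dotp u u.
Proof. by rewrite sqr_sqrtr // dotp_ge0. Qed.

Lemma enorm0 : enorm (0 : 'rV[R]_d) = 0.
Proof. by rewrite /enorm dotp0l sqrtr0. Qed.

Lemma enorm_eq0 u : enorm u = 0 -> u = 0.
Proof. by move=> u0; apply: dotp_eq0; rewrite -enorm_sqr u0 expr0n. Qed.

Lemma enormN u : enorm (- u) = enorm u.
Proof. by rewrite /enorm dotpNl dotpNr opprK. Qed.

Lemma enormB u v : enorm (u - v) = enorm (v - u).
Proof. by rewrite -enormN opprB. Qed.

Lemma enormZ (a : R) u : enorm (a *: u) = `|a| * enorm u.
Proof.
rewrite /enorm dotpZl dotpZr mulrA -expr2 sqrtrM ?sqr_ge0 //.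
by rewrite sqrtr_sqr.
Qed.

Lemma norm_sub_le (a b c : R) : a - b <= c -> b - a <= c -> `|a - b| <= c.
Proof. by move=> ab ba; rewrite ler_norml ab andbT lerNl opprB. Qed.

Lemma ler_enorm u v : (enorm u <= enorm v) = (dotp u u <= dotp v v).
Proof. by rewrite -!enorm_sqr ler_pXn2r ?nnegrE ?enorm_ge0. Qed.

Lemma cauchy_schwarz u v : `|dotp u v| <= enorm u * enorm v.
Proof.
have [v0|v0] := eqVneq (dotp v v) 0.
  by rewrite (dotp_eq0 _ v0) dotpC dotp0l normr0 mulr_ge0 ?enorm_ge0.
rewrite -(ler_pXn2r (n := 2)) ?nnegrE ?mulr_ge0 ?enorm_ge0 //.
rewrite real_normK ?num_real // exprMn !enorm_sqr.
have vv : 0 < dotp v v by rewrite lt_def v0 dotp_ge0.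
have := dotp_ge0 (dotp v v *: u - dotp u v *: v).
rewrite !dotpE (dotpC v u) => h.
rewrite -subr_ge0 -(pmulr_rge0 _ vv).
by move: h; congr (_ <= _); ring.
Qed.

Lemma dotp_le u v : dotp u v <= enorm u * enorm v.
Proof. exact: le_trans (ler_norm _) (cauchy_schwarz u v). Qed.

Lemma enormD u v : enorm (u + v) <= enorm u + enorm v.
Proof.
rewrite -(ler_pXn2r (n := 2)) ?nnegrE ?addr_ge0 ?enorm_ge0 //.
rewrite sqrrD !enorm_sqr !dotpE (dotpC v u) -!enorm_sqr.
have := dotp_le u v; lra.
Qed.

Lemma enorm_triangle w u v : enorm (u - v) <= enorm (u - w) + enorm (w - v).
Proof. by rewrite (le_trans _ (enormD _ _)) // addrA subrK. Qed.

Lemma coord_le_enorm u i : `|u 0 i| <= enorm u.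
Proof.
rewrite -(ler_pXn2r (n := 2)) ?nnegrE ?enorm_ge0 //.
rewrite enorm_sqr real_normK ?num_real // /dotp (bigD1 i) //= -expr2 lerDl.
by apply: sumr_ge0 => j _; rewrite -expr2 sqr_ge0.
Qed.

Lemma coord_le_mx_norm u i : `|u 0 i| <= `|u|.
Proof.
rewrite [leRHS]mx_normrE.
exact: (le_bigmax _ (fun ij : 'I_1 * 'I_d => `|u ij.1 ij.2|) (0, i)).
Qed.

Lemma enorm_le_mx_norm u : enorm u <= d%:R * `|u|.
Proof.
have [d0|d0] := posnP d.
  have -> : u = 0 by apply/rowP => -[i ilt]; exfalso; move: ilt; rewrite d0.
  by rewrite enorm0 normr0 mulr0.
rewrite -(ler_pXn2r (n := 2)) ?nnegrE ?mulr_ge0 ?enorm_ge0 //.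
rewrite enorm_sqr exprMn (@le_trans _ _ (d%:R * `|u| ^+ 2)) //.
  rewrite [leRHS]mulr_natl -[X in _ *+ X]card_ord -sumr_const.
  apply: ler_sum => i _; rewrite -expr2 -(real_normK (num_real (u 0 i))).
  by rewrite ler_pXn2r ?nnegrE // coord_le_mx_norm.
by rewrite ler_wpM2r ?sqr_ge0 // expr2 ler_peMl // ler1n.
Qed.

Lemma mx_norm_le_enorm u : `|u| <= enorm u.
Proof.
rewrite [leLHS]mx_normrE; apply/bigmax_leP; split; first exact: enorm_ge0.
by move=> [i j] _ /=; rewrite ord1 coord_le_enorm.
Qed.

(** The topology comes from the sup norm; the two norms are equivalent, so Euclidean balls generate
    the same neighbourhoods and epsilon-delta arguments can use [enorm]. *)
Lemma nbhs_enorm x (A : set 'rV[R]_d) :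
  nbhs x A <-> exists2 e : R, 0 < e & forall y, enorm (x - y) < e -> A y.
Proof.
split.
  move=> /nbhs_ballP[e /= e0 eA]; exists e => // y xy; apply: eA.
  rewrite -ball_normE /=; exact: le_lt_trans (mx_norm_le_enorm _) xy.
(* Dividing by [d.+1] rather than [d] keeps the radius positive when [d = 0]. *)
move=> [e e0 eA]; apply/nbhs_ballP; exists (e / d.+1%:R) => /=.
  by rewrite divr_gt0.
move=> y; rewrite -ball_normE /= ltr_pdivlMr // => xy; apply: eA.
apply: le_lt_trans (enorm_le_mx_norm _) _; apply: le_lt_trans xy.
by rewrite mulrC ler_wpM2l // ler_nat.
Qed.

Lemma continuous_withinP (A : set 'rV[R]_d) (f : 'rV[R]_d -> R) :
  {within A, continuous f} <-> forall x, A x -> forall e : R, 0 < e ->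
    exists2 r : R, 0 < r & forall y, A y -> enorm (x - y) < r -> `|f x - f y| < e.
Proof.
split=> [/subspace_continuousP fc x Ax e e0|fc].
  have /cvgrPdist_lt/(_ e e0) := fc x Ax.
  rewrite /within /= => /nbhs_enorm[r r0 hr].
  by exists r => // y Ay xy; exact: hr.
apply/subspace_continuousP => x Ax; apply/cvgrPdist_lt => e e0.
have [r r0 hr] := fc x Ax e e0.
by rewrite /within /=; apply/nbhs_enorm; exists r => // y xy Ay; exact: hr.
Qed.

Lemma continuous_enormP (f : 'rV[R]_d -> R) :
  continuous f <-> forall x (e : R), 0 < e ->
    exists2 r : R, 0 < r & forall y, enorm (x - y) < r -> `|f x - f y| < e.
Proof.
split=> [/continuous_subspace_setT/continuous_withinP fc x e e0|fc].
  by have [r r0 hr] := fc x I e e0; exists r => // y; exact: hr.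
apply/continuous_subspace_setT/continuous_withinP => x _ e e0.
by have [r r0 hr] := fc x e e0; exists r => // y _; exact: hr.
Qed.

Lemma lipschitz_within (A : set 'rV[R]_d) (L : R) (f : 'rV[R]_d -> R) :
  (forall x y, A x -> A y -> `|f x - f y| <= L * enorm (x - y)) ->
  {within A, continuous f}.
Proof.
move=> fL; apply/continuous_withinP => x Ax e e0.
exists (e / (`|L| + 1)); first by rewrite divr_gt0 // ltr_wpDl.
move=> y Ay; rewrite ltr_pdivlMr ?ltr_wpDl // => h.
apply: (le_lt_trans (fL _ _ Ax Ay)); apply: le_lt_trans h.
rewrite mulrC ler_wpM2l ?enorm_ge0 //.
by rewrite (le_trans (ler_norm L)) // lerDl.
Qed.

Lemma lipschitz_continuous (L : R) (f : 'rV[R]_d -> R) :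
  (forall x y, `|f x - f y| <= L * enorm (x - y)) -> continuous f.
Proof.
move=> fL; apply/continuous_subspace_setT.
exact: (@lipschitz_within _ L).
Qed.

Lemma enorm_lip x y : `|enorm x - enorm y| <= enorm (x - y).
Proof.
have h u v : enorm u - enorm v <= enorm (u - v).
  by rewrite lerBlDr; have := enormD (u - v) v; rewrite subrK.
by apply: norm_sub_le; rewrite // enormB.
Qed.

End euclid.

Ltac lra_dotp :=
  repeat match goal with |- context [dotp ?u ?v] => move: (dotp u v) => ? end;
  lra.

(** Real-valued, so that it can enter integrals and Lipschitz estimates directly; it agrees with
    [energy] under the hypotheses of [energy_infE]. *)
Definition energy_inf {R : realType} {d : nat} (X Xs : set 'rV[R]_d) y : R :=
  inf [set energy_at X p y | p in Xs].

(** * Projection onto a convex compact set and the energy functions *)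

Section projection.
Context {R : realType} {d : nat} {X : set 'rV[R]_d}.
Hypothesis X_nonempty : X !=set0.
Hypothesis X_convex : convex_set (X : set (convex_lmodType 'rV[R]_d)).
Hypothesis X_compact : compact X.
Implicit Types (x y z p v : 'rV[R]_d).
Local Notation pr := (Defs.proj X).

Lemma convex_segment x y (t : R) : X x -> X y -> 0 <= t <= 1 ->
  X (x + t *: (y - x)).
Proof.
move=> Xx Xy t01.
have := X_convex y x (Itv01 (andP t01).1 (andP t01).2) (mem_set Xy) (mem_set Xx).
rewrite inE; congr (X _).
rewrite /conv /= scalerBl scale1r scalerBr.
by rewrite addrC addrAC -addrA [t *: y - _]addrC.
Qed.

Lemma proj_spec y : X (pr y) /\ forall z, X z -> enorm (y - pr y) <= enorm (y - z).
Proof.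
rewrite /Defs.proj; apply: (@xgetPex _ 0 [set x | X x /\ _]).
have [c cX cmin] : exists2 c, c \in X &
    forall t, t \in X -> enorm (y - c) <= enorm (y - t).
  apply: compact_EVT_min => //; apply: (@lipschitz_within _ _ _ 1) => u v _ _.
  rewrite mul1r (le_trans (enorm_lip _ _)) //.
  by rewrite opprB addrC addrA subrK enormB.
exists c; rewrite inE in cX; split => // z Xz; apply: cmin; exact/mem_set.
Qed.

Lemma projX y : X (pr y). Proof. by have [] := proj_spec y. Qed.

(** Moving from the nearest point a fraction [t] of the way to [z] cannot come closer to [y]; the
    term of first order in [t] gives the sign. *)
Lemma proj_obtuse y z : X z -> dotp (y - pr y) (z - pr y) <= 0.
Proof.
move=> Xz; have [Xp pmin] := proj_spec y.
set p := pr y in Xp pmin *; set a := dotp _ _; set b := dotp (z - p) (z - p).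
have h t : 0 <= t <= 1 -> 2 * (t * a) <= t ^+ 2 * b.
  move=> t01; have := pmin _ (convex_segment _ _ _ Xp Xz t01).
  rewrite ler_enorm opprD addrA.
  move: (y - p) => w in a *.
  have key (v : 'rV[R]_d) : dotp w w <= dotp (w - t *: v) (w - t *: v) ->
      2 * (t * dotp w v) <= t ^+ 2 * dotp v v.
    rewrite !dotpE (dotpC v w); lra_dotp.
  exact: key.
rewrite leNgt; apply/negP => a0.
have b2 := h 1; rewrite ler01 lexx /= in b2; have {}b2 := b2 isT.
have b0 : 0 < b by lra.
(* [t = a / b] minimizes [t ^ 2 b - 2 t a]; the instance [t = 1] has given [2 a <= b], so this [t]
   is admissible. *)
have := h (a / b).
rewrite divr_ge0 ?(ltW a0) ?(ltW b0) //= ler_pdivrMr // mul1r.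
have -> : (a / b) ^+ 2 * b = a / b * a by field; rewrite gt_eqF.
have ab0 : 0 < a / b * a by rewrite mulr_gt0 // divr_gt0.
move=> /(_ ltac:(lra)); lra.
Qed.

Lemma proj_unique x y : X x -> (forall z, X z -> dotp (y - x) (z - x) <= 0) ->
  pr y = x.
Proof.
move=> Xx xmin; apply/eqP; rewrite -subr_eq0; apply/eqP/dotp_eq0.
apply/eqP; rewrite eq_le dotp_ge0 andbT.
have := proj_obtuse y x Xx; have := xmin _ (projX y).
rewrite !dotpE (dotpC x (pr y)); lra_dotp.
Qed.

Lemma proj_id x : X x -> pr x = x.
Proof. by move=> Xx; apply: proj_unique => // z _; rewrite subrr dotp0l. Qed.

Lemma proj_lip y z : enorm (pr y - pr z) <= enorm (y - z).
Proof.
have h : enorm (pr y - pr z) ^+ 2 <= enorm (y - z) * enorm (pr y - pr z).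
  apply: le_trans (dotp_le _ _); rewrite enorm_sqr.
  have := proj_obtuse y (pr z) (projX z); have := proj_obtuse z (pr y) (projX y).
  rewrite !dotpE (dotpC (pr z) (pr y)); lra_dotp.
have [e0|e0] := eqVneq (enorm (pr y - pr z)) 0; first by rewrite e0 enorm_ge0.
by move: h; rewrite expr2 ler_pM2r // lt_def e0 enorm_ge0.
Qed.

Lemma diameter : exists2 D : R, 0 < D & forall x y, X x -> X y -> enorm (x - y) <= D.
Proof.
have [M [_ XM]] := compact_bounded X_compact.
pose B := `|M| + 1.
have XB x : X x -> `|x| <= B.
  by apply: XM; rewrite (le_lt_trans (ler_norm M)) // ltrDl.
have B0 : 0 < B by rewrite ltr_wpDl.
exists (d.+1%:R * (B + B)); first by rewrite mulr_gt0 // addr_gt0.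
move=> x y Xx Xy; apply: le_trans (enorm_le_mx_norm _) _.
apply: ler_pM => //; first by rewrite ler_nat.
by rewrite (le_trans (ler_normB _ _)) // lerD ?XB.
Qed.

(** [energy_at X p y] equals [|pr y - p|^2 + 2 <y - pr y, pr y - p>], and the last product is
    nonnegative by [proj_obtuse]. *)
Lemma energy_at_ge p y : X p -> dotp (pr y - p) (pr y - p) <= energy_at X p y.
Proof.
move=> Xp; have := proj_obtuse y p Xp.
rewrite /energy_at !enorm_sqr !dotpE (dotpC p (pr y)); lra_dotp.
Qed.

(** Since [pr y] maximizes [2 <y, x> - |x|^2] over [X], the energy is a Fenchel coupling: convex in
    [y], with gradient [2 (pr y - p)]. The projection being nonexpansive, this gradient is
    2-Lipschitz, whence the quadratic upper bound. The proof combines [proj_obtuse] at [y] with the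
    square of [pr (y + v) - pr y - v]. *)
Lemma energy_atD p y v :
  energy_at X p (y + v) <=
  energy_at X p y + 2 * dotp v (pr y - p) + enorm v ^+ 2.
Proof.
have := proj_obtuse y (pr (y + v)) (projX _).
have := dotp_ge0 (pr (y + v) - pr y - v).
rewrite /energy_at !enorm_sqr; set a := pr (y + v); set b := pr y.
rewrite !dotpE (dotpC b a) (dotpC v a) (dotpC v b); lra_dotp.
Qed.

(** The gradient inequality of the same convex function at [y + v]; it yields a Lipschitz constant
    of twice the diameter. *)
Lemma energy_at_incr p y v :
  energy_at X p (y + v) - energy_at X p y <= 2 * dotp v (pr (y + v) - p).
Proof.
have := proj_obtuse y (pr (y + v)) (projX _).
have := dotp_ge0 (pr (y + v) - pr y).
rewrite /energy_at !enorm_sqr; set a := pr (y + v); set b := pr y.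
rewrite !dotpE (dotpC b a); lra_dotp.
Qed.

Section energy.
Context {Xs : set 'rV[R]_d}.
Hypothesis Xs_nonempty : Xs !=set0.
Hypothesis XsX : Xs `<=` X.

Local Notation energy_inf := (energy_inf X Xs).

Lemma energy_at_ge0 p y : X p -> 0 <= energy_at X p y.
Proof. by move=> Xp; exact: le_trans (dotp_ge0 _) (energy_at_ge _ _ Xp). Qed.

Let has_inf_energy y : has_inf [set energy_at X p y | p in Xs].
Proof.
split; first by have [p Xsp] := Xs_nonempty; exists (energy_at X p y), p.
by exists 0 => _ [p /XsX Xp <-]; exact: energy_at_ge0.
Qed.

Lemma energy_infE y : energy X Xs y = (energy_inf y)%:E.
Proof.
rewrite /energy /energy_inf -ereal_inf_EFin.
- by congr ereal_inf; rewrite image_comp.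
- by have [] := has_inf_energy y.
- by have [] := has_inf_energy y.
Qed.

Lemma energy_inf_le p y : Xs p -> energy_inf y <= energy_at X p y.
Proof. by move=> Xsp; apply: ge_inf; [have [] := has_inf_energy y | exists p]. Qed.

Lemma le_energy_inf c y : (forall p, Xs p -> c <= energy_at X p y) ->
  c <= energy_inf y.
Proof.
move=> h; apply: lb_le_inf; first by have [] := has_inf_energy y.
by move=> _ [p Xsp <-]; exact: h.
Qed.

Lemma energy_inf_ge0 y : 0 <= energy_inf y.
Proof. by apply: le_energy_inf => p /XsX; exact: energy_at_ge0. Qed.

Lemma energy_at_lip p (D : R) : (forall x y, X x -> X y -> enorm (x - y) <= D) ->
  X p -> forall y z, `|energy_at X p y - energy_at X p z| <= 2 * D * enorm (y - z).
Proof.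
move=> XD Xp.
have h y z : energy_at X p y - energy_at X p z <= 2 * D * enorm (y - z).
  have := energy_at_incr p z (y - z); rewrite (addrC z) subrK => /le_trans -> //.
  rewrite -mulrA ler_pM2l // (le_trans (dotp_le _ _)) // mulrC.
  by rewrite ler_wpM2r ?enorm_ge0 // XD //; exact: projX.
by move=> y z; apply: norm_sub_le; rewrite // enormB.
Qed.

Lemma energy_inf_lip (D : R) : (forall x y, X x -> X y -> enorm (x - y) <= D) ->
  forall y z, `|energy_inf y - energy_inf z| <= 2 * D * enorm (y - z).
Proof.
move=> XD.
have h y z : energy_inf y - energy_inf z <= 2 * D * enorm (y - z).
  rewrite lerBlDl -lerBlDr; apply: le_energy_inf => p Xsp.
  rewrite lerBlDr (le_trans (energy_inf_le _ y Xsp)) // addrC -lerBlDr.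
  by rewrite (le_trans (ler_norm _)) // energy_at_lip //; exact: XsX.
by move=> y z; apply: norm_sub_le; rewrite // enormB.
Qed.

Lemma edist_to_ge0 x : (0 <= edist_to x Xs)%E.
Proof. by apply: le_ereal_inf_tmp => _ [p _ <-]; rewrite lee_fin enorm_ge0. Qed.

Lemma edist_to_le_energy y :
  (edist_to (pr y) Xs <= (Num.sqrt (energy_inf y))%:E)%E.
Proof.
apply/lee_addgt0Pr => e e0; rewrite -EFinD.
(* The infimum over [Xs] need not be attained; this is the slack that keeps the energy of a
   near-minimizer below [(sqrt E + e) ^ 2]. *)
have e'0 : 0 < (Num.sqrt (energy_inf y) + e) ^+ 2 - energy_inf y.
  rewrite -{2}(sqr_sqrtr (energy_inf_ge0 y)) subr_gt0 ltr_pXn2r ?ltrDl //.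
    by rewrite nnegrE sqrtr_ge0.
  by rewrite nnegrE addr_ge0 ?sqrtr_ge0 // ltW.
have [_ [p Xsp <-]] := inf_adherent e'0 (has_inf_energy y).
rewrite -/(energy_inf y) addrC subrK => pe.
apply: le_trans (_ : (enorm (pr y - p))%:E <= _)%E.
  by apply: ereal_inf_lbound; exists p.
rewrite lee_fin ltW // -(ltr_pXn2r (n := 2)) ?nnegrE ?enorm_ge0 //.
  by rewrite enorm_sqr (le_lt_trans (energy_at_ge p y (XsX p Xsp))).
by rewrite addr_ge0 ?sqrtr_ge0 // ltW.
Qed.

End energy.
End projection.

(** * Measurability of vector-valued maps *)

Section measurable_vectors.
Context {R : realType} {d : nat}.

Definition measurable_rV {dT} {T : measurableType dT} (xi : T -> 'rV[R]_d) :=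
  forall i, measurable_fun setT (fun t => xi t 0 i).

Section closure.
Context {dT : measure_display} {T : measurableType dT}.
Implicit Types xi : T -> 'rV[R]_d.

Lemma measurable_rV_cst (v : 'rV[R]_d) : measurable_rV (fun _ : T => v).
Proof. by move=> i; exact: measurable_cst. Qed.

Lemma measurable_rVD xi1 xi2 : measurable_rV xi1 -> measurable_rV xi2 ->
  measurable_rV (fun t => xi1 t + xi2 t).
Proof.
move=> m1 m2 i; under eq_fun do rewrite mxE.
exact: measurable_funD (m1 i) (m2 i).
Qed.

Lemma measurable_rVZ (a : R) xi : measurable_rV xi ->
  measurable_rV (fun t => a *: xi t).
Proof.
move=> m i; under eq_fun do rewrite mxE.
exact: measurable_funM (measurable_cst _) (m i).
Qed.

Lemma measurable_rVB xi1 xi2 : measurable_rV xi1 -> measurable_rV xi2 ->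
  measurable_rV (fun t => xi1 t - xi2 t).
Proof.
move=> m1 m2; under [X in measurable_rV X]eq_fun do rewrite -scaleN1r.
exact: measurable_rVD m1 (measurable_rVZ _ _ m2).
Qed.

Lemma measurable_dotp xi1 xi2 : measurable_rV xi1 -> measurable_rV xi2 ->
  measurable_fun setT (fun t => dotp (xi1 t) (xi2 t)).
Proof.
move=> m1 m2; apply: measurable_sum => i.
exact: measurable_funM (m1 i) (m2 i).
Qed.

Lemma measurable_enorm xi : measurable_rV xi ->
  measurable_fun setT (fun t => enorm (xi t)).
Proof.
move=> m; apply: (measurableT_comp _ (measurable_dotp _ _ m m)).
by apply: continuous_measurable_fun; exact: sqrt_continuous.
Qed.

End closure.

Lemma measurable_rV_comp {dT dU} {T : measurableType dT} {U : measurableType dU}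
  (xi : T -> 'rV[R]_d) (h : U -> T) :
  measurable_fun setT h -> measurable_rV xi -> measurable_rV (xi \o h).
Proof. by move=> mh mxi i; exact: measurableT_comp (mxi i) mh. Qed.

(* [xi] is approximated by maps with values in a grid, hence in a countable set. *)
Lemma measurable_fun_caratheodory {dT dU} {T : measurableType dT}
    {U : measurableType dU} (H : 'rV[R]_d -> U -> R) (xi : T -> 'rV[R]_d) :
  measurable_rV xi -> (forall x, measurable_fun setT (H x)) ->
  (forall u, continuous (H^~ u)) ->
  measurable_fun setT (fun tu : T * U => H (xi tu.1) tu.2).
Proof.
move=> mxi mH cH.
pose fl n t : 'rV[int]_d := \row_i Num.floor (n.+1%:R * xi t 0 i).
pose pt n (q : 'rV[int]_d) : 'rV[R]_d := \row_i ((q 0 i)%:~R / n.+1%:R).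
apply: (@measurable_fun_cvg _ _ _ _
  (fun n (tu : T * U) => H (pt n (fl n tu.1)) tu.2)); last first.
  move=> -[t u] _ /=.
  apply: (@cvg_comp _ _ _ (fun n => pt n (fl n t)) (H^~ u) _ (nbhs (xi t)));
    last exact: cH.
  apply/cvgrPdist_lt => e e0; near=> n.
  rewrite (le_lt_trans (_ : _ <= n.+1%:R^-1)) //; last first.
    near: n; exact: near_infty_natSinv_lt (PosNum e0).
  rewrite [leLHS]mx_normrE; apply/bigmax_leP; split; first by rewrite invr_ge0.
  move=> [i j] _ /=; rewrite ord1 !mxE.
  have /andP[lo up] := mem_rg1_floor (n.+1%:R * xi t 0 j).
  have n0 : (0 : R) < n.+1%:R by [].
  rewrite -(ler_pM2l n0) -[X in X * `|_|]gtr0_norm // -normrM mulrBr.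
  rewrite mulrCA !divff ?gt_eqF // mulr1 ger0_norm ?subr_ge0 //.
  by rewrite lerBlDl -intrD1 ltW // -floor_lt_int ltzD1.
move=> n _ B mB; rewrite setTI.
(* The grid is countable, so the preimage is a countable union of rectangles, one for each value of
   the rounded point. *)
have -> : (fun tu : T * U => H (pt n (fl n tu.1)) tu.2) @^-1` B =
    \bigcup_(q : 'rV[int]_d) ((fl n @^-1` [set q]) `*` (H (pt n q) @^-1` B)).
  apply/seteqP; split => [[t u] /= Btu|[t u] [q _ [/= <- //]]].
  by exists (fl n t).
apply: countable_bigcupT_measurable => // q; apply: measurableX; last first.
  by rewrite -[X in measurable X]setTI; exact: mH.
have -> : fl n @^-1` [set q] = \bigcap_(i in [set: 'I_d])
    [set t | Num.floor (n.+1%:R * xi t 0 i) = q 0 i].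
  apply/seteqP; split => [t /= <- i _ /=|t ht /=]; first by rewrite mxE.
  by apply/rowP => i; rewrite mxE; exact: ht.
apply: fin_bigcap_measurable => // i _.
have -> : [set t | Num.floor (n.+1%:R * xi t 0 i) = q 0 i] =
    (fun t => n.+1%:R * xi t 0 i) @^-1` `[(q 0 i)%:~R, (q 0 i + 1)%:~R[.
  apply/seteqP; split => t /=; rewrite in_itv /= => h.
    by rewrite -h floor_itv.
  exact: floor_def.
rewrite -[X in measurable X]setTI.
exact: (measurable_funM (measurable_cst _) (mxi i)).
Unshelve. all: by end_near. Qed.

Lemma measurable_fun_continuous_comp {dT} {T : measurableType dT}
    (h : 'rV[R]_d -> R) (xi : T -> 'rV[R]_d) :
  measurable_rV xi -> continuous h -> measurable_fun setT (h \o xi).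
Proof.
move=> mxi ch.
have m := measurable_fun_caratheodory (fun x (_ : T) => h x) xi mxi
  (fun x => measurable_cst _) (fun _ => ch).
apply: (@measurableT_comp _ _ _ _ _ _ _ _ (fun t : T => (t, t)) m).
exact: measurable_fun_pair.
Qed.

End measurable_vectors.

(** * The orthogonal projector onto the directions of [X] *)

Section tangent.
Context {R : realType} {d : nat}.

Lemma gram_unit m (A : 'M[R]_(m, d)) : row_free A -> A *m A^T \in unitmx.
Proof.
move=> Afree; rewrite -row_free_unit -kermx_eq0 -submx0.
apply/rV_subP => u /sub_kermxP; rewrite mulmxA => uAA.
have uA0 : u *m A = 0.
  apply: dotp_eq0; rewrite dotp_mxE trmx_mul mulmxA uAA.
  by rewrite mul0mx mxE.
by rewrite submx0 -(mulmx_free_eq0 _ Afree) uA0.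
Qed.

(** The rows of [A] are a largest linearly independent family of differences [z - x0] with [z] in
    [X], and [A^T (A A^T)^-1 A] projects orthogonally onto their span. Writing the rows of [T] as
    combinations of such differences later expresses the tangential part of a gradient by
    derivatives in directions of [X]. *)
Lemma tangent_projector (X : set 'rV[R]_d) (x0 : 'rV[R]_d) :
  exists T : 'M[R]_d, [/\ T^T = T, T *m T = T,
    forall x, X x -> (x - x0) *m T = x - x0 &
    forall i, exists m (c : 'I_m -> R) (z : 'I_m -> 'rV[R]_d),
      (forall k, X (z k)) /\ row i T = \sum_k c k *: (z k - x0)].
Proof.
pose P m := `[< exists2 A : 'M[R]_(m, d), \rank A = m &
  forall k, exists2 z, X z & row k A = z - x0 >].
have exP : exists m, P m.
  exists 0%N; apply/asboolP; exists 0; first by rewrite mxrank0.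
  by move=> -[k klt]; exfalso; move: klt; rewrite ltn0.
have maxP m : P m -> (m <= d)%N by move=> /asboolP[A Am _]; rewrite -Am rank_leq_col.
have [m /asboolP[A Am Az] mmax] := ex_maxnP exP maxP.
have Afree : row_free A by rewrite /row_free Am.
have spanA x : X x -> (x - x0 <= A)%MS.
  move=> Xx; apply: contrapT => /negP xA.
  (* A difference outside the row space could be appended to [A], against the maximality of [m]. *)
  suff : P (m + 1)%N by move/mmax; rewrite addn1 ltnn.
  apply/asboolP; exists (col_mx A (x - x0)).
    suff : (\rank A < \rank (col_mx A (x - x0)))%N.
      move=> lt; apply/eqP; rewrite eqn_leq rank_leq_row /=.
      by apply: leq_trans lt; rewrite Am addn1.
    apply: rank_ltmx; rewrite ltmxE -addsmxE addsmxSl /=.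
    by apply: contra xA; rewrite col_mx_sub => /andP[].
  move=> k; rewrite -[k]splitK; case: (fintype.split k) => j /=.
    by rewrite rowKu; exact: Az.
  by exists x => //; rewrite rowKd ord1 row_id.
have Bunit := gram_unit _ _ Afree; set B := A *m A^T in Bunit.
have BT : B^T = B by rewrite trmx_mul trmxK.
pose T := A^T *m invmx B *m A.
have AT : A *m T = A by rewrite /T !mulmxA mulmxV // mul1mx.
exists T; split.
- by rewrite /T !trmx_mul trmxK trmx_inv BT mulmxA.
- by rewrite {1}/T -mulmxA AT.
- by move=> x /spanA/submxP[u ->]; rewrite -mulmxA AT.
move=> i.
exists m, (fun k => (A^T *m invmx B) i k).
have /choice[z zX] : forall k, exists z, X z /\ row k A = z - x0.
  by move=> k; have [z] := Az k; exists z.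
exists z; split=> [k|]; first exact: (zX k).1.
rewrite /T row_mul mulmx_sum_row; apply: eq_bigr => k _.
by rewrite (zX k).2 mxE.
Qed.

Lemma projector_contraction (T : 'M[R]_d) u :
  T^T = T -> T *m T = T -> enorm (u *m T) <= enorm u.
Proof.
move=> TT T2; have [->|uT0] := eqVneq (enorm (u *m T)) 0; first exact: enorm_ge0.
have uTp : 0 < enorm (u *m T) by rewrite lt_def uT0 enorm_ge0.
rewrite -(ler_pM2r uTp) -expr2 enorm_sqr.
by rewrite dotp_mulmx TT -mulmxA T2; exact: dotp_le.
Qed.

End tangent.

(** * Gradients within [X] and their joint measurability *)

Section gradient.
Context {R : realType} {d : nat}.

Lemma gradient_within_expansion (X : set 'rV[R]_d) (h : 'rV[R]_d -> R) x g :
  gradient_within X h x g -> forall e : R, 0 < e ->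
  exists2 r : R, 0 < r & forall y, X y -> enorm (x - y) < r ->
    `|h y - h x - dotp g (y - x)| <= e * enorm (y - x).
Proof.
move=> hg e e0; have /cvgrPdist_le/(_ e e0) := hg.
rewrite /within /= => /nbhs_enorm[r r0 hr].
exists r => // y Xy xy; have [->|yx] := eqVneq y x.
  by rewrite !subrr dotpC dotp0l subrr normr0 mulr_ge0 ?enorm_ge0 // ltW.
have yx0 : 0 < enorm (y - x).
  rewrite lt_def enorm_ge0 andbT; apply: contra yx => /eqP/enorm_eq0/eqP.
  by rewrite subr_eq0.
have := hr y xy; rewrite sub0r normrN normrM normfV (gtr0_norm yx0).
by rewrite ler_pdivrMr //; apply.
Qed.

Lemma gradient_within_continuous (X : set 'rV[R]_d) (h : 'rV[R]_d -> R) :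
  (forall x, X x -> exists g, gradient_within X h x g) -> {within X, continuous h}.
Proof.
move=> hg; apply/continuous_withinP => x Xx e e0; have [g xg] := hg x Xx.
have [r r0 hr] := gradient_within_expansion _ _ _ _ xg 1 ltr01.
pose k := enorm g + 1; have k0 : 0 < k by rewrite ltr_wpDl ?enorm_ge0.
exists (Num.min r (e / k)); first by rewrite lt_min r0 divr_gt0.
move=> y Xy; rewrite lt_min ltr_pdivlMr // => /andP[xr xe].
have := hr y Xy xr; rewrite mul1r => hy.
rewrite distrC (le_lt_trans _ xe) //.
rewrite -(subrK (dotp g (y - x)) (h y - h x)).
rewrite (le_trans (ler_normD _ _)) // mulrDr mulr1 addrC enormB lerD //.
by rewrite mulrC; exact: cauchy_schwarz.
Qed.

Section joint.
Context {dO : measure_display} {Omega : measurableType dO}.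
Variables (X : set 'rV[R]_d) (F : 'rV[R]_d -> Omega -> R).
Variables (G : 'rV[R]_d -> Omega -> 'rV[R]_d) (N : set Omega).
Hypothesis X_nonempty : X !=set0.
Hypothesis X_convex : convex_set (X : set (convex_lmodType 'rV[R]_d)).
Hypothesis X_compact : compact X.
Hypothesis N_measurable : measurable N.
Hypothesis F_measurable : forall x, X x -> measurable_fun setT (F x).
Hypothesis F_gradient : forall u, ~ N u -> forall x, X x ->
  gradient_within X (F^~ u) x (G x u).
Local Notation pr := (Defs.proj X).
Local Notation prX := (projX X_nonempty X_compact).

(** Composing with the projection and erasing [N] makes this continuous in [x] for every [u] without
    exception, as the Caratheodory argument requires. *)
Let F' x u := if u \in N then 0 else F (pr x) u.

Let measurable_offN (f : Omega -> R) : measurable_fun setT f ->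
  measurable_fun setT (fun u => if u \in N then 0 else f u).
Proof.
move=> mf.
rewrite (_ : (fun _ => _) = (fun u => f u * \1_(~` N) u)); last first.
  apply/funext => u; rewrite indicE in_setC.
  by case: (u \in N); rewrite ?mulr0 ?mulr1.
apply: measurable_funM => //; apply: measurable_indic; exact: measurableC.
Qed.

Let continuous_F' u : continuous (F'^~ u).
Proof.
apply/continuous_enormP => x e e0; rewrite /F'.
case: (boolP (u \in N)) => [_ |/negP uN].
  by exists 1 => // y _; rewrite subrr normr0.
have {}uN : ~ N u by move/mem_set/uN.
have /continuous_withinP hc : {within X, continuous F^~ u}.
  by apply: gradient_within_continuous => y Xy; exists (G y u); exact: F_gradient.
have [r r0 hr] := hc _ (prX x) e e0; exists r => // y xy; apply: hr.
  exact: prX.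
by apply: le_lt_trans xy; exact: proj_lip.
Qed.

(** Three corrections of [G]: it is extended to all points through the projection, set to zero on
    the exceptional samples, and reduced to its component along [X], the one that [F] determines. *)
Definition offnull_gradient (T : 'M[R]_d) x u : 'rV[R]_d :=
  if u \in N then 0 else G (pr x) u *m T.

(** Derivatives of [F] towards points of [X] are limits of difference quotients, hence jointly
    measurable; the coordinates of the tangential gradient are fixed finite combinations of them, by
    the form of the rows of [T]. *)
Lemma measurable_offnull_gradient x0 (T : 'M[R]_d) :
  X x0 -> T^T = T ->
  (forall i, exists m (c : 'I_m -> R) (z : 'I_m -> 'rV[R]_d),
      (forall k, X (z k)) /\ row i T = \sum_k c k *: (z k - x0)) ->
  forall dT (S : measurableType dT) (xi : S -> 'rV[R]_d), measurable_rV xi ->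
  measurable_rV (fun p : S * Omega => offnull_gradient T (xi p.1) p.2).
Proof.
move=> Xx0 TT Tspan dT S xi mxi.
have mpr : measurable_rV (pr \o xi).
  move=> i; apply: (measurable_fun_continuous_comp (fun x => pr x 0 i) _ mxi).
  apply: (@lipschitz_continuous _ _ 1) => x y; rewrite mul1r.
  rewrite (le_trans _ (proj_lip X_nonempty X_convex X_compact x y)) //.
  by have := coord_le_enorm (pr x - pr y) i; rewrite !mxE.
pose D z (p : S * Omega) := if p.2 \in N then 0 else
  dotp (G (pr (xi p.1)) p.2) (z - pr (xi p.1)).
have mD z : X z -> measurable_fun setT (D z).
  move=> Xz.
  (* By convexity these points of the segment from [pr (xi t)] to [z] remain in [X], where the
     expansion of [F] holds. *)
  pose xin n t := pr (xi t) + n.+1%:R^-1 *: (z - pr (xi t)).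
  have mxin n : measurable_rV (xin n).
    apply: measurable_rVD => //; apply: measurable_rVZ.
    by apply: measurable_rVB => //; exact: measurable_rV_cst.
  have mF' (x : S -> 'rV[R]_d) : measurable_rV x ->
      measurable_fun setT (fun p : S * Omega => F' (x p.1) p.2).
    move=> mx; apply: (measurable_fun_caratheodory F' x mx _ continuous_F') => y.
    by apply: measurable_offN; exact: F_measurable (prX y).
  apply: (@measurable_fun_cvg _ _ R setT (fun n (p : S * Omega) =>
    n.+1%:R * (F' (xin n p.1) p.2 - F' (xi p.1) p.2)) (D z)).
    move=> n; apply: measurable_funM => //.
    by apply: measurable_funB; exact: mF'.
  move=> [t u] _; rewrite /F' /D /=; case: ifPn => [_|/negP uN].
    by under eq_fun do rewrite subrr mulr0; exact: cvg_cst.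
  have {}uN : ~ N u by move/mem_set/uN.
  set x := pr (xi t); have Xx : X x := prX _.
  have n1 n : (0 <= (n.+1%:R^-1 : R) <= 1).
    by rewrite invr_ge0 ler0n invf_le1 ?ler1n ?ltr0n.
  have Xxin n : X (xin n t) by exact: convex_segment.
  have xinE n : xin n t - x = n.+1%:R^-1 *: (z - x) by rewrite addrC addKr.
  apply/cvgrPdist_le => e e0.
  pose k := enorm (z - x) + 1; have k0 : 0 < k by rewrite ltr_wpDl ?enorm_ge0.
  have [r r0 hr] := gradient_within_expansion _ _ _ _ (F_gradient _ uN _ Xx)
    (e / k) (divr_gt0 e0 k0).
  near=> n; rewrite (proj_id X_nonempty X_convex X_compact _ (Xxin n)).
  have nn : (n.+1%:R^-1 : R) < r / k.
    by near: n; exact: near_infty_natSinv_lt (PosNum (divr_gt0 r0 k0)).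
  have n0 : (0 : R) < n.+1%:R by [].
  have := hr _ (Xxin n); rewrite enormB xinE enormZ gtr0_norm ?invr_gt0 // dotpZr.
  have zk : enorm (z - x) <= k by rewrite lerDl.
  move=> /(_ _)/wrap[].
    rewrite (le_lt_trans (ler_wpM2l _ zk)) ?invr_ge0 //.
    by rewrite -ltr_pdivlMr.
  rewrite -(ler_pM2l n0) -[X in X * `|_|](gtr0_norm n0) -normrM.
  rewrite mulrBr mulVKf ?gt_eqF // mulrCA mulVKf ?gt_eqF // distrC => /le_trans; apply.
  by rewrite mulrAC ler_pdivrMr // ler_wpM2l // ltW.
move=> i; have [m [c [z [zX Ti]]]] := Tspan i.
(* The moving base point [pr (xi t)] cancels in [D (z k) - D x0], which leaves the product of the
   gradient with [z k - x0]. *)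
have -> : (fun p : S * Omega => offnull_gradient T (xi p.1) p.2 0 i) =
    (fun p => \sum_k c k * (D (z k) p - D x0 p)).
  apply/funext => -[t u]; rewrite /offnull_gradient /D /=.
  case: ifP => _; first by rewrite mxE big1 // => k _; rewrite subrr mulr0.
  set g := G _ _; transitivity (dotp g (row i T)).
    rewrite mxE; apply: eq_bigr => j _; rewrite mxE; congr (_ * _).
    by rewrite -{1}TT mxE.
  have dotp_sum (f : 'I_m -> 'rV[R]_d) : dotp g (\sum_k f k) = \sum_k dotp g (f k).
    elim/big_ind2: _ => [|u1 a v b <- <-|//]; first by rewrite dotpC dotp0l.
    by rewrite dotpDr.
  rewrite Ti dotp_sum; apply: eq_bigr => k _; rewrite dotpZr -dotpBr.
  by rewrite opprB addrA subrK.
apply: measurable_sum => k; apply: measurable_funM => //.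
by apply: measurable_funB; apply: mD.
Unshelve. all: by end_near. Qed.

End joint.
End gradient.

(** * A mean value inequality for functions that are merely differentiable *)

Section increment_bound.
Context {R : realType}.
Local Notation mu := (@lebesgue_measure R).
Local Open Scope ereal_scope.

Let le_mu (A B : set R) : measurable A -> measurable B -> A `<=` B -> mu A <= mu B.
Proof. by move=> mA mB AB; apply: le_measure => //; rewrite inE. Qed.

(** The sum counts levels [k c] below [a], so it is at most [a] rounded up to a multiple of [c]. *)
Lemma level_sum_le (c a : R) n : (0 < c)%R -> (0 <= a)%R ->
  \sum_(0 <= k < n) (c * (k%:R * c < a)%R%:R)%:E <= (a + c)%:E.
Proof.
move=> c0 a0; rewrite sumEFin lee_fin.
(* The bound by [n c] is carried along for the induction: if level [n] lies below [a], the earlier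
   terms sum to at most [n c < a]. *)
suff : (\sum_(0 <= k < n) c * (k%:R * c < a)%R%:R <= Num.min (n%:R * c) (a + c))%R.
  by rewrite le_min => /andP[].
elim: n => [|n IH].
  by rewrite big_geq // mul0r le_min lexx addr_ge0 // ltW.
rewrite big_nat_recr //= le_min; move: IH; rewrite le_min => /andP[IH1 IH2].
have n1 : (n.+1%:R * c = n%:R * c + c)%R by rewrite -addn1 natrD mulrDl mul1r.
apply/andP; split.
  by rewrite n1 lerD // ler_piMr ?(ltW c0) // lern1 leq_b1.
case: ltP => nc /=; last by rewrite mulr0 addr0.
by rewrite mulr1 lerD // (le_trans IH1) // ltW.
Qed.

(* A weak form of the Vitali-Caratheodory theorem. *)
Lemma open_majorant (A : set R) (D : R -> R) (c : R) :
  (0 < c)%R -> measurable A -> mu A <= 1 -> measurable_fun setT D ->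
  exists g : R -> \bar R, [/\ measurable_fun setT g, forall t, 0 <= g t,
    \int[mu]_(t in A) g t <= \int[mu]_(t in A) `|D t|%:E + (c + c)%:E &
    forall t, A t -> \forall s \near t, `|D t|%:E <= g s].
Proof.
move=> c0 mA muA mD.
have c0' : (0 <= c)%R by exact: ltW.
pose E k := A `&` [set t | (k%:R * c < `|D t|)%R].
have mE k : measurable (E k).
  apply: measurableI => //.
  have -> : [set t | (k%:R * c < `|D t|)%R] =
      (fun t => `|D t|%R) @^-1` `](k%:R * c)%R, +oo[%classic.
    by apply/seteqP; split => t /=; rewrite in_itv /= andbT.
  rewrite -[X in measurable X]setTI.
  by apply: (measurableT_comp (@normr_measurable _ _)) => //.
have muE k : mu (E k) < +oo.
  rewrite (@le_lt_trans _ _ 1) ?ltry // (le_trans _ muA) //.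
  by apply: le_mu => // t [].
have e0 k : (0 < 1 / (2 ^ k.+1)%:R :> R)%R by rewrite divr_gt0 // ltr0n expn_gt0.
have /choice[U UE] : forall k, exists U : set R, [/\ open U, E k `<=` U &
    mu (U `\` E k) < (1 / (2 ^ k.+1)%:R)%:E].
  by move=> k; apply: lebesgue_regularity_outer; [exact: mE|exact: muE|exact: e0].
have mU k : measurable (U k) by have [oU _ _] := UE k; exact: open_measurable.
have muU k : mu (U k `&` A) <= mu (E k) + (1 / (2 ^ k.+1)%:R)%:E.
  have [_ EU lt] := UE k.
  apply: (@le_trans _ _ (mu (U k))).
    apply: le_mu; [exact: measurableI | exact: mU | by move=> t []].
  rewrite (measureDI mu (mU k) (mE k)) addeC leeD ?(ltW lt) //.
  by rewrite (setIidr EU).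
(* The layers of [|D|] in steps of [c], each widened to an open set, which makes [g] lower
   semicontinuous. Widening layer [k] costs at most [c / 2 ^ (k + 1)], in total [c]; rounding costs
   another [c] because [A] has measure at most 1. *)
pose g t := \sum_(0 <= k <oo) (c * \1_(U k) t)%:E.
have t0 k t : 0 <= (c * \1_(U k) t)%:E by rewrite lee_fin mulr_ge0.
have mt (V : set R) : measurable V ->
    measurable_fun setT (fun t => (c * \1_V t)%:E).
  by move=> mV; apply/measurable_EFinP; apply: measurable_funM.
have intc (V : set R) : measurable V ->
    \int[mu]_(t in A) (c * \1_V t)%:E = c%:E * mu (V `&` A).
  move=> mV; under eq_integral do rewrite EFinM.
  rewrite ge0_integralZl_EFin // ?integral_indic //.
  exact/measurable_EFinP.
exists g; split.
- by apply: ge0_emeasurable_sum => // k t _; exact: mt.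
- by move=> t; apply: nneseries_ge0.
- rewrite integral_nneseries //; last by move=> k; apply: measurable_funTS; exact: mt.
  apply: (@le_trans _ _ (\sum_(0 <= k <oo) (c%:E * mu (E k) +
      (c / (2 ^ k.+1)%:R)%:E))).
    apply: lee_nneseries => [k _ _|k _]; rewrite intc //.
      by rewrite mule_ge0 ?lee_fin.
    rewrite (le_trans (lee_wpmul2l _ (muU k))) ?lee_fin //.
    by rewrite ge0_muleDr ?lee_fin ?(ltW (e0 k)) // -EFinM mulrA mulr1.
  apply: le_trans (epsilon_trick _ _ c0') _.
    by move=> k; rewrite mule_ge0 ?lee_fin.
  rewrite EFinD addeA leeD2r //.
  have -> : \sum_(0 <= k <oo) (c%:E * mu (E k)) =
      \int[mu]_(t in A) \sum_(0 <= k <oo) (c * \1_(E k) t)%:E.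
    rewrite integral_nneseries //.
    - apply: eq_eseriesr => k _; rewrite intc //.
      by rewrite (setIidl (@subIsetl _ _ _)).
    - by move=> k; apply: measurable_funTS; exact: mt.
    - by move=> k t _; rewrite lee_fin mulr_ge0.
  apply: (@le_trans _ _ (\int[mu]_(t in A) (`|D t|%:E + c%:E))).
    apply: ge0_le_integral => //.
    - by move=> t _; apply: nneseries_ge0 => k _ _; rewrite lee_fin mulr_ge0.
    - apply: measurable_funTS; apply: ge0_emeasurable_sum => [k t _ _|k _].
        by rewrite lee_fin mulr_ge0.
      exact: mt.
    - apply: emeasurable_funD => //; apply: measurable_funTS.
      by apply/measurable_EFinP; apply: measurableT_comp.
    move=> t At; apply: lime_le.
      by apply: is_cvg_nneseries => k _ _; rewrite lee_fin mulr_ge0.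
    near=> n; rewrite -EFinD (le_trans _ (level_sum_le _ _ n c0 (normr_ge0 (D t)))) //.
    apply: lee_sum => k _; rewrite lee_fin ler_wpM2l // indicE.
    by rewrite ler_nat; case: (boolP (t \in E k)) => // /set_mem[_ /= ->].
  rewrite ge0_integralD //; last first.
    by apply: measurable_funTS; apply/measurable_EFinP; apply: measurableT_comp.
  rewrite leeD2l // integral_cst // -[leRHS]mule1.
  by rewrite lee_wpmul2l ?lee_fin.
move=> t At.
(* Only finitely many levels lie below [|D t|], so the open sets belonging to them have a common
   neighbourhood of [t]. *)
have [K tK Kmin] : exists2 K : nat, (`|D t| <= K%:R * c)%R &
    forall k, (k < K)%N -> (k%:R * c < `|D t|)%R.
  have exK : exists K : nat, (`|D t| <= K%:R * c)%R.
    exists (Num.truncn (`|D t| / c)).+1.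
    by rewrite -ler_pdivrMr // ltW // truncnS_gt.
  exists (ex_minn exK); case: ex_minnP => // K _ Kmin k kK.
  by rewrite ltNge; apply/negP => /Kmin; rewrite leqNgt kK.
have : \forall s \near t, forall k : 'I_K, U k s.
  apply: (@filter_forall R 'I_K (fun k => U k) (nbhs t)) => k.
  have [oU EU _] := UE k; apply: open_nbhs_nbhs; split => //; apply: EU; split => //.
  exact: Kmin.
apply: filterS => s Us.
apply: le_trans (nneseries_lim_ge K _) => //.
rewrite sumEFin lee_fin (le_trans tK) // big_mkord.
rewrite (eq_bigr (fun=> c)); last first.
  by move=> k _; rewrite indicE mem_set ?mulr1.
by rewrite sumr_const card_ord mulr_natl.
Unshelve. all: by end_near. Qed.

(** The derivative [D] exists at every point of the interval but need not be continuous, nor even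
    integrable: the right-hand side may be infinite. So [phi] is compared with the integral of a
    lower semicontinuous majorant of [|D|], which bounds the increments near each point, by
    continuous induction along the interval. *)
Lemma increment_le_integral_norm (phi D : R -> R) :
  measurable_fun setT D ->
  (forall t : R, (0 <= t <= 1)%R -> forall e : R, (0 < e)%R ->
    exists2 r : R, (0 < r)%R & forall s : R, (0 <= s <= 1)%R -> (`|t - s| < r)%R ->
      (`|phi s - phi t - D t * (s - t)| <= e * `|s - t|)%R) ->
  `|phi 1%R - phi 0%R|%:E <= \int[mu]_(t in `[0%R, 1%R]) `|D t|%:E.
Proof.
move=> mD phiD; apply/lee_addgt0Pr => e e0.
(* Two thirds of [e] pay for the majorant, one third for the slope error [c * x]. *)
pose c := (e / 3)%R; have c0 : (0 < c)%R by rewrite divr_gt0.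
have mu1 : mu `[0%R, 1%R]%classic <= 1 :> \bar R.
  by rewrite lebesgue_measure_itv /= lte_fin ltr01 sube0.
have [g [mg g0 gint gD]] := open_majorant `[0%R, 1%R] D c c0 (measurable_itv _)
  mu1 mD.
pose I x := \int[mu]_(t in `[0%R, x]) g t.
have Isplit x y : (0 <= x <= y)%R -> I y = I x + \int[mu]_(t in `]x, y]) g t.
  move=> /andP[x0 xy]; rewrite /I (_ : `[0%R, y]%classic = `[0%R, x] `|` `]x, y]).
    rewrite ge0_integral_setU //; first exact: measurable_funTS.
    apply/disj_setPS => t [] /=; rewrite !in_itv /= => /andP[_ tx] /andP[xt _].
    by have := lt_le_trans xt tx; rewrite ltxx.
  apply/seteqP; split => t /=; rewrite !in_itv /=.
    by case: (leP t x) => [tx /andP[-> _]|xt /andP[_ ->]]; [left|right].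
  move=> [/andP[-> tx]|/andP[xt ->]]; first by rewrite (le_trans tx).
  by rewrite (le_trans x0 (ltW xt)).
(* The point [t] may be either end of the interval: as right end it shows that the supremum below
   belongs to [P], as left end that the supremum could be passed if it were less than 1. *)
have local t : (0 <= t <= 1)%R -> exists2 r : R, (0 < r)%R &
    forall x y, (0 <= x <= y)%R -> (y <= 1)%R -> (x = t \/ y = t) ->
      (y - x < r)%R ->
      `|phi y - phi x|%:E <= \int[mu]_(s in `]x, y]) g s + (c * (y - x))%:E.
  move=> t01; have [r1 r10 h1] := phiD t t01 c c0.
  have : \forall s \near t, `|D t|%:E <= g s by apply: gD; rewrite /= in_itv.
  move=> /nbhs_ballP[r2 /= r20 h2].
  exists (Num.min r1 r2); first by rewrite lt_min r10.
  move=> x y /andP[x0 xy] y1 xyt; rewrite lt_min => /andP[xr1 xr2].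
  have xy0 : (0 <= y - x)%R by rewrite subr_ge0.
  have le1 : (`|phi y - phi x| <= (`|D t| + c) * (y - x))%R.
    have aux s : (0 <= s <= 1)%R -> (`|t - s| < r1)%R ->
        (`|phi s - phi t| <= (`|D t| + c) * `|s - t|)%R.
      move=> s01 st; rewrite -(subrK (D t * (s - t))%R (phi s - phi t)%R).
      rewrite (le_trans (ler_normD _ _)) // mulrDl addrC lerD ?normrM //.
      exact: h1.
    case: xyt => tE; [subst x | subst y].
      have := aux y; rewrite (distrC t) (ger0_norm xy0); apply => //.
      by rewrite (le_trans x0 xy).
    have := aux x; rewrite (distrC x) (ger0_norm xy0) (distrC (phi x)).
    apply => //.
    by rewrite x0 (le_trans xy y1).
  apply: (@le_trans _ _ ((`|D t| * (y - x))%:E + (c * (y - x))%:E)).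
    by rewrite -EFinD lee_fin -mulrDl.
  rewrite leeD2r //.
  have -> : (`|D t| * (y - x))%:E = \int[mu]_(s in `]x, y]) (cst `|D t|%:E) s.
    rewrite integral_cst //= lebesgue_measure_itv /= lte_fin EFinM; congr (_ * _).
    case: ltP => // yx; have -> : y = x by apply/eqP; rewrite eq_le yx.
    by rewrite subrr.
  apply: ge0_le_integral => //.
  - by move=> s _; rewrite /= lee_fin.
  - exact: measurable_funTS mg.
  move=> s; rewrite /= in_itv /= => /andP[xs sy]; apply: h2.
  rewrite /ball /=; case: xyt => <-.
    by rewrite distrC ger0_norm ?subr_ge0 ?(ltW xs) // (le_lt_trans _ xr2) // lerB.
  by rewrite ger0_norm ?subr_ge0 // (le_lt_trans _ xr2) // lerB // ltW.
pose P x := (0 <= x <= 1)%R /\ `|phi x - phi 0%R|%:E <= I x + (c * x)%:E.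
have step x y : P x -> (x <= y <= 1)%R ->
    `|phi y - phi x|%:E <= \int[mu]_(s in `]x, y]) g s + (c * (y - x))%:E -> P y.
  move=> [/andP[x0 x1] Px] /andP[xy y1] h; split; first by rewrite (le_trans x0 xy).
  rewrite (Isplit x y) ?x0 //.
  apply: (@le_trans _ _ (`|phi x - phi 0%R|%:E + `|phi y - phi x|%:E)).
    rewrite -EFinD lee_fin.
    have -> : (phi y - phi 0 = (phi x - phi 0) + (phi y - phi x))%R.
      by rewrite [RHS]addrC addrA subrK.
    exact: ler_normD.
  apply: (le_trans (leeD Px h)).
  have -> : (c * y)%:E = (c * x)%:E + (c * (y - x))%:E.
    by rewrite -EFinD -mulrDr addrC subrK.
  by rewrite addeACA.
have P0 : P 0%R.
  split; first by rewrite lexx ler01.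
  by rewrite subrr normr0 mulr0 adde0 integral_ge0.
have supP : has_sup P.
  by split; [exists 0%R | exists 1%R => x [/andP[]]].
pose x := sup P.
have x01 : (0 <= x <= 1)%R.
  rewrite sup_upper_bound //= ge_sup //; first by exists 0%R.
  by move=> y [/andP[]].
have [r r0 hr] := local x x01.
have Px : P x.
  have [y Py yx] := sup_adherent r0 supP.
  have yx' : (y <= x)%R by exact: sup_upper_bound.
  have [/andP[y0 y1] _] := Py.
  apply: (step y) => //; first by rewrite yx' (andP x01).2.
  apply: hr => //; [by rewrite y0| exact: (andP x01).2 | by right|].
  by rewrite ltrBlDr -ltrBlDl.
have x1 : x = 1%R.
  apply/eqP; rewrite eq_le (andP x01).2 /= leNgt; apply/negP => lt1.
  pose y := Num.min 1%R (x + r / 2)%R.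
  have xy : (x < y)%R by rewrite lt_min lt1 ltrDl divr_gt0.
  have y1 : (y <= 1)%R by rewrite ge_min lexx.
  have Py : P y.
    apply: (step x) => //; first by rewrite (ltW xy).
    apply: hr => //; [by rewrite (andP x01).1 (ltW xy)|by left|].
    rewrite ltrBlDl (@le_lt_trans _ _ (x + r / 2)%R) ?ge_min ?lexx ?orbT //.
    by rewrite ltrD2l ltr_pdivrMr // ltr_pMr // ltr1n.
  by have := sup_upper_bound supP Py; rewrite leNgt xy.
have [_] := Px; rewrite x1 mulr1 => /le_trans; apply.
apply: (@le_trans _ _ (\int[mu]_(t in `[0%R, 1%R]) `|D t|%:E + (c + c)%:E + c%:E)).
  by rewrite leeD2r.
rewrite -addeA leeD2l // -EFinD lee_fin /c; lra.
Qed.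

End increment_bound.

(** * The past of the samples: independence and freezing *)

Section sampling.
Context {R : realType} {dO dS : measure_display}.
Context {Omega : measurableType dO} {S : measurableType dS}.
Context {P : probability Omega R} {Q : probability S R}.
Variable v : nat -> {mfun S >-> Omega}.
Hypothesis v_iid : iid_from P Q v.

Definition past_cylinders n : set (set S) :=
  [set A | exists (J : {fset nat}) (B : nat -> set Omega),
    [/\ forall i, measurable (B i), forall i, i \in J -> (i < n)%N &
        A = \bigcap_(i in [set` J]) (v i @^-1` B i)]].

(** A copy of [S] carrying the sigma-algebra of the samples of index below [n], so that being
    adapted is plain measurability of a map out of [past n]. *)
Definition past n := g_sigma_algebraType (past_cylinders n).

Let v_measurable i (B : set Omega) : measurable B -> measurable (v i @^-1` B).
Proof. by move=> mB; rewrite -[X in measurable X]setTI; exact: measurable_funPT. Qed.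

Lemma past_cylinders_measurable n : past_cylinders n `<=` measurable.
Proof.
move=> _ [J [B [mB _ ->]]]; apply: fin_bigcap_measurable.
  exact: finite_fset.
by move=> i _; exact: v_measurable.
Qed.

Lemma past_measurable n (A : set S) : measurable (A : set (past n)) -> measurable A.
Proof.
apply: smallest_sub; first exact: sigma_algebra_measurable.
exact: past_cylinders_measurable.
Qed.

Lemma past_cylinders_setI n : setI_closed (past_cylinders n).
Proof.
move=> _ _ [J [B [mB Jn ->]]] [J' [B' [mB' J'n ->]]].
pose B'' i := (if i \in J then B i else setT) `&` (if i \in J' then B' i else setT).
exists (J `|` J')%fset, B''; split.
- by move=> i; apply: measurableI; case: ifP.
- by move=> i; rewrite inE => /orP[/Jn|/J'n].
- apply/seteqP; split.
    by move=> o [h h'] i _; split; case: ifPn => // ij; [exact: h | exact: h'].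
  move=> o h; split => i /= iJ; have := h i; rewrite /= inE iJ ?orbT.
    by move=> /(_ isT); rewrite /B'' iJ => -[].
  by move=> /(_ isT); rewrite /B'' iJ => -[].
Qed.

Lemma past_cylindersT n : past_cylinders n setT.
Proof.
exists fset0, (fun=> setT); split => //.
by apply/seteqP; split.
Qed.

(** Both sides are finite measures in [A]: [Q] restricted to the event, and [Q] scaled by its
    probability. They agree on cylinders, which are stable under intersection. *)
Lemma past_independent n (A : set (past n)) (B : set Omega) :
  measurable A -> measurable B ->
  Q (A `&` v n @^-1` B) = (Q A * P B)%E.
Proof.
move=> mA mB; have [vP vQ] := v_iid.
have mvB := v_measurable n _ mB.
have PB : Q (v n @^-1` B) = P B by rewrite -(vP n).
pose r : {nonneg R} := NngNum (fine_ge0 (measure_ge0 P B)).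
have rE : (r%:num)%:E = P B by rewrite /= fineK // fin_num_measure.
suff : mrestr Q mvB A = mscale r Q A by rewrite /mscale rE muleC.
apply: (@g_sigma_algebra_measure_unique _ _ _ _
  (@past_cylinders_measurable n) (fun=> setT) (fun=> past_cylindersT n)) => //.
- by rewrite bigcup_const.
- exact: past_cylinders_setI.
- move=> A0 [J [C [mC Jn A0E]]].
  change (Q (A0 `&` v n @^-1` B) = (r%:num)%:E * Q A0)%E; rewrite rE {}A0E.
  pose C' i := if i == n then B else C i.
  have nJ : n \notin J by apply/negP => /Jn; rewrite ltnn.
  have mC' i : measurable (C' i) by rewrite /C'; case: ifP.
  have C'E i : i \in J -> C' i = C i.
    by rewrite /C'; case: eqP => // -> iJ; rewrite iJ in nJ.
  have := vQ (n |` J)%fset C' mC'.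
  rewrite big_fsetU1 //= {2}/C' eqxx PB.
  rewrite (eq_big_seq (fun i => Q (v i @^-1` C i))); last first.
    by move=> i iJ; rewrite C'E.
  rewrite -vQ // => <-; congr (Q _); apply/seteqP; split.
    move=> o [h vB] i /=; rewrite !inE => /orP[/eqP ->|iJ].
      by rewrite /C' eqxx.
    by rewrite C'E //; exact: h.
  move=> o h; split; last first.
    by have := h n; rewrite /= !inE eqxx /C' eqxx; apply.
  by move=> i iJ; rewrite /= -C'E //; apply: h; rewrite /= !inE iJ orbT.
- move=> _; change (Q (setT `&` v n @^-1` B) < +oo)%E.
  by rewrite setTI (le_lt_trans (probability_le1 _ mvB)) ?ltry.
Qed.

Lemma measurable_id_past n : measurable_fun setT (id : S -> past n).
Proof. by move=> _ A mA; rewrite setTI; exact: (past_measurable n A mA). Qed.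

Let id_past_mfun n : {mfun S >-> past n} :=
  HB.pack (id : S -> past n) (isMeasurableFun.Build _ _ _ _ _ (measurable_id_past n)).

Lemma measurable_past_pair n :
  measurable_fun setT (fun o : S => (o : past n, v n o)).
Proof.
apply: measurable_fun_pair; first exact: measurable_id_past.
exact: measurable_funPT.
Qed.

Let pair_mfun n : {mfun S >-> (past n * Omega)%type} :=
  HB.pack (fun o : S => (o : past n, v n o))
    (isMeasurableFun.Build _ _ _ _ _ (measurable_past_pair n)).

(** By independence the joint law of the past and the next sample is a product measure, so Tonelli's
    theorem integrates out the new sample with the past held fixed. *)
Lemma past_freezing n (f : past n * Omega -> \bar R) :
  measurable_fun setT f -> (forall x, 0 <= f x)%E ->
  (\int[Q]_o f (o, v n o) = \int[Q]_o \int[P]_u f (o, u))%E.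
Proof.
move=> mf f0.
have -> : (\int[Q]_o f (o, v n o) = \int[distribution Q (pair_mfun n)]_x f x)%E.
  by rewrite ge0_integral_distribution.
have lawE (A : set (past n * Omega)) : measurable A ->
    (distribution Q (id_past_mfun n) \x P)%E A = distribution Q (pair_mfun n) A.
  apply: product_measure_unique => B C mB mC.
  have [vP _] := v_iid.
  rewrite [RHS](_ : _ = (Q B * P C)%E) // -past_independent //.
transitivity (\int[distribution Q (id_past_mfun n) \x P]_x f x)%E.
  by apply: eq_measure_integral => A mA _; exact/esym/lawE.
rewrite fubini_tonelli1 // ge0_integral_distribution //.
  exact: measurable_fun_fubini_tonelli_F.
by move=> x; apply: integral_ge0.
Qed.

End sampling.

(** * Moment bounds for random vectors *)

Section moments.
Context {R : realType} {d : nat} {dO : measure_display}.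
Context {Omega : measurableType dO} {P : probability Omega R}.
Implicit Types (g : Omega -> 'rV[R]_d) (v : 'rV[R]_d) (M : R).

(** From [a <= 1 + a ^ 2]; this is the origin of the factor [1 + M] in the Lipschitz constant of the
    objective and in the drift error. *)
Lemma integral_enorm_le g M : measurable_rV g ->
  (\int[P]_u (enorm (g u) ^+ 2)%:E <= M%:E)%E ->
  (\int[P]_u (enorm (g u))%:E <= (1 + M)%:E)%E.
Proof.
move=> mg gM; have mn := measurable_enorm _ mg.
apply: (@le_trans _ _ (\int[P]_u (1%:E + (enorm (g u) ^+ 2)%:E))%E).
  apply: ge0_le_integral => //.
  - by move=> u _; rewrite lee_fin enorm_ge0.
  - exact/measurable_EFinP.
  - apply: emeasurable_funD => //.
    by apply/measurable_EFinP; exact: measurable_funX.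
  - move=> u _; rewrite -EFinD lee_fin.
    have := sqr_ge0 (enorm (g u) - 1); have := enorm_ge0 (g u).
    move: (enorm (g u)) => a; nra.
rewrite ge0_integralD //; last 2 first.
- by move=> u _; rewrite lee_fin sqr_ge0.
- by apply/measurable_EFinP; exact: measurable_funX.
by rewrite integral_cst //= probability_setT mule1 EFinD leeD2l.
Qed.

Lemma integral_abs_dotp_le g M v : measurable_rV g ->
  (\int[P]_u (enorm (g u) ^+ 2)%:E <= M%:E)%E ->
  (\int[P]_u `|dotp (g u) v|%:E <= ((1 + M) * enorm v)%:E)%E.
Proof.
move=> mg gM; have mn := measurable_enorm _ mg.
apply: (@le_trans _ _ (\int[P]_u ((enorm v)%:E * (enorm (g u))%:E))%E).
  apply: ge0_le_integral => //.
  - apply/measurable_EFinP; apply: measurableT_comp => //.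
    by apply: measurable_dotp => //; exact: measurable_rV_cst.
  - by apply: measurable_funeM; exact/measurable_EFinP.
  - by move=> u _; rewrite -EFinM lee_fin mulrC cauchy_schwarz.
rewrite ge0_integralZl_EFin ?enorm_ge0 //; last exact/measurable_EFinP.
  by rewrite mulrC EFinM lee_wpmul2l ?lee_fin ?enorm_ge0 // integral_enorm_le.
by move=> u _; rewrite lee_fin enorm_ge0.
Qed.

Lemma integrable_dotp g M v : measurable_rV g ->
  (\int[P]_u (enorm (g u) ^+ 2)%:E <= M%:E)%E ->
  P.-integrable setT (fun u => (dotp (g u) v)%:E).
Proof.
move=> mg gM; apply/integrableP; split.
  by apply/measurable_EFinP/measurable_dotp => //; exact: measurable_rV_cst.
by rewrite (le_lt_trans (integral_abs_dotp_le _ _ v mg gM)) // ltry.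
Qed.

Lemma dotp_delta v i : dotp v (delta_mx 0 i) = v 0 i.
Proof.
rewrite /dotp (bigD1 i) //= mxE !eqxx mulr1 big1 ?addr0 // => j ji.
by rewrite mxE (negbTE ji) andbF mulr0.
Qed.

Lemma integral_dotp g M v : measurable_rV g ->
  (\int[P]_u (enorm (g u) ^+ 2)%:E <= M%:E)%E ->
  (\int[P]_u (dotp (g u) v)%:E = (dotp (Evec P g) v)%:E)%E.
Proof.
move=> mg gM.
have gi i : P.-integrable setT (fun u => (g u 0 i)%:E).
  have := integrable_dotp _ _ (delta_mx 0 i) mg gM.
  by under eq_fun do rewrite dotp_delta.
rewrite /dotp; under eq_integral do rewrite -sumEFin.
rewrite integral_sum //; last first.
  move=> i; under eq_fun do rewrite EFinM muleC.
  exact: integrableZl.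
rewrite -sumEFin; apply: eq_bigr => i _.
under eq_integral do rewrite EFinM.
rewrite integralZr // EFinM mxE unlock fineK //.
exact: integrable_fin_num.
Qed.

End moments.

(** * The tangential gradient as a stochastic oracle; existence of minimizers *)

Section oracle.
Context {R : realType} {d : nat} {dO : measure_display}.
Context {Omega : measurableType dO} {P : probability Omega R}.
Context {X : set 'rV[R]_d} {F : 'rV[R]_d -> Omega -> R}.
Context {G : 'rV[R]_d -> Omega -> 'rV[R]_d} {N : set Omega}.
Hypothesis X_nonempty : X !=set0.
Hypothesis X_convex : convex_set (X : set (convex_lmodType 'rV[R]_d)).
Hypothesis X_compact : compact X.
Hypothesis F_integrable : forall x, X x -> P.-integrable setT (EFin \o F x).
Hypothesis G_measurable : forall x i, X x -> measurable_fun setT (fun o => G x o 0 i).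
Hypothesis N_measurable : measurable N.
Hypothesis N_null : P N = 0%E.
Hypothesis F_gradient : forall u, ~ N u -> forall x, X x ->
  gradient_within X (F^~ u) x (G x u).
Variable M : R.
Hypothesis G_bounded : forall x, X x ->
  (\int[P]_u (enorm (G x u) ^+ 2)%:E <= M%:E)%E.
Variables (x0 : 'rV[R]_d) (T : 'M[R]_d).
Hypothesis Xx0 : X x0.
Hypothesis TT : T^T = T.
Hypothesis T2 : T *m T = T.
Hypothesis T_tangent : forall x, X x -> (x - x0) *m T = x - x0.
Hypothesis T_span : forall i, exists m (c : 'I_m -> R) (z : 'I_m -> 'rV[R]_d),
  (forall k, X (z k)) /\ row i T = \sum_k c k *: (z k - x0).
Local Notation pr := (Defs.proj X).
Local Notation prX := (projX X_nonempty X_compact).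
Local Notation G' := (offnull_gradient X G N T).

Lemma F_measurable x : X x -> measurable_fun setT (F x).
Proof. by move=> /F_integrable/measurable_int/measurable_EFinP. Qed.

Lemma tangentB x y : X x -> X y -> (x - y) *m T = x - y.
Proof.
move=> Xx Xy; rewrite -(subrKA x0) mulmxDl T_tangent //.
by rewrite -(opprB y x0) mulNmx T_tangent.
Qed.

Lemma measurable_oracle dT (S : measurableType dT) (xi : S -> 'rV[R]_d) :
  measurable_rV xi ->
  measurable_rV (fun p : S * Omega => G' (xi p.1) p.2).
Proof.
by apply: (measurable_offnull_gradient X F G N X_nonempty X_convex X_compact
  N_measurable F_measurable F_gradient x0 T Xx0 TT T_span).
Qed.

Lemma measurable_oracle_at x : measurable_rV (G' x).
Proof.
move=> i.
have m := measurable_oracle _ _ (fun _ : Omega => x) (measurable_rV_cst x) i.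
apply: (measurableT_comp m (_ : measurable_fun setT (fun u => (u, u)))).
exact: measurable_fun_pair.
Qed.

Lemma oracle_bounded x : (\int[P]_u (enorm (G' x u) ^+ 2)%:E <= M%:E)%E.
Proof.
apply: le_trans (G_bounded _ (prX x)); apply: ge0_le_integral => //.
- by move=> u _; rewrite lee_fin sqr_ge0.
- by apply/measurable_EFinP/measurable_funX/measurable_enorm/measurable_oracle_at.
- apply/measurable_EFinP/measurable_funX/measurable_enorm => i.
  by apply: G_measurable; exact: prX.
move=> u _; rewrite lee_fin /offnull_gradient; case: ifP => _.
  by rewrite enorm0 expr0n sqr_ge0.
by rewrite ler_pXn2r ?nnegrE ?enorm_ge0 // projector_contraction.
Qed.

Lemma oracle_dotp x p q u : ~ N u -> X x -> X p -> X q ->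
  dotp (G' x u) (p - q) = dotp (G x u) (p - q).
Proof.
move=> Nu Xx Xp Xq; rewrite /offnull_gradient memNset //.
by rewrite proj_id // dotp_mulmx TT tangentB.
Qed.

(** The mean is preserved in products with differences of points of [X], since the oracle may differ
    from [G] by a vector orthogonal to these directions. *)
Lemma integral_oracle x p q : X x -> X p -> X q ->
  (\int[P]_u (dotp (G' x u) (p - q))%:E = (dotp (Evec P (G x)) (p - q))%:E)%E.
Proof.
move=> Xx Xp Xq.
rewrite -(integral_dotp (G x) M) //; last 2 first.
- by move=> i; exact: G_measurable.
- exact: G_bounded.
apply: ae_eq_integral => //.
- apply/measurable_EFinP/measurable_dotp; last exact: measurable_rV_cst.
  exact: measurable_oracle_at.
- apply/measurable_EFinP/measurable_dotp; last exact: measurable_rV_cst.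
  by move=> i; exact: G_measurable.
exists N; split => // u /= h; apply: contrapT => Nu; apply: h => _.
by rewrite oracle_dotp.
Qed.

Lemma increment_le_integral_oracle x y u : ~ N u -> X x -> X y ->
  (`|F y u - F x u|%:E <=
   \int[lebesgue_measure]_(t in `[0%R, 1%R]%classic)
      `|dotp (G' (x + t *: (y - x))%R u) (y - x)%R|%:E)%E.
Proof.
move=> Nu Xx Xy.
pose xi (t : R) := x + t *: (y - x).
have mxi : measurable_rV xi.
  move=> i; under eq_fun do rewrite mxE mxE.
  by apply: measurable_funD => //; apply: measurable_funM.
have := increment_le_integral_norm (fun t => F (xi t) u)
  (fun t => dotp (G' (xi t) u) (y - x)).
have -> : xi 1 = y by rewrite /xi scale1r addrC subrK.
have -> : xi 0 = x by rewrite /xi scale0r addr0.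
apply.
  have m := measurable_dotp _ _ (measurable_oracle _ _ _ mxi)
    (measurable_rV_cst (y - x)).
  apply: (measurableT_comp m (_ : measurable_fun setT (fun t : R => (t, u)))).
  exact: measurable_fun_pair.
move=> t t01 e e0; have Xt s : 0 <= s <= 1 -> X (xi s) by exact: convex_segment.
pose k := enorm (y - x) + 1; have k0 : 0 < k by rewrite ltr_wpDl ?enorm_ge0.
have [r r0 hr] := gradient_within_expansion _ _ _ _ (F_gradient _ Nu _ (Xt _ t01))
  (e / k) (divr_gt0 e0 k0).
exists (r / k); first by rewrite divr_gt0.
move=> s s01; rewrite ltr_pdivlMr // => st.
have xiB a b : xi a - xi b = (a - b) *: (y - x).
  by rewrite /xi opprD addrACA subrr add0r scalerBl.
have yk : enorm (y - x) <= k by rewrite lerDl.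
have := hr _ (Xt _ s01); rewrite !xiB !enormZ dotpZr => /(_ _)/wrap[].
  by rewrite (le_lt_trans _ st) // ler_wpM2l.
rewrite -/(xi t) -/(xi s) oracle_dotp //; last exact: Xt.
rewrite mulrC => /le_trans; apply.
rewrite mulrACA ler_piMr ?mulr_ge0 ?(ltW e0) //.
by rewrite mulrC ler_pdivrMr // mul1r.
Qed.

(** A sample function need not be Lipschitz. Its increment is bounded by the integral of its
    directional derivatives along the segment; after the two integrals are exchanged, the moment
    bound applies at each point of the segment. *)
Lemma objective_lipschitz x y : X x -> X y ->
  `|objective P F x - objective P F y| <= (1 + M) * enorm (x - y).
Proof.
have M0 : 0 <= M.
  rewrite -lee_fin (le_trans _ (G_bounded _ Xx0)) //; apply: integral_ge0 => u _.
  by rewrite lee_fin sqr_ge0.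
move=> Xx Xy; rewrite distrC enormB.
pose xi (t : R) := x + t *: (y - x).
have mxi : measurable_rV xi.
  move=> i; under eq_fun do rewrite mxE mxE.
  by apply: measurable_funD => //; apply: measurable_funM.
pose D (p : R * Omega) : \bar R :=
  (`|dotp (G' (xi p.1) p.2) (y - x)| * \1_`[0, 1] p.1)%:E.
have mD : measurable_fun setT D.
  apply/measurable_EFinP/measurable_funM; last first.
    have mI : measurable_fun setT (\1_`[0, 1] : R -> R) by exact: measurable_indic.
    exact: measurableT_comp mI measurable_fst.
  apply: measurableT_comp => //; apply: measurable_dotp; last exact: measurable_rV_cst.
  exact: measurable_oracle mxi.
have D0 p : (0 <= D p)%E by rewrite lee_fin mulr_ge0.
have iB : P.-integrable setT (fun u => (F y u - F x u)%:E).
  under eq_fun do rewrite EFinB.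
  by apply: integrableB => //; exact: F_integrable.
have mB := measurable_int _ iB.
have fE : (objective P F y - objective P F x)%:E = (\int[P]_u (F y u - F x u)%:E)%E.
  under [RHS]eq_integral do rewrite EFinB.
  rewrite integralB //; [|exact: F_integrable..].
  by rewrite EFinB /objective unlock !fineK // integrable_fin_num //; exact: F_integrable.
rewrite -lee_fin -abse_EFin fE (le_trans (le_abse_integral _ _ mB)) //.
apply: (@le_trans _ _ (\int[P]_u \int[lebesgue_measure]_t D (t, u))%E).
  apply: ae_ge0_le_integral => //.
  - exact: measurableT_comp.
  - by move=> u _; apply: integral_ge0.
  - exact: measurable_fun_fubini_tonelli_G.
  exists N; split => // u /= h; apply: contrapT => Nu; apply: h => _.
  rewrite (le_trans (increment_le_integral_oracle _ _ _ Nu Xx Xy)) //.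
  rewrite integral_mkcond epatch_indic le_eqVlt; apply/orP; left; apply/eqP.
  by apply: eq_integral => t _; rewrite /D /= EFinM.
rewrite -fubini_tonelli //.
apply: (@le_trans _ _ (\int[lebesgue_measure]_t
    (((1 + M) * enorm (y - x)) * \1_`[0%R, 1%R] t)%:E)%E).
  apply: ge0_le_integral => //.
  - by move=> t _; apply: integral_ge0.
  - exact: measurable_fun_fubini_tonelli_F.
  - by apply/measurable_EFinP; apply: measurable_funM.
  move=> t _; rewrite /D /=.
  under eq_integral do rewrite mulrC EFinM.
  rewrite ge0_integralZl_EFin //; last first.
    apply/measurable_EFinP; apply: measurableT_comp => //.
    by apply: measurable_dotp; [exact: measurable_oracle_at | exact: measurable_rV_cst].
  rewrite mulrC EFinM lee_wpmul2l ?lee_fin // integral_abs_dotp_le //.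
    exact: measurable_oracle_at.
  exact: oracle_bounded.
under eq_integral do rewrite EFinM.
rewrite ge0_integralZl_EFin //; last 2 first.
- by apply/measurable_EFinP; exact: measurable_indic.
- by rewrite mulr_ge0 ?enorm_ge0 // addr_ge0.
rewrite integral_indic //= setIT lebesgue_measure_itv /= lte_fin ltr01 sube0.
by rewrite mule1.
Qed.

(** The infima that define the distance and the energy are degenerate over an empty set, so the
    solution set must be known to be inhabited. *)
Lemma argmin_objective_nonempty : argmin X (objective P F) !=set0.
Proof.
have [x /set_mem Xx xmin] := compact_EVT_min X_nonempty X_compact
  (lipschitz_within X (1 + M) (objective P F) objective_lipschitz).
by exists x; split => // z Xz; apply: xmin; exact: mem_set.
Qed.

End oracle.

(** * The pasts as a filtration *)

Section filtration.
Context {R : realType} {dO dS : measure_display}.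
Context {Omega : measurableType dO} {S : measurableType dS}.
Variable v : nat -> {mfun S >-> Omega}.
Local Notation past := (past v).

Lemma past_measurableS n m (A : set S) : (n <= m)%N ->
  measurable (A : set (past n)) -> measurable (A : set (past m)).
Proof.
move=> nm; apply: smallest_sub; first exact: smallest_sigma_algebra.
move=> _ [J [B [mB Jn ->]]]; apply: sub_sigma_algebra; exists J, B; split => //.
by move=> i /Jn/leq_trans; exact.
Qed.

Lemma past_measurable_funS {dU} {U : measurableType dU} n m (f : S -> U) :
  (n <= m)%N -> measurable_fun setT (f : past n -> U) ->
  measurable_fun setT (f : past m -> U).
Proof.
move=> nm mf _ B mB; rewrite setTI; apply: (past_measurableS n) => //.
by rewrite -[X in measurable X]setTI; exact: mf.
Qed.

Lemma past_measurable_fun {dU} {U : measurableType dU} n (f : S -> U) :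
  measurable_fun setT (f : past n -> U) -> measurable_fun setT f.
Proof.
move=> mf _ B mB; rewrite setTI; apply: (past_measurable v n).
by rewrite -[X in measurable X]setTI; exact: mf.
Qed.

Lemma measurable_sample n : measurable_fun setT (v n : past n.+1 -> Omega).
Proof.
move=> _ B mB; rewrite setTI; apply: sub_sigma_algebra.
exists [fset n]%fset, (fun=> B); split => //.
  by move=> i; rewrite inE => /eqP ->.
apply/seteqP; split.
  by move=> o vB i; rewrite /= inE => /eqP ->.
by move=> o h; apply: (h n); rewrite /= inE.
Qed.

Lemma measurable_past_succ_pair n :
  measurable_fun setT (fun o : past n.+1 => (o : past n, v n o)).
Proof.
apply: measurable_fun_pair; last exact: measurable_sample.
by move=> _ A mA; rewrite setTI; exact: (past_measurableS n n.+1 A _ mA).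
Qed.

End filtration.

(** * Almost supermartingales that keep returning near zero *)

Section supermartingale.
Context {R : realType} {dO dS : measure_display}.
Context {Omega : measurableType dO} {S : measurableType dS} {Q : probability S R}.
Variable v : nat -> {mfun S >-> Omega}.
Local Notation past := (past v).
Variables (V : nat -> S -> R) (beta : nat -> R).
Hypothesis V_measurable : forall n, measurable_fun setT (V n : past n -> R).
Hypothesis V_ge0 : forall n o, 0 <= V n o.
Hypothesis V_drift : forall n (A : set (past n)), measurable A ->
  (\int[Q]_(o in A) (V n.+1 o)%:E <= \int[Q]_(o in A) (V n o)%:E + (beta n)%:E)%E.

Section crossing.
Variables (N : nat) (delta eps : R).
Hypothesis delta_gt0 : 0 < delta.
Hypothesis eps_gt0 : 0 < eps.

(* [0]: the process has not been below [delta] since time [N]; [1]: it has, and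
   it has stayed below [eps] ever since; [2]: it has exceeded [eps] afterwards. *)
Fixpoint stage k o : nat :=
  if k is k'.+1 then
    match stage k' o with
    | 0 => nat_of_bool (V (N + k) o < delta)
    | 1 => if V (N + k) o < eps then 1 else 2
    | _ => 2
    end
  else nat_of_bool (V N o < delta).

(** The values are chosen so that every change of stage is a move downwards: entering replaces
    [delta] by a smaller value of [V], and leaving replaces a value at least [eps] by [eps]. Only
    the drift of [V] during stage 1 can raise the mean. *)
Definition stopped k o : R :=
  match stage k o with 0 => delta | 1 => V (N + k) o | _ => eps end.

Lemma measurable_stage k i :
  measurable ([set o | stage k o = i] : set (past (N + k))).
Proof.
have lvl n c : measurable ([set o | V n o < c] : set (past n)).
  have -> : [set o | V n o < c] = V n @^-1` `]-oo, c[%classic.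
    by apply/seteqP; split => o /=; rewrite in_itv.
  by rewrite -[X in measurable X]setTI; exact: V_measurable.
have cstP n (p : Prop) : measurable ([set _ | p] : set (past n)).
  have [hp|hp] := pselect p.
    by rewrite (_ : [set _ | _] = setT) //; apply/seteqP; split.
  by rewrite (_ : [set _ | _] = set0) //; apply/seteqP; split.
elim: k i => [|k IH] i.
  rewrite addn0 (_ : [set _ | _] =
    ([set o | V N o < delta] `&` [set _ | i = 1%N]) `|`
    (~` [set o | V N o < delta] `&` [set _ | i = 0%N])).
    by apply: measurableU; apply: measurableI => //; exact: measurableC.
  apply/seteqP; split => o /=; case: (V N o < delta)%R.
  - by move=> <-; left.
  - by move=> <-; right.
  - by case=> -[].
  - by case=> -[].
have m j : measurable ([set o | stage k o = j] : set (past (N + k.+1))).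
  by apply: (past_measurableS v (N + k)); [rewrite leq_add2l | exact: IH].
pose D := [set o | V (N + k.+1) o < delta].
pose E := [set o | V (N + k.+1) o < eps].
have mD : measurable (D : set (past (N + k.+1))) by exact: lvl.
have mE : measurable (E : set (past (N + k.+1))) by exact: lvl.
(* The new stage is a Boolean combination of the previous stage and two level events of [V];
   conditions on [i] enter as constant events. *)
rewrite (_ : [set _ | _] =
  (([set o | stage k o = 0%N] `&` ((D `&` [set _ | i = 1%N]) `|`
     (~` D `&` [set _ | i = 0%N]))) `|`
  ([set o | stage k o = 1%N] `&` ((E `&` [set _ | i = 1%N]) `|`
     (~` E `&` [set _ | i = 2%N])))) `|`
  ((~` [set o | stage k o = 0%N] `&` ~` [set o | stage k o = 1%N]) `&`
     [set _ | i = 2%N])).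
  apply: measurableU; first apply: measurableU.
  - apply: measurableI => //; apply: measurableU; apply: measurableI => //.
    exact: measurableC.
  - apply: measurableI => //; apply: measurableU; apply: measurableI => //.
    exact: measurableC.
  - by apply: measurableI => //; apply: measurableI; apply: measurableC.
apply/seteqP; split => o; rewrite /D /E /=; case: (stage k o) => [|[|j]].
- by case: (_ < delta) => <-; left; left; split => //; [left | right].
- by case: (_ < eps) => <-; left; right; split => //; [left | right].
- by move=> <-; right.
- by rewrite /is_true; case: (_ < delta) => /=; intuition congruence.
- by move=> [[[] //|[_ [[-> ->]|[/negP/negbTE -> ->]]]]|[[_ []]]].
- by rewrite /is_true /=; intuition congruence.
Qed.

Lemma stopped_ge0 k o : 0 <= stopped k o.
Proof.
rewrite /stopped; case: (stage k o) => [|[|i]]; first exact: ltW.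
  exact: V_ge0.
exact: ltW.
Qed.

Lemma measurable_stopped k : measurable_fun setT (stopped k).
Proof.
have mS i : measurable [set o | stage k o = i].
  exact: (past_measurable v (N + k) _ (measurable_stage k i)).
have mV : measurable_fun setT (V (N + k)).
  exact: (past_measurable_fun v _ _ (V_measurable (N + k))).
rewrite (_ : stopped k = fun o => delta * \1_[set o | stage k o = 0%N] o +
   V (N + k) o * \1_[set o | stage k o = 1%N] o +
   eps * \1_(~` [set o | stage k o = 0%N] `&` ~` [set o | stage k o = 1%N]) o).
  apply: measurable_funD; first apply: measurable_funD.
  - by apply: measurable_funM => //; exact: measurable_indic.
  - by apply: measurable_funM => //; exact: measurable_indic.
  - apply: measurable_funM => //; apply: measurable_indic.
    by apply: measurableI; exact: measurableC.
apply/funext => o; have memE i : (o \in [set p | stage k p = i]) = (stage k o == i).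
  by apply/idP/eqP => [/set_mem //|h]; exact/mem_set.
rewrite /stopped !indicE in_setI !in_setC !memE.
by case: (stage k o) => [|[|i]] /=; rewrite ?mulr1 ?mulr0 ?addr0 ?add0r.
Qed.

(** Outside stage 1 the stopped process does not increase for any sample. Stage 1 is an event of the
    past on which the process equals [V] now and is at most [V] at the next time, so the drift
    hypothesis applies there. *)
Lemma stopped_drift k :
  (\int[Q]_o (stopped k.+1 o)%:E <= \int[Q]_o (stopped k o)%:E + (beta (N + k))%:E)%E.
Proof.
pose A := [set o | stage k o = 1%N].
have mAp : measurable (A : set (past (N + k))) by exact: measurable_stage.
have mA : measurable A by exact: (past_measurable v (N + k) _ mAp).
have split (f : S -> R) : measurable_fun setT f -> (forall o, 0 <= f o) ->
    (\int[Q]_o (f o)%:E = \int[Q]_(o in ~` A) (f o)%:E + \int[Q]_(o in A) (f o)%:E)%E.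
  move=> mf f0; rewrite -ge0_integral_setU ?setvU //; first exact: measurableC.
  - exact/measurable_EFinP.
  - by move=> o _; rewrite lee_fin.
  - by apply/disj_setPS => o [].
have ms := measurable_stopped; have s0 := stopped_ge0.
have mV n : measurable_fun setT (V n).
  exact: (past_measurable_fun v _ _ (V_measurable n)).
rewrite (split (stopped k.+1)) // (split (stopped k)) // -addeA leeD //.
  apply: ge0_le_integral => //.
  - exact: measurableC.
  - by move=> o _; rewrite lee_fin.
  - by apply: measurable_funTS; exact/measurable_EFinP.
  - by apply: measurable_funTS; exact/measurable_EFinP.
  move=> o; rewrite lee_fin /stopped /A /=.
  case: (stage k o) => [|[|i]] //= _.
  by case: ltP => // /ltW.
apply: (@le_trans _ _ (\int[Q]_(o in A) (V (N + k).+1 o)%:E)%E).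
  apply: ge0_le_integral => //.
  - by move=> o _; rewrite lee_fin.
  - by apply: measurable_funTS; exact/measurable_EFinP.
  - by apply: measurable_funTS; exact/measurable_EFinP.
  move=> o; rewrite lee_fin /stopped /A /= => ->.
  by rewrite addnS; case: ltP.
apply: le_trans (V_drift _ _ mAp) _; rewrite leeD2r //.
apply: ge0_le_integral => //.
- by move=> o _; rewrite lee_fin.
- by apply: measurable_funTS; exact/measurable_EFinP.
- by apply: measurable_funTS; exact/measurable_EFinP.
by move=> o; rewrite /stopped /A /= => ->.
Qed.

(** Markov's inequality for the stopped process, which starts at most at [delta] and equals [eps] in
    stage 2. *)
Lemma crossing_probability k :
  (eps%:E * Q [set o | stage k o = 2%N] <= (delta + \sum_(j < k) beta (N + j))%:E)%E.
Proof.
have mC : measurable [set o | stage k o = 2%N].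
  exact: (past_measurable v (N + k) _ (measurable_stage k 2)).
apply: (@le_trans _ _ (\int[Q]_o (stopped k o)%:E)%E).
  have -> : (eps%:E * Q [set o | stage k o = 2%N] =
      \int[Q]_o (eps%:E * (\1_[set o | stage k o = 2%N] o)%:E))%E.
    rewrite ge0_integralZl_EFin ?(ltW eps_gt0) //; last first.
      by apply/measurable_EFinP; exact: measurable_indic.
    by rewrite integral_indic // setIT.
  apply: ge0_le_integral => //.
  - by move=> o _; rewrite mule_ge0 ?lee_fin // ltW.
  - by apply: measurable_funeM; apply/measurable_EFinP; exact: measurable_indic.
  - by apply/measurable_EFinP; exact: measurable_stopped.
  move=> o _; rewrite -EFinM lee_fin indicE.
  case: (boolP (o \in _)) => [/set_mem /= oE|_]; last by rewrite mulr0 stopped_ge0.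
  by rewrite mulr1 /stopped oE.
elim: k {mC} => [|k IH].
  rewrite big_ord0 addr0; apply: (@le_trans _ _ (\int[Q]_o delta%:E)%E).
    apply: ge0_le_integral => //.
    - by move=> o _; rewrite lee_fin stopped_ge0.
    - by apply/measurable_EFinP; exact: measurable_stopped.
    by move=> o _; rewrite lee_fin /stopped /= addn0; case: ltP => //= /ltW.
  by rewrite integral_cst //= probability_setT mule1.
rewrite big_ord_recr /= addrA EFinD (le_trans (stopped_drift k)) //.
by rewrite leeD2r.
Qed.

Lemma stage_crossing o : (exists2 n, (N <= n)%N & V n o < delta) ->
  (forall m, exists2 n, (m <= n)%N & eps <= V n o) -> exists k, stage k o = 2%N.
Proof.
move=> [n0 Nn0 Vn0] up; apply: contrapT => /forallNP no2.
have [k0 k01] : exists k0, stage k0 o = 1%N.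
  apply: contrapT => /forallNP no1.
  have st0 k : stage k o = 0%N.
    by have := no1 k; have := no2 k; elim: k => [|k IH] /=;
      [case: (V N o < delta) | case: (stage k o) => [|[|i]] //; case: ltP].
  have := st0 (n0 - N)%N; case: (n0 - N)%N (subnKC Nn0) => [|k] /= E.
    by move: Vn0; rewrite -E addn0 => ->.
  by rewrite st0 E Vn0.
have st1 j : stage (k0 + j) o = 1%N /\ V (N + (k0 + j).+1) o < eps.
  elim: j => [|j [IH1 IH2]].
    rewrite addn0 k01; split => //.
    by have := no2 k0.+1; rewrite /= k01; case: ltP.
  have h : stage (k0 + j.+1) o = 1%N by rewrite addnS /= IH1 IH2.
  by split => //; have := no2 (k0 + j.+1).+1; rewrite /= h; case: ltP.
have [n nk ne] := up (N + k0.+1)%N.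
have [_] := st1 (n - (N + k0.+1))%N.
by rewrite -addSn addnA subnKC // ltNge ne.
Qed.

End crossing.

Hypothesis beta_summable : exists B, forall n, \sum_(k < n) beta k <= B.
Hypothesis V_recurrent : {ae Q, forall o, forall (delta : R) (N : nat), 0 < delta ->
  exists2 n, (N <= n)%N & V n o < delta}.

(** [N] is taken where the partial sum is within [eta] of the supremum of all partial sums. *)
Lemma summable_tail (eta : R) : 0 < eta ->
  exists N, forall k, \sum_(j < k) beta (N + j) <= eta.
Proof.
move=> eta0; have [B hB] := beta_summable.
pose E := range (fun n => \sum_(k < n) beta k).
have supE : has_sup E.
  split; first by exists (\sum_(k < 0) beta k), 0%N.
  by exists B => _ [n _ <-].
have [_ [N _ <-] hN] := sup_adherent eta0 supE.
exists N => k.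
have := sup_upper_bound supE; move=> /(_ (\sum_(j < N + k) beta j)) h.
have {}h := h (ex_intro2 _ _ (N + k)%N I erefl).
rewrite big_split_ord /= in h.
by move: hN; rewrite ltrBlDl => hN; have := le_lt_trans h hN; rewrite addrC ltrD2r => /ltW.
Qed.

(** By recurrence, almost every sample that reaches [eps] infinitely often gets to stage 2, whatever
    the starting time and the entrance level. With the entrance level and the tail of the errors
    both at most [eta], this has probability at most [2 eta / eps]. *)
Lemma crossing_null (eps : R) : 0 < eps ->
  {ae Q, forall o, exists N, forall n, (N <= n)%N -> V n o < eps}.
Proof.
move=> eps0.
pose bad := \bigcap_N \bigcup_(n in [set n | (N <= n)%N]) [set o | eps <= V n o].
have mlvl n : measurable [set o | eps <= V n o].
  have -> : [set o | eps <= V n o] = V n @^-1` `[eps, +oo[%classic.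
    by apply/seteqP; split => o /=; rewrite in_itv /= andbT.
  rewrite -[X in measurable X]setTI.
  exact: (past_measurable_fun v _ _ (V_measurable n)).
have mbad : measurable bad.
  by apply: bigcapT_measurable => N; apply: bigcup_measurable.
have [Z [mZ QZ ZE]] := V_recurrent.
have key (eta : R) : 0 < eta -> (eps%:E * Q bad <= (eta + eta)%:E)%E.
  move=> eta0; have [N hN] := summable_tail eta eta0.
  pose C k := [set o | stage N eta eps k o = 2%N].
  have mC k : measurable (C k).
    exact: (past_measurable v (N + k) (C k) (measurable_stage N eta eps k 2)).
  have ndC : nondecreasing_seq C.
    apply/nondecreasing_seqP => k; apply/subsetPset => o; rewrite /C /=.
    by move=> ->.
  have QC : (eps%:E * Q (\bigcup_k C k) <= (eta + eta)%:E)%E.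
    have cv : Q (C k) @[k --> \oo] --> Q (\bigcup_k C k).
      exact: nondecreasing_cvg_mu mC (bigcupT_measurable _ mC) ndC.
    have cv2 := cvgeZl (isT : eps%:E \is a fin_num) cv.
    rewrite -(cvg_lim _ cv2) //; apply: lime_le; first exact: cvgP cv2.
    apply: nearW => k; apply: le_trans (crossing_probability N eta eps eta0 eps0 k) _.
    by rewrite lee_fin lerD2l.
  have badC : bad `<=` Z `|` \bigcup_k C k.
    move=> o hbad; have [Zo|nZo] := pselect (Z o); [by left|right].
    have rec : forall (delta : R) (N : nat), 0 < delta ->
        exists2 n, (N <= n)%N & V n o < delta.
      by apply: contrapT => h; apply: nZo; exact: ZE.
    have [k hk] := stage_crossing N eta eps o (rec eta N eta0)
      (fun m => let: ex_intro2 n mn h := hbad m I in ex_intro2 _ _ n mn h).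
    by exists k.
  apply: le_trans QC; rewrite lee_wpmul2l ?lee_fin ?(ltW eps0) //.
  have mUC := bigcupT_measurable _ mC.
  apply: le_trans (_ : Q (Z `|` \bigcup_k C k) <= _)%E.
    by rewrite le_measure ?inE //; exact: measurableU.
  have : (Q (Z `|` \bigcup_k C k) <= Q Z + Q (\bigcup_k C k))%E by exact: measureU2.
  by rewrite QZ add0e.
exists bad; split => //.
  apply/eqP; rewrite eq_le measure_ge0 andbT.
  have h : (eps%:E * Q bad <= 0)%E.
    apply/lee_addgt0Pr => e e0; rewrite add0e.
    have := key (e / 2) (divr_gt0 e0 (ltr0n _ 2)).
    by rewrite -splitr.
  by rewrite pmule_rle0 ?lte_fin // in h.
move=> o /= ho N _; apply: contrapT => hN; apply: ho; exists N => n Nn.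
by rewrite ltNge; apply/negP => h; apply: hN; exists n.
Qed.

Lemma supermartingale_cvg0 : {ae Q, forall o, V n o @[n --> \oo] --> (0 : R)}.
Proof.
have /ae_foralln := fun m => crossing_null m.+1%:R^-1 (ltac:(by rewrite invr_gt0)).
apply: filterS => o h; apply/cvgrPdist_lt => e e0.
have [m _ me] := near_infty_natSinv_lt (PosNum e0).
have [N hN] := h m.
exists N => // n Nn; rewrite sub0r normrN ger0_norm //.
exact: lt_trans (hN n Nn) (me m (leqnn m)).
Qed.

End supermartingale.

(** * Telescoping estimates for sums of step-sizes *)

Section partial_sums.
Context {R : realType}.
Implicit Types (u h H : nat -> R).

Lemma sum_ord_split u m n : (m <= n)%N ->
  \sum_(k < n) u k = \sum_(k < m) u k + \sum_(i < n - m) u (m + i)%N.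
Proof. by move=> mn; rewrite -[in LHS](subnKC mn) big_split_ord. Qed.

(** A discrete integral test: [h] plays the role of the tail integral. *)
Lemma bounded_sum_telescope u h n0 : (forall n, 0 <= u n) ->
  (forall n, (n0 <= n)%N -> 0 <= h n) ->
  (forall n, (n0 <= n)%N -> u n <= h n - h n.+1) ->
  exists B, forall n, \sum_(k < n) u k <= B.
Proof.
move=> u0 h0 uh; exists (\sum_(k < n0) u k + h n0) => n.
have [nn0|n0n] := leqP n n0.
  rewrite (sum_ord_split _ _ _ nn0) -addrA lerDl addr_ge0 ?h0 //.
  exact: sumr_ge0.
rewrite (sum_ord_split _ _ _ (ltnW n0n)) lerD2l.
suff : \sum_(i < n - n0) u (n0 + i)%N <= h n0 - h (n0 + (n - n0))%N.
  by move/le_trans; apply; rewrite gerBl h0 // leq_addr.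
elim: (n - n0)%N => [|j IH]; first by rewrite big_ord0 addn0 subrr.
rewrite big_ord_recr /= (le_trans (lerD IH (uh _ (leq_addr _ _)))) //.
by rewrite -addnS subrKA.
Qed.

Lemma unbounded_sum_telescope u H n0 : (forall n, 0 <= u n) ->
  (forall n, (n0 <= n)%N -> H n.+1 - H n <= u n) ->
  (forall A, exists2 n, (n0 <= n)%N & A <= H n) ->
  forall A, exists n, A <= \sum_(k < n) u k.
Proof.
move=> u0 uH Hoo A; have [n n0n An] := Hoo (A + H n0); exists n.
rewrite (sum_ord_split _ _ _ n0n) (@le_trans _ _ (H n - H n0)) //.
  by rewrite lerBrDr.
rewrite ler_wpDl ?sumr_ge0 // -{1}(subnKC n0n).
elim: (n - n0)%N => [|j IH]; first by rewrite big_ord0 addn0 subrr.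
rewrite big_ord_recr /= (le_trans _ (lerD IH (uH _ (leq_addr _ _)))) //.
by rewrite -addnS [leRHS]addrC subrKA.
Qed.

Lemma ln_le_sub1 (x : R) : 0 < x -> ln x <= x - 1.
Proof.
by move=> x0; rewrite lerBrDl -[leRHS]lnK ?posrE // expR_ge1Dx.
Qed.

Lemma lnB_le (x y : R) : 0 < x -> 0 < y -> ln y - ln x <= (y - x) / x.
Proof.
move=> x0 y0; rewrite -ln_div ?posrE // mulrBl divff ?gt_eqF //.
by rewrite ln_le_sub1 // divr_gt0.
Qed.

Lemma lnB_ge (x y : R) : 0 < x -> 0 < y -> (y - x) / y <= ln y - ln x.
Proof.
by move=> x0 y0; rewrite -lerN2 opprB -mulNr opprB lnB_le.
Qed.

Definition square_summable u := exists B, forall n, \sum_(k < n) u k ^+ 2 <= B.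

Definition divergent_sum u := forall A, exists n, A <= \sum_(k < n) u k.

(** Up to a constant, the inner sum bounds the mean distance travelled by the iterates between the
    request and the arrival of the gradient used at iteration [m]; its product with [u m] is the
    staleness part of the drift error. *)
Definition staleness_summable (s : nat -> nat) u := exists B, forall n,
  \sum_(m < n) u m * \sum_(s m <= k < m) u k <= B.

Lemma square_summable_harmonic u c n0 : (forall n, 0 <= u n) -> 0 <= c ->
  (forall n, (n0 <= n)%N -> u n <= c / n.+1%:R) -> square_summable u.
Proof.
(* [1 / n - 1 / n.+1] dominates [(1 / n.+1) ^ 2]; starting at index 1 avoids the default value of
   [1 / 0]. *)
move=> u0 c0 uc; apply: (@bounded_sum_telescope (fun k => u k ^+ 2)
  (fun n => c ^+ 2 / n%:R) (maxn n0 1)) => n.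
- exact: sqr_ge0.
- by move=> _; rewrite divr_ge0 ?sqr_ge0.
rewrite geq_max => /andP[n0n n1].
have nn : (0 : R) < n%:R by rewrite ltr0n.
have nn1 : (0 : R) < n.+1%:R by rewrite ltr0n.
apply: (@le_trans _ _ ((c / n.+1%:R) ^+ 2)).
  by rewrite ler_pXn2r ?nnegrE ?divr_ge0 ?uc.
have -> : c ^+ 2 / n%:R - c ^+ 2 / n.+1%:R = c ^+ 2 / (n%:R * n.+1%:R).
  rewrite -mulrBr; congr (_ * _); rewrite -(natr1 n) in nn1 *.
  by field; rewrite !gt_eqF.
rewrite expr_div_n ler_wpM2l ?sqr_ge0 // expr2.
by rewrite lef_pV2 ?posrE ?mulr_gt0 // ler_pM2r // ler_nat.
Qed.

(* The steps are discrete versions of [c L' / L] with [L' = w], so that their sum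
   over a window is close to the increment of [c ln L]: here [L] is the identity,
   [ln] or [ln ln]. *)
Section slow_steps.
Variables (u L w : nat -> R) (s : nat -> nat) (n0 n1 : nat) (c : R).
Hypothesis u_ge0 : forall n, 0 <= u n.
Hypothesis s_le : forall n, (s n <= n)%N.
Hypothesis c_gt0 : 0 < c.
Hypothesis uE : forall n, (n0 <= n)%N -> u n = c * (w n.+1 / L n.+1).
Hypothesis L_gt0 : forall n, (n0 <= n)%N -> 0 < L n.
Hypothesis L_le : forall n, (n0 <= n)%N -> L n.+1 - L n <= w n.
Hypothesis L_ge : forall n, (n0 <= n)%N -> w n.+1 <= L n.+1 - L n.
Hypothesis w_gt0 : forall n, (n0 <= n)%N -> 0 < w n.
Hypothesis L_unbounded : forall A, exists2 n, (n0 <= n)%N & A <= L n.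
Hypothesis n01 : (n0 <= n1)%N.
Hypothesis s_ge : forall n, (n1 <= n)%N -> (n0 <= s n)%N.

Let L_mono n : (n0 <= n)%N -> L n <= L n.+1.
Proof.
move=> n0n; rewrite -subr_ge0 (le_trans _ (L_ge _ n0n)) // ltW // w_gt0 //.
exact: leqW.
Qed.

Lemma slow_steps_divergent : divergent_sum u.
Proof.
(* The shift by one matches [u n], which involves [L n.+1]: the increment of [ln L] from [n.+1] to
   [n.+2] is at most [w n.+1 / L n.+1]. *)
apply: (@unbounded_sum_telescope u (fun n => c * ln (L n.+1)) n0) => // [n n0n|A].
  rewrite uE // -mulrBr ler_pM2l // (le_trans (lnB_le _ _ _ _)) ?L_gt0 ?leqW //.
  by rewrite ler_pM2r ?invr_gt0 ?L_gt0 ?L_le ?leqW.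
have [n n0n An] := L_unbounded (expR (A / c)); exists n => //.
rewrite mulrC -ler_pdivrMr // -[leLHS]expRK ler_ln ?posrE ?expR_gt0 //.
  exact: le_trans An (L_mono _ n0n).
by rewrite L_gt0 // leqW.
Qed.

(** The window sum is at most [c] times the increment of [ln L], hence at most
    [c (L n - L (s n)) / L (s n)]. The bound [K n <= L n / 2] forces [L (s n) >= L n / 2], which is
    the factor 2. *)
Lemma slow_steps_stale (K : nat -> R) n : (n1 <= n)%N ->
  L n - L (s n) <= K n -> K n <= L n / 2 ->
  \sum_(s n <= k < n) u k <= c * (2 * (K n / L n)).
Proof.
move=> n1n LK KL; have n0s := s_ge _ n1n.
have n0n := leq_trans n01 n1n.
have Ln := L_gt0 _ n0n; have Ls := L_gt0 _ n0s.
apply: (@le_trans _ _ (c * (ln (L n) - ln (L (s n))))).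
  suff key k j : (n0 <= k)%N ->
      \sum_(k <= i < k + j) u i <= c * (ln (L (k + j)%N) - ln (L k)).
    by have := key _ (n - s n)%N n0s; rewrite subnKC.
  move=> n0k; elim: j => [|j IH]; first by rewrite addn0 big_geq // subrr mulr0.
  rewrite addnS big_nat_recr ?leq_addr //=.
  have n0kj : (n0 <= k + j)%N := leq_trans n0k (leq_addr _ _).
  have -> : c * (ln (L (k + j).+1) - ln (L k)) =
      c * (ln (L (k + j)%N) - ln (L k)) + c * (ln (L (k + j).+1) - ln (L (k + j)%N)).
    by rewrite -mulrDr [in RHS]addrC subrKA.
  rewrite lerD // uE // ler_pM2l //.
  rewrite (le_trans _ (lnB_ge _ _ _ _)) ?L_gt0 ?leqW //.
  by rewrite ler_pM2r ?invr_gt0 ?L_gt0 ?L_ge ?leqW.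
rewrite ler_pM2l // (le_trans (lnB_le _ _ Ls Ln)) //.
have half : L n / 2 <= L (s n).
  have -> : L n / 2 = L n - L n / 2 by field.
  by rewrite lerBlDr -lerBlDl (le_trans LK).
have K0 : 0 <= K n.
  rewrite (le_trans _ LK) // subr_ge0.
  suff key k j : (n0 <= k)%N -> L k <= L (k + j)%N.
    by have := key _ (n - s n)%N n0s; rewrite subnKC.
  move=> n0k; elim: j => [|j IH]; first by rewrite addn0.
  by rewrite addnS (le_trans IH) // L_mono // (leq_trans n0k) // leq_addr.
apply: (@le_trans _ _ (K n / L (s n))); first by rewrite ler_pM2r ?invr_gt0.
rewrite mulrCA ler_wpM2l // -[leRHS]invrK lef_pV2 ?posrE ?invr_gt0 ?mulr_gt0 ?invr_gt0 //.
by rewrite invfM invrK mulrC.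
Qed.

Lemma slow_steps_staleness (K h : nat -> R) :
  (forall n, (n1 <= n)%N -> L n - L (s n) <= K n) ->
  (forall n, (n1 <= n)%N -> K n <= L n / 2) ->
  (forall n, (n1 <= n)%N -> 0 <= h n) ->
  (forall n, (n1 <= n)%N -> w n.+1 / L n.+1 * (K n / L n) <= h n - h n.+1) ->
  staleness_summable s u.
Proof.
move=> LK KL h0 hK.
apply: (@bounded_sum_telescope (fun m => u m * \sum_(s m <= k < m) u k)
  (fun n => 2 * c ^+ 2 * h n) n1) => n.
- by rewrite mulr_ge0 // sumr_ge0.
- by move=> n1n; rewrite mulr_ge0 ?h0 // mulr_ge0 // sqr_ge0.
move=> n1n; rewrite (le_trans (ler_wpM2l (u_ge0 n)
  (slow_steps_stale K _ n1n (LK _ n1n) (KL _ n1n)))) //.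
rewrite uE ?(leq_trans n01) // -mulrBr.
have -> : c * (w n.+1 / L n.+1) * (c * (2 * (K n / L n))) =
  2 * c ^+ 2 * (w n.+1 / L n.+1 * (K n / L n)) by ring.
by rewrite ler_wpM2l ?hK // mulr_ge0 // sqr_ge0.
Qed.

(** The case of delays bounded on the scale of [L]: the error terms are at most the decrements of
    [k / L]. *)
Lemma slow_steps_staleness_cst (k : R) : 0 <= k ->
  (forall n, (n1 <= n)%N -> L n - L (s n) <= k) ->
  (forall n, (n1 <= n)%N -> k <= L n / 2) ->
  staleness_summable s u.
Proof.
move=> k0 Lk kL; pose Kk (n : nat) := k; pose hk n := k / L n.
have n0n n : (n1 <= n)%N -> (n0 <= n)%N by exact: leq_trans.
have L0 n : (n1 <= n)%N -> 0 < L n by move=> /n0n; exact: L_gt0.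
apply: (@slow_steps_staleness Kk hk) => // n n1n.
  by rewrite divr_ge0 // ltW // L0.
have -> : hk n - hk n.+1 = (L n.+1 - L n) / L n.+1 * (k / L n).
  by rewrite /hk; field; rewrite !gt_eqF ?L0 ?leqW.
rewrite ler_wpM2r ?divr_ge0 ?(ltW (L0 _ n1n)) //.
by rewrite ler_pM2r ?invr_gt0 ?L0 ?leqW // L_ge // n0n.
Qed.

End slow_steps.
End partial_sums.

(** * The four delay and step-size conditions *)

Section step_sizes.
Context {R : realType}.
Variables (s : nat -> nat) (alpha : nat -> R).
Hypothesis s_le : forall n, (s n <= n)%N.
Hypothesis delays_finite : forall k, has_ubound (delays R s k).
Hypothesis alpha_gt0 : forall n, 0 < alpha n.+1.
Local Notation u := (fun k => alpha k.+1).

Let u_ge0 k : 0 <= u k. Proof. exact: ltW. Qed.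

Lemma nat_above (x : R) n0 : exists2 n, (n0 <= n)%N & x <= n%:R.
Proof.
exists (maxn n0 (Num.truncn x).+1); first exact: leq_maxl.
by rewrite (le_trans (ltW (truncnS_gt x))) // ler_nat leq_maxr.
Qed.

Lemma natr_ge_trans (x : R) n m : (n <= m)%N -> x <= n%:R -> x <= m%:R.
Proof. by move=> nm /le_trans; apply; rewrite ler_nat. Qed.

Lemma le_delay n : (n%:R - (s n)%:R : R) <= delay R s (s n).
Proof.
rewrite -natrB //; apply: sup_ubound; first exact: delays_finite.
by exists n.
Qed.

(** A finite delay means that iteration [K] is the origin of gradients received only up to some
    time. This turns bounds valid for large origins [s n] into bounds valid for large [n]. *)
Lemma origin_unbounded K : exists N, forall n, (N <= n)%N -> (K <= s n)%N.
Proof.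
elim: K => [|K [N IH]]; first by exists 0%N.
have [b hb] := delays_finite K.
have [N' _ hN'] := nat_above (K%:R + b + 1) 0.
exists (maxn N N') => n; rewrite geq_max => /andP[/IH Kn N'n].
rewrite ltn_neqAle Kn andbT; apply/negP => /eqP Ks.
have : (n%:R - K%:R : R) <= b.
  by rewrite Ks -natrB //; apply: hb; exists n => //; rewrite /= -Ks.
have : n%:R >= K%:R + b + 1 :> R by exact: natr_ge_trans hN'.
by lra.
Qed.

Lemma delay_le_eventually (g : nat -> R) : (forall k, 0 <= g k) ->
  (delay R s : nat -> R^o) =O_\oo (g : nat -> R^o) ->
  exists2 C : R, 0 < C & exists N, forall n, (N <= n)%N ->
    n%:R - (s n)%:R <= C * g (s n).
Proof.
move=> g0 /eqO_exP[C C0 [k0 _ hk]]; exists C => //.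
have [N hN] := origin_unbounded k0; exists N => n Nn.
rewrite (le_trans (le_delay n)) // (le_trans (ler_norm _)) //.
rewrite (le_trans (hk _ (hN n Nn))) //.
by rewrite [X in C * X]ger0_norm.
Qed.

Definition step_conditions := [/\ square_summable u, divergent_sum u &
  staleness_summable s u].

Lemma window_count D m n : (\sum_(k < n) ((m <= k + D) && (k < m)) <= D)%N.
Proof.
rewrite -(big_mkord xpredT (fun k => nat_of_bool ((m <= k + D) && (k < m))%N)).
rewrite -big_mkcond /= sum1_count /index_iota subn0 -size_filter.
rewrite -[X in (_ <= X)%N](size_iota (m - D) D); apply: uniq_leq_size.
  by rewrite filter_uniq // iota_uniq.
move=> k; rewrite mem_filter !mem_iota => /andP[/andP[mk km] _].
rewrite leq_subLR addnC mk /=; have [Dm|mD] := leqP D m.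
  by rewrite subnK.
by rewrite (leq_trans km) // (leq_trans (ltnW mD)) // leq_addl.
Qed.

(** The products [u m * u k] are split by [x y <= x ^ 2 + y ^ 2], and each square then occurs at
    most [D] times in either role. *)
Lemma bounded_staleness D : square_summable u ->
  (forall n, (n <= s n + D)%N) -> staleness_summable s u.
Proof.
move=> [B hB] sD; exists (D%:R * B + D%:R * B) => n.
pose b m k : R := ((m <= k + D) && (k < m))%N%:R.
apply: (@le_trans _ _ (\sum_(m < n) \sum_(k < n) (b m k * u m ^+ 2 + b m k * u k ^+ 2))).
  apply: ler_sum => m _; rewrite mulr_sumr.
  rewrite (big_nat_widenl _ 0%N) // (big_nat_widen _ _ n) ?(ltnW (ltn_ord m)) //.
  rewrite big_mkord big_mkcond /=; apply: ler_sum => k _.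
  rewrite -mulrDr /b; case: ifP => [/andP[sk km]|_]; last first.
    by rewrite mulr_ge0 ?addr_ge0 ?sqr_ge0.
  rewrite km andbT (leq_trans (sD m)) ?leq_add2r // mul1r.
  have := sqr_ge0 (alpha m.+1 - alpha k.+1).
  have := sqr_ge0 (alpha m.+1 + alpha k.+1).
  by move: (alpha m.+1) (alpha k.+1) => x y; nra.
under eq_bigr do rewrite big_split /=.
rewrite big_split /= lerD //.
  apply: (@le_trans _ _ (\sum_(m < n) D%:R * u m ^+ 2)).
    apply: ler_sum => m _; rewrite -mulr_suml ler_wpM2r ?sqr_ge0 //.
    by rewrite -natr_sum ler_nat window_count.
  by rewrite -mulr_sumr ler_wpM2l.
rewrite exchange_big /=; apply: (@le_trans _ _ (\sum_(k < n) D%:R * u k ^+ 2)).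
  apply: ler_sum => k _; rewrite -mulr_suml ler_wpM2r ?sqr_ge0 //.
  rewrite -natr_sum ler_nat.
  (* For fixed [k], the indices [i] with [k < i <= k + D] form the window that ends just below
     [(k + D).+1], so the same count applies. *)
  rewrite (eq_bigr (fun i : 'I_n => ((k + D).+1 <= i + D)%N && (i < (k + D).+1)%N
     : nat)); first exact: window_count.
  by move=> i _; rewrite ltnS andbC -addSn leq_add2r.
by rewrite -mulr_sumr ler_wpM2l.
Qed.

Lemma bounded_delays_conditions : bounded_delays s alpha -> step_conditions.
Proof.
move=> [[D D0 hD] cv2 cvoo].
have S1 : square_summable u.
  exists (limn (series (fun n => alpha n.+1 ^+ 2))) => n.
  rewrite -(big_mkord xpredT (fun k => u k ^+ 2)).
  apply: (nondecreasing_cvgn_le _ cv2 n).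
  by apply/nondecreasing_seqP => k; rewrite /series /= big_nat_recr //= lerDl sqr_ge0.
split=> //.
- move=> A; have /cvgryPge/(_ A)[n _ hn] := cvoo; exists n.
  by have := hn n (leqnn n); rewrite /series /= big_mkord.
apply: (@bounded_staleness (Num.truncn D).+1) => // n.
rewrite -(ler_nat R) natrD -lerBlDl (le_trans (le_delay n)) //.
exact: le_trans (hD _) (ltW (truncnS_gt _)).
Qed.

Lemma ln_succ_le n : (0 < n)%N -> ln (n.+1%:R : R) - ln n%:R <= n%:R^-1.
Proof.
move=> n0; rewrite (le_trans (lnB_le _ _ _ _)) ?ltr0n //.
by rewrite -natrB // subSnn mul1r.
Qed.

Lemma ln_succ_ge n : (0 < n)%N -> n.+1%:R^-1 <= ln (n.+1%:R : R) - ln n%:R.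
Proof.
move=> n0; rewrite (le_trans _ (lnB_ge _ _ _ _)) ?ltr0n //.
by rewrite -natrB // subSnn mul1r.
Qed.

Lemma le_ln_above (x : R) n : expR x <= n%:R -> x <= ln n%:R.
Proof.
move=> xn; rewrite -[leLHS]expRK ler_ln ?posrE ?expR_gt0 //.
exact: lt_le_trans (expR_gt0 x) xn.
Qed.

(** [L] is [ln]: since [n <= (C + 1) s n], the delay is at most [ln (C + 1)] on the logarithmic
    scale. *)
Lemma linear_delays_conditions : linear_delays s alpha -> step_conditions.
Proof.
move=> [hO [c c0 hc]].
have [C C0 [N hN]] := delay_le_eventually _ (fun k => ler0n R k) hO.
pose k := ln (C + 1); have k0 : 0 <= k by rewrite ln_ge0 // lerDr ltW.
(* From [n0] on, [ln n >= 1 + 2 k]: the 1 gives [u n <= c / n.+1], and the [2 k] gives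
   [k <= ln n / 2]. *)
have [n0 n02 hn0] := nat_above (expR (1 + 2 * k)) 2.
have L1 n : (n0 <= n)%N -> 1 + 2 * k <= ln (n%:R : R).
  by move=> n0n; apply: le_ln_above; exact: natr_ge_trans hn0.
have n_gt0 n : (n0 <= n)%N -> (0 < n)%N.
  by move=> n0n; rewrite (leq_trans _ n0n) // ltnW.
have L_gt0 n : (n0 <= n)%N -> 0 < ln (n%:R : R).
  by move=> /L1; lra.
pose w n : R := n%:R^-1.
have uE n : (n0 <= n)%N -> u n = c * (w n.+1 / ln n.+1%:R).
  move=> n0n; rewrite hc -?invfM // invr_gt0 mulr_gt0 ?ltr0n // L_gt0 //.
  exact: leqW.
have [N' hN'] := origin_unbounded n0.
pose n1 := maxn n0 (maxn N N').
have n01 : (n0 <= n1)%N by exact: leq_maxl.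
have L_le n : (n0 <= n)%N -> ln (n.+1%:R : R) - ln n%:R <= w n.
  by move=> n0n; rewrite ln_succ_le // n_gt0.
have L_ge n : (n0 <= n)%N -> w n.+1 <= ln (n.+1%:R : R) - ln n%:R.
  by move=> n0n; rewrite ln_succ_ge // n_gt0.
have w_gt0 n : (n0 <= n)%N -> 0 < w n by move=> /n_gt0 n_gt; rewrite invr_gt0 ltr0n.
have L_unbounded A : exists2 n, (n0 <= n)%N & A <= ln (n%:R : R).
  by have [n n0n /le_ln_above An] := nat_above (expR A) n0; exists n.
have s_ge n : (n1 <= n)%N -> (n0 <= s n)%N.
  by rewrite !geq_max => /andP[_ /andP[_]]; exact: hN'.
split.
- apply: (@square_summable_harmonic _ u c n0) => // [|n n0n]; first exact: ltW.
  rewrite uE // ler_pM2l // ler_pdivrMr ?L_gt0 ?leqW // ler_peMr ?invr_ge0 //.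
  by have := L1 n.+1 (leqW n0n); lra.
- exact: (@slow_steps_divergent _ u (fun n => ln n%:R) w n0 c).
apply: (@slow_steps_staleness_cst _ u (fun n => ln n%:R) w s n0 n1 c
  _ _ _ _ _ _ _ _ _ k) => // n n1n.
  have sn := s_ge _ n1n; have sn0 := n_gt0 _ sn.
  move: (n1n); rewrite !geq_max => /andP[n0n /andP[/hN h _]].
  rewrite lerBlDr -lnM ?posrE ?ltr0n ?addr_gt0 //.
  rewrite ler_ln ?posrE ?mulr_gt0 ?ltr0n ?addr_gt0 ?n_gt0 //.
  by rewrite mulrDl mul1r -lerBlDr.
by have := L1 _ (leq_trans n01 n1n); rewrite ler_pdivlMr //; lra.
Qed.

(** [L] is [ln ln]: [n <= s n + C (s n)^q <= (s n)^(q + 1)] once [s n >= 1 + C], so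
    [ln n <= (q + 1) ln (s n)], and the delay is at most [ln (q + 1)] on this scale. *)
Lemma polynomial_delays_conditions : polynomial_delays s alpha -> step_conditions.
Proof.
move=> [[q q1 hO] [c c0 hc]].
have [C C0 [N hN]] := delay_le_eventually _ (fun k => powR_ge0 _ _) hO.
pose k := ln (q + 1); have k0 : 0 <= k by rewrite ln_ge0 // lerDr (le_trans ler01).
pose L n : R := ln (ln n%:R).
have [na na2 hna] := nat_above (expR (expR (1 + 2 * k))) 2.
have [n0 n0a hn0] := nat_above (1 + C) na.
have L0 n : (n0 <= n)%N -> expR (1 + 2 * k) <= ln (n%:R : R).
  move=> n0n; apply: le_ln_above; apply: natr_ge_trans hna.
  exact: leq_trans n0n.
have l1 n : (n0 <= n)%N -> 1 <= ln (n%:R : R).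
  move=> n0n; rewrite (le_trans _ (L0 _ n0n)) //.
  by rewrite (le_trans _ (expR_ge1Dx _)) //; lra.
have l_gt0 n : (n0 <= n)%N -> 0 < ln (n%:R : R).
  by move=> /l1; exact: lt_le_trans.
have L1 n : (n0 <= n)%N -> 1 + 2 * k <= L n.
  move=> n0n; rewrite -[leLHS]expRK ler_ln ?posrE ?expR_gt0 ?l_gt0 //.
  exact: L0.
have n_gt0 n : (n0 <= n)%N -> (0 < n)%N.
  by move=> n0n; rewrite (leq_trans _ n0n) // (leq_trans _ n0a) // ltnW.
have L_gt0 n : (n0 <= n)%N -> 0 < L n by move=> /L1; lra.
pose w n : R := (n%:R * ln n%:R)^-1.
have uE n : (n0 <= n)%N -> u n = c * (w n.+1 / L n.+1).
  move=> n0n; rewrite hc -?invfM // invr_gt0.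
  by rewrite mulr_gt0 ?L_gt0 ?leqW // mulr_gt0 ?l_gt0 ?leqW // ltr0n.
have [N' hN'] := origin_unbounded n0.
pose n1 := maxn n0 (maxn N N').
have n01 : (n0 <= n1)%N by exact: leq_maxl.
have L_le n : (n0 <= n)%N -> L n.+1 - L n <= w n.
  move=> n0n; rewrite (le_trans (lnB_le _ _ _ _)) ?l_gt0 ?leqW // /w invfM.
  by rewrite ler_pM2r ?invr_gt0 ?l_gt0 // ln_succ_le // n_gt0.
have L_ge n : (n0 <= n)%N -> w n.+1 <= L n.+1 - L n.
  move=> n0n; rewrite (le_trans _ (lnB_ge _ _ _ _)) ?l_gt0 ?leqW // /w invfM.
  by rewrite ler_pM2r ?invr_gt0 ?l_gt0 ?leqW // ln_succ_ge // n_gt0.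
have w_gt0 n : (n0 <= n)%N -> 0 < w n.
  by move=> n0n; rewrite invr_gt0 mulr_gt0 ?l_gt0 ?ltr0n ?n_gt0.
have L_unbounded A : exists2 n, (n0 <= n)%N & A <= L n.
  have [n n0n /le_ln_above An] := nat_above (expR (expR A)) n0; exists n => //.
  by rewrite -[leLHS]expRK ler_ln ?posrE ?expR_gt0 ?l_gt0.
have s_ge n : (n1 <= n)%N -> (n0 <= s n)%N.
  by rewrite !geq_max => /andP[_ /andP[_]]; exact: hN'.
split.
- apply: (@square_summable_harmonic _ u c n0) => // [|n n0n]; first exact: ltW.
  rewrite uE // ler_pM2l // /w invfM -mulrA ler_piMr ?invr_ge0 //.
  rewrite -invfM invf_le1 ?mulr_gt0 ?l_gt0 ?L_gt0 ?leqW //.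
  rewrite mulr_ege1 ?l1 ?leqW //.
  by have := L1 n.+1 (leqW n0n); lra.
- exact: (@slow_steps_divergent _ u L w n0 c).
apply: (@slow_steps_staleness_cst _ u L w s n0 n1 c _ _ _ _ _ _ _ _ _ k) => // n n1n.
  have sn := s_ge _ n1n; have sn0 := n_gt0 _ sn.
  move: (n1n); rewrite !geq_max => /andP[n0n /andP[/hN h _]].
  rewrite lerBlDr -lnM ?posrE ?addr_gt0 ?l_gt0 ?(lt_le_trans _ q1) //.
  rewrite ler_ln ?posrE ?mulr_gt0 ?l_gt0 ?addr_gt0 ?(lt_le_trans _ q1) //.
  rewrite -ln_powR ler_ln ?posrE ?powR_gt0 ?ltr0n ?n_gt0 //.
  have sR : (0 : R) < (s n)%:R by rewrite ltr0n.
  rewrite powRD; last by apply/implyP => _; rewrite gt_eqF.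
  rewrite powRr1 ?(ltW sR) //.
  have s1 : (1 : R) <= (s n)%:R by rewrite ler1n.
  have ssq : (s n)%:R <= (s n)%:R `^ q by exact: le1r_powR.
  have sC : 1 + C <= (s n)%:R by exact: natr_ge_trans hn0.
  have powRsq := powR_ge0 (s n)%:R q.
  apply: (@le_trans _ _ ((1 + C) * (s n)%:R `^ q)); first by lra.
  by rewrite [leRHS]mulrC ler_wpM2r.
by have := L1 _ (leq_trans n01 n1n); rewrite ler_pdivlMr //; lra.
Qed.

(** [L] is the identity, a scale on which the delays may grow like [n ^ p]. The error terms are then
    of order [n ^ (p - 2)], dominated by the decrements of a multiple of [n ^ (p - 1)]. *)
Lemma sublinear_delays_conditions : sublinear_delays s alpha -> step_conditions.
Proof.
move=> [[p [p0 p1 hO]] [c c0 hc]].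
have [C C0 [N hN]] := delay_le_eventually _ (fun k => powR_ge0 _ _) hO.
pose r := 1 - p; have r0 : 0 < r by rewrite subr_gt0.
pose L n : R := n%:R.
pose w (n : nat) : R := 1.
(* Chosen so that [n ^ (p - 1) <= 1 / (2 C)], that is [C n ^ p <= n / 2], from [n0] on. *)
have [n0 n01' hn0] := nat_above (expR (ln (2 * C) / r)) 1.
have n_gt0 n : (n0 <= n)%N -> (0 < n)%N by move=> n0n; rewrite (leq_trans _ n0n).
have L_gt0 n : (n0 <= n)%N -> 0 < L n by move=> /n_gt0; rewrite ltr0n.
have uE n : (n0 <= n)%N -> u n = c * (w n.+1 / L n.+1).
  by move=> n0n; rewrite hc ?mul1r // invr_gt0 ltr0n.
have [N' hN'] := origin_unbounded n0.
pose n1 := maxn n0 (maxn N N').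
have n01 : (n0 <= n1)%N by exact: leq_maxl.
have L_le n : (n0 <= n)%N -> L n.+1 - L n <= w n.
  by move=> _; rewrite -natrB // subSnn.
have L_ge n : (n0 <= n)%N -> w n.+1 <= L n.+1 - L n.
  by move=> _; rewrite -natrB // subSnn.
have w_gt0 n : (n0 <= n)%N -> 0 < w n by [].
have L_unbounded A : exists2 n, (n0 <= n)%N & A <= L n.
  by have [n n0n An] := nat_above A n0; exists n.
have s_ge n : (n1 <= n)%N -> (n0 <= s n)%N.
  by rewrite !geq_max => /andP[_ /andP[_]]; exact: hN'.
split.
- apply: (@square_summable_harmonic _ u c n0) => // [|n n0n]; first exact: ltW.
  by rewrite uE // mul1r.
- exact: (@slow_steps_divergent _ u L w n0 c).
pose e n : R := expR (- r * ln n%:R).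
pose h n := 2 * C / r * e n.
have eE n : (0 < n)%N -> n%:R `^ p = n%:R * e n :> R.
  move=> n_gt; rewrite /powR gt_eqF ?ltr0n //.
  by rewrite -[X in _ = X * _]lnK ?posrE ?ltr0n // -expRD; congr expR; rewrite /r; ring.
have e_gt0 n : 0 < e n by exact: expR_gt0.
apply: (@slow_steps_staleness _ u L w s n0 n1 c _ _ _ _ _ _ _ _ _
  (fun n => C * n%:R `^ p) h) => // n n1n.
- move: (n1n); rewrite !geq_max => /andP[n0n /andP[/hN hs _]].
  rewrite (le_trans hs) // ler_wpM2l ?(ltW C0) // ge0_ler_powR ?nnegrE ?ler_nat //.
  exact: ltW.
- have n0n := leq_trans n01 n1n; rewrite eE ?n_gt0 // mulrCA ler_wpM2l //.
  have le2C : e n <= expR (- ln (2 * C)).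
    rewrite ler_expR mulNr lerN2 -ler_pdivrMl // mulrC le_ln_above //.
    exact: natr_ge_trans hn0.
  rewrite expRN lnK ?posrE ?mulr_gt0 // invfM in le2C.
  by rewrite mulrC -ler_pdivlMr.
- by rewrite !mulr_ge0 ?invr_ge0 // ltW.
have n0n := leq_trans n01 n1n; have n_gt := n_gt0 _ n0n.
have nR : (n%:R : R) != 0 by rewrite gt_eqF ?ltr0n.
rewrite eE // mul1r /h -mulrBr.
(* [e n.+1 <= e n / (1 + t0)], and [1 - 1 / (1 + t0) >= t0 / 2] because [t0 <= 1]; this half and the
   [r] in [t0] account for the constant [2 C / r] in [h]. *)
pose t0 := r / n.+1%:R.
have t0_gt0 : 0 < t0 by rewrite divr_gt0 ?ltr0n.
have t0_le1 : t0 <= 1.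
  rewrite ler_pdivrMr ?ltr0n // mul1r (@le_trans _ _ 1) ?ler1n // /r.
  by rewrite lerBlDr lerDl ltW.
have e_succ : e n.+1 <= e n / (1 + t0).
  have -> : e n.+1 = e n / expR (r * (ln n.+1%:R - ln n%:R)).
    by rewrite -expRN -expRD; congr expR; ring.
  rewrite ler_wpM2l ?(ltW (e_gt0 n)) // lef_pV2 ?posrE ?expR_gt0 ?addr_gt0 //.
  rewrite (le_trans (expR_ge1Dx _)) // ler_expR ler_pM2l //.
  exact: ln_succ_ge.
have drop : e n * (t0 / 2) <= e n - e n.+1.
  rewrite lerBrDr -lerBrDl (le_trans e_succ) // -[X in _ <= X - _]mulr1 -mulrBr.
  rewrite ler_wpM2l ?(ltW (e_gt0 n)) // -[leLHS]mul1r ler_pdivrMr ?addr_gt0 //.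
  by nra.
have -> : n.+1%:R^-1 * (C * (n%:R * e n) / L n) = 2 * C / r * (e n * (t0 / 2)).
  by rewrite /t0 /L; field; rewrite nR !gt_eqF // -natr1 natr1 ltr0n.
by rewrite ler_wpM2l // !mulr_ge0 ?invr_ge0 // ltW.
Qed.

Lemma step_conditions_of_delay_step :
  delay_step_condition s alpha -> step_conditions.
Proof.
case; [exact: bounded_delays_conditions | exact: sublinear_delays_conditions |
  exact: linear_delays_conditions | exact: polynomial_delays_conditions].
Qed.

End step_sizes.

(** By monotone convergence the sum of the series is integrable, hence finite almost everywhere. *)
Lemma ae_bounded_sums {dT : measure_display} {T : measurableType dT} {R : realType}
    {mu : {measure set T -> \bar R}} (f : nat -> T -> R) (B : R) :
  (forall k, measurable_fun setT (f k)) -> (forall k t, 0 <= f k t) ->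
  (forall n, (\sum_(k < n) \int[mu]_t (f k t)%:E <= B%:E)%E) ->
  {ae mu, forall t, exists C, forall n, \sum_(k < n) f k t <= C}.
Proof.
move=> mf f0 fB.
have mfE k : measurable_fun setT (fun t => (f k t)%:E) by exact/measurable_EFinP.
pose g t := (\sum_(k <oo) (f k t)%:E)%E.
have g0 t : (0 <= g t)%E by apply: nneseries_ge0 => k _ _; rewrite lee_fin.
have g_int : mu.-integrable setT g.
  apply/integrableP; split.
    by apply: (ge0_emeasurable_sum (P := xpredT)) => // k t _ _; rewrite lee_fin.
  under eq_integral do rewrite gee0_abs //.
  rewrite integral_nneseries //; last by move=> k t _; rewrite lee_fin.
  have int_ge0 k : (0 <= \int[mu]_t (f k t)%:E)%E.
    by apply: integral_ge0 => t _; rewrite lee_fin.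
  rewrite (@le_lt_trans _ _ B%:E) ?ltry //; apply: lime_le.
    exact: is_cvg_nneseries.
  by apply: nearW => n; rewrite big_mkord.
apply: filterS (integrable_ae measurableT g_int) => t /(_ I) gt.
exists (fine (g t)) => n; rewrite -lee_fin fineK // -sumEFin.
rewrite -(big_mkord xpredT (fun k => (f k t)%:E)).
by apply: nneseries_lim_ge => k _ _; rewrite lee_fin.
Qed.

(** * Drift and convergence of the energies along the delayed recursion *)

Section recursion.
Context {R : realType} {d : nat} {dO dS : measure_display}.
Context {Omega : measurableType dO} {S : measurableType dS}.
Context {P : probability Omega R} {Q : probability S R}.
Context {X Xs : set 'rV[R]_d}.
Hypothesis X_nonempty : X !=set0.
Hypothesis X_convex : convex_set (X : set (convex_lmodType 'rV[R]_d)).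
Hypothesis X_compact : compact X.
Hypothesis Xs_nonempty : Xs !=set0.
Hypothesis XsX : Xs `<=` X.
Local Notation pr := (Defs.proj X).

Lemma measurable_rV_proj {dT} {T : measurableType dT} (xi : T -> 'rV[R]_d) :
  measurable_rV xi -> measurable_rV (fun t => pr (xi t)).
Proof.
move=> mxi i; apply: (measurable_fun_continuous_comp (fun y => pr y 0 i) xi mxi).
apply: (lipschitz_continuous 1) => x y; rewrite mul1r.
apply: le_trans (proj_lip X_nonempty X_convex X_compact x y).
by have := coord_le_enorm (pr x - pr y) i; rewrite !mxE.
Qed.

Variable v : nat -> {mfun S >-> Omega}.
Hypothesis v_iid : iid_from P Q v.
Local Notation past := (past v).

Lemma past_freezing_on n (A : set (past n)) (f : past n * Omega -> \bar R) :
  measurable A -> measurable_fun setT f -> (forall x, 0 <= f x)%E ->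
  (\int[Q]_(o in A) f (o, v n o) = \int[Q]_(o in A) \int[P]_u f (o, u))%E.
Proof.
move=> mA mf f0; rewrite [LHS]integral_mkcond [RHS]integral_mkcond.
pose g := f \_ (fst @^-1` A).
have mB : measurable (fst @^-1` A : set (past n * Omega)).
  by rewrite -[X in measurable X]setTI; exact: measurable_fst.
transitivity (\int[Q]_o g (o, v n o))%E.
  apply: eq_integral => o _; rewrite /g !patchE.
  by congr (if _ then _ else _); apply/idP/idP => /set_mem h; exact/mem_set.
rewrite (past_freezing v v_iid n g).
- apply: eq_integral => o _; rewrite patchE; case: ifPn => oA.
    apply: eq_integral => u _; rewrite /g patchE ifT //.
  apply: integral0_eq => u _; rewrite /g patchE ifF //.
  by apply/negbTE; apply: contra oA => /set_mem h; exact/mem_set.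
- by apply/(measurable_restrictT _ _).1 => //; exact: measurable_funTS.
- by move=> x; rewrite /g patchE; case: ifP.
Qed.

Variables (H : 'rV[R]_d -> Omega -> 'rV[R]_d) (h : 'rV[R]_d -> 'rV[R]_d) (M L : R).
Hypothesis H_measurable : forall dT (T : measurableType dT) (xi : T -> 'rV[R]_d),
  measurable_rV xi -> measurable_rV (fun p : T * Omega => H (xi p.1) p.2).
Hypothesis H_measurable_at : forall x, measurable_rV (H x).
Hypothesis H_bounded : forall x, (\int[P]_u (enorm (H x u) ^+ 2)%:E <= M%:E)%E.
Hypothesis H_mean : forall x p q, X x -> X p -> X q ->
  (\int[P]_u (dotp (H x u) (p - q))%:E = (dotp (h x) (p - q))%:E)%E.
Hypothesis L_ge0 : 0 <= L.
Hypothesis h_lip : forall x y, X x -> X y -> enorm (h x - h y) <= L * enorm (x - y).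
Hypothesis h_coherent : forall p x, Xs p -> X x -> 0 <= dotp (h x) (x - p).
Hypothesis h_strict : forall p x, Xs p -> X x -> dotp (h x) (x - p) = 0 -> Xs x.

Variables (D : R).
Hypothesis D_ge0 : 0 <= D.
Hypothesis XD : forall x y, X x -> X y -> enorm (x - y) <= D.

Lemma M_ge0 : 0 <= M.
Proof.
rewrite -lee_fin (le_trans _ (H_bounded 0)) //; apply: integral_ge0 => u _.
by rewrite lee_fin sqr_ge0.
Qed.

Lemma mean_energy_at_step a x y p : 0 <= a -> X x -> X p ->
  (\int[P]_u (energy_at X p (y - a *: H x u))%:E <=
   (energy_at X p y - 2 * a * dotp (h x) (pr y - p) + a ^+ 2 * M)%:E)%E.
Proof.
move=> a0 Xx Xp; have Xy : X (pr y) by exact: projX.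
pose g u := energy_at X p y - 2 * a * dotp (H x u) (pr y - p) +
  a ^+ 2 * enorm (H x u) ^+ 2.
have le_g u : energy_at X p (y - a *: H x u) <= g u.
  rewrite (le_trans (energy_atD X_nonempty X_convex X_compact p y (- (a *: H x u)))) //.
  rewrite enormN enormZ exprMn ger0_norm // /g lerD2r lerD2l.
  by rewrite -scaleNr dotpZl mulNr mulrN mulrA.
have g_ge0 u : 0 <= g u.
  by rewrite (le_trans _ (le_g u)) // (energy_at_ge0 X_nonempty X_convex).
have mH := H_measurable_at x.
have mdot : measurable_fun setT (fun u => dotp (H x u) (pr y - p)).
  by apply: measurable_dotp => //; exact: measurable_rV_cst.
have msq : measurable_fun setT (fun u => enorm (H x u) ^+ 2).
  by apply: measurable_funX; exact: measurable_enorm.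
have mg : measurable_fun setT g.
  apply: measurable_funD; last exact: measurable_funM.
  by apply: measurable_funB => //; exact: measurable_funM.
have Elip := energy_at_lip X_nonempty X_convex X_compact p D XD Xp.
apply: (@le_trans _ _ (\int[P]_u (g u)%:E)%E).
  apply: ge0_le_integral => //.
  - by move=> u _; rewrite lee_fin (energy_at_ge0 X_nonempty X_convex).
  - apply/measurable_EFinP.
    apply: (measurable_fun_continuous_comp (energy_at X p)) => //.
      by apply: measurable_rVB; [exact: measurable_rV_cst | exact: measurable_rVZ].
    exact: (lipschitz_continuous (2 * D)).
  - exact/measurable_EFinP.
  - by move=> u _; rewrite lee_fin.
have isq : P.-integrable setT (fun u => (enorm (H x u) ^+ 2)%:E).
  apply/integrableP; split; first exact/measurable_EFinP.
  under eq_integral do rewrite gee0_abs ?lee_fin ?sqr_ge0 //.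
  by rewrite (le_lt_trans (H_bounded x)) // ltry.
have idot := integrable_dotp (H x) M (pr y - p) mH (H_bounded x).
have icst : P.-integrable setT (fun _ => (energy_at X p y)%:E).
  by apply: finite_measure_integrable_cst.
have iadot : P.-integrable setT (fun u => (- (2 * a))%:E * (dotp (H x u) (pr y - p))%:E)%E.
  exact: integrableZl.
have iasq : P.-integrable setT (fun u => (a ^+ 2)%:E * (enorm (H x u) ^+ 2)%:E)%E.
  exact: integrableZl.
have -> : (\int[P]_u (g u)%:E = \int[P]_u ((energy_at X p y)%:E +
   (- (2 * a))%:E * (dotp (H x u) (pr y - p))%:E +
   (a ^+ 2)%:E * (enorm (H x u) ^+ 2)%:E))%E.
  by apply: eq_integral => u _; rewrite /g -mulNr !EFinD !EFinM.
rewrite integralD //; last exact: integrableD.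
rewrite integralD // integralZl // integralZl // integral_cst //= probability_setT mule1.
rewrite H_mean // -EFinM -EFinD mulNr [leRHS]EFinD leeD2l // (EFinM (a ^+ 2) M).
by rewrite lee_wpmul2l // lee_fin sqr_ge0.
Qed.

(** The mean gradient at the current point [pr y] replaces the one at the stale point [x]; the
    Lipschitz bound on [h] and the diameter limit the cost of the exchange. *)
Lemma mean_energy_at_descent a x y p : 0 <= a -> X x -> Xs p ->
  (\int[P]_u (energy_at X p (y - a *: H x u))%:E +
     (2 * a * dotp (h (pr y)) (pr y - p))%:E <=
   (energy_at X p y + 2 * a * L * D * enorm (x - pr y) + a ^+ 2 * M)%:E)%E.
Proof.
move=> a0 Xx Xsp; have Xp := XsX _ Xsp; have Xy : X (pr y) by exact: projX.
rewrite -leeBrDr // (le_trans (mean_energy_at_step _ _ y _ a0 Xx Xp)) //.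
rewrite -EFinB lee_fin.
have : dotp (h (pr y) - h x) (pr y - p) <= L * D * enorm (x - pr y).
  rewrite (le_trans (dotp_le _ _)) //.
  rewrite (le_trans (ler_pM _ _ (h_lip _ _ Xy Xx) (XD _ _ Xy Xp))) ?enorm_ge0 //.
  by rewrite enormB mulrAC.
move=> /(ler_wpM2l a0).
rewrite dotpBl.
move: (dotp _ _) (dotp _ _) (enorm _) (energy_at _ _ _) => e1 e2 e3 e4.
by lra.
Qed.

(** The mean of an infimum is at most each of the means, and the error terms are the same for all
    [p], so the infimum can be taken on the right afterwards. Coherence discards the gap, which does
    depend on [p]. *)
Lemma mean_energy_inf_descent a x y : 0 <= a -> X x ->
  (\int[P]_u (energy_inf X Xs (y - a *: H x u))%:E <=
   (energy_inf X Xs y + 2 * a * L * D * enorm (x - pr y) + a ^+ 2 * M)%:E)%E.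
Proof.
move=> a0 Xx; have Xy : X (pr y) by exact: projX.
pose I := (\int[P]_u (energy_inf X Xs (y - a *: H x u))%:E)%E.
have Ele := energy_inf_le X_nonempty X_convex X_compact Xs_nonempty XsX.
have E0 := energy_inf_ge0 X_nonempty X_convex X_compact Xs_nonempty XsX.
have mY : measurable_rV (fun u => y - a *: H x u).
  by apply: measurable_rVB; [exact: measurable_rV_cst | exact: measurable_rVZ].
have I_le p : Xs p ->
    (I <= (energy_at X p y + 2 * a * L * D * enorm (x - pr y) + a ^+ 2 * M)%:E)%E.
  move=> Xsp; apply: le_trans (mean_energy_at_descent a x y p a0 Xx Xsp).
  rewrite -[leLHS]adde0 leeD //; last first.
    by rewrite lee_fin mulr_ge0 ?h_coherent // mulr_ge0.
  apply: ge0_le_integral => //.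
  - by move=> u _; rewrite lee_fin.
  - apply/measurable_EFinP; apply: (measurable_fun_continuous_comp _ _ mY).
    exact: (lipschitz_continuous (2 * D)) (energy_inf_lip _ _ _ _ _ _ XD).
  - apply/measurable_EFinP; apply: (measurable_fun_continuous_comp _ _ mY).
    exact: (lipschitz_continuous (2 * D)) (energy_at_lip _ _ _ _ _ XD (XsX _ Xsp)).
  - by move=> u _; rewrite lee_fin Ele.
have I0 : (0 <= I)%E by apply: integral_ge0 => u _; rewrite lee_fin.
have [p0 Xsp0] := Xs_nonempty.
have If : I \is a fin_num.
  by rewrite ge0_fin_numE // (le_lt_trans (I_le _ Xsp0)) // ltry.
rewrite -/I -(fineK If) lee_fin -lerBlDr -lerBlDr.
apply: le_energy_inf => // p Xsp; rewrite !lerBlDr -lee_fin fineK //.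
exact: I_le.
Qed.

Variables (u : nat -> R) (s : nat -> nat) (Y : nat -> S -> 'rV[R]_d).
Variable y0 : 'rV[R]_d.
Hypothesis u_ge0 : forall n, 0 <= u n.
Hypothesis s_le : forall n, (s n <= n)%N.
Hypothesis Y0 : forall o, Y 0%N o = y0.
Hypothesis YS : forall n o, Y n.+1 o = Y n o - u n *: H (pr (Y (s n) o)) (v n o).

Lemma measurable_iterate n : measurable_rV (Y n : past n -> 'rV[R]_d).
Proof.
(* Strong induction, because the update reaches back to [Y (s n)]. *)
elim/ltn_ind: n => -[_|n IH].
  rewrite (_ : Y 0%N = fun=> y0); last exact/funext.
  exact: measurable_rV_cst.
have up m : (m <= n)%N -> measurable_rV (Y m : past n -> 'rV[R]_d).
  by move=> mn i; apply: (past_measurable_funS v m n) => //; apply: IH; rewrite ltnS.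
rewrite (_ : Y n.+1 = fun o => Y n o - u n *: H (pr (Y (s n) o)) (v n o)); last first.
  by apply/funext => o; rewrite YS.
apply: measurable_rVB.
  move=> i; apply: (past_measurable_funS v n n.+1) => //; exact: IH.
apply: measurable_rVZ.
have := H_measurable _ _ _ (measurable_rV_proj _ (up _ (s_le n))).
move=> /(measurable_rV_comp _ _ (measurable_past_succ_pair v n)).
exact.
Qed.

Lemma measurable_past_iterate m n : (m <= n)%N ->
  measurable_rV (Y m : past n -> 'rV[R]_d).
Proof.
by move=> mn i; apply: (past_measurable_funS v m n) => //; exact: measurable_iterate.
Qed.

Lemma measurable_oracle_call n :
  measurable_rV (fun p : past n * Omega => H (pr (Y (s n) p.1)) p.2).
Proof.
apply: (H_measurable _ _ (fun o : past n => pr (Y (s n) o))).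
by apply: measurable_rV_proj; exact: measurable_past_iterate.
Qed.

Lemma measurable_S_iterate n : measurable_rV (Y n).
Proof. by move=> i; apply: (past_measurable_fun v n); exact: measurable_iterate. Qed.

(** The projection being nonexpansive, step [k] moves the projected iterate by at most [u k] times
    the norm of a gradient, whose mean is at most [1 + M] once the past is frozen. *)
Lemma iterate_variation m n : (m <= n)%N ->
  (\int[Q]_o (enorm (pr (Y m o) - pr (Y n o)))%:E <=
   ((1 + M) * \sum_(m <= k < n) u k)%:E)%E.
Proof.
have mY k : measurable_rV (fun o => pr (Y k o)).
  by apply: measurable_rV_proj; exact: measurable_S_iterate.
have mdiff k j : measurable_fun setT (fun o => (enorm (pr (Y k o) - pr (Y j o)))%:E).
  by apply/measurable_EFinP; apply: measurable_enorm; exact: measurable_rVB.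
have diag k : (\int[Q]_o (enorm (pr (Y k o) - pr (Y k o)))%:E <=
    ((1 + M) * \sum_(k <= i < k) u i)%:E)%E.
  rewrite big_geq // mulr0 (eq_integral (cst 0%E)) ?integral0 // => o _.
  by rewrite subrr enorm0.
elim: n => [|n IH]; first by rewrite leqn0 => /eqP ->; exact: diag.
rewrite leq_eqVlt => /orP[/eqP ->|]; first exact: diag.
rewrite ltnS => mn; rewrite big_nat_recr //= mulrDr EFinD.
pose e o := (enorm (H (pr (Y (s n) o)) (v n o)))%:E.
have mH : measurable_rV (fun o => H (pr (Y (s n) o)) (v n o)).
  exact: (measurable_rV_comp _ _ (measurable_past_pair v n) (measurable_oracle_call n)).
have me : measurable_fun setT e by apply/measurable_EFinP; exact: measurable_enorm.
apply: (@le_trans _ _ (\int[Q]_o ((enorm (pr (Y m o) - pr (Y n o)))%:E + (u n)%:E * e o))%E).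
  apply: ge0_le_integral => //.
  - by move=> o _; rewrite lee_fin enorm_ge0.
  - by apply: emeasurable_funD => //; exact: measurable_funeM.
  move=> o _; rewrite /e -EFinM -EFinD lee_fin.
  rewrite (le_trans (enorm_triangle (pr (Y n o)) _ _)) // lerD2l.
  rewrite (le_trans (proj_lip X_nonempty X_convex X_compact _ _)) //.
  by rewrite YS opprB addrC subrK enormZ ger0_norm.
rewrite ge0_integralD //; first last.
- exact: measurable_funeM.
- by move=> o _; rewrite mule_ge0 ?lee_fin ?enorm_ge0.
- by move=> o _; rewrite lee_fin enorm_ge0.
rewrite leeD ?IH // ge0_integralZl //; first last.
- by rewrite lee_fin.
- by move=> o _; rewrite lee_fin enorm_ge0.
rewrite mulrC EFinM lee_wpmul2l ?lee_fin //.
pose f (p : past n * Omega) := (enorm (H (pr (Y (s n) p.1)) p.2))%:E.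
have := past_freezing v v_iid n f.
rewrite /f /e => -> //.
- apply: (@le_trans _ _ (\int[Q]_o (1 + M)%:E)%E).
    apply: ge0_le_integral => //.
    + by move=> o _; apply: integral_ge0 => w _; rewrite lee_fin enorm_ge0.
    + apply: (past_measurable_fun v n).
      apply: (@measurable_fun_fubini_tonelli_F _ _ _ _ _ P f).
      + by apply/measurable_EFinP; apply: measurable_enorm; exact: measurable_oracle_call.
      + by move=> p; rewrite lee_fin enorm_ge0.
    move=> o _ /=.
    exact: (integral_enorm_le (H (pr (Y (s n) o))) M (H_measurable_at _) (H_bounded _)).
  by rewrite integral_cst //= probability_setT mule1.
- by apply/measurable_EFinP; apply: measurable_enorm; exact: measurable_oracle_call.
- by move=> p; rewrite lee_fin enorm_ge0.
Qed.

Definition drift_error n : R :=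
  2 * L * D * (1 + M) * (u n * \sum_(s n <= k < n) u k) + M * u n ^+ 2.

(** Stated for a pair [phi], [psi] so as to serve twice: for [energy_at X p] with its gap, where the
    decrease must be kept, and for [energy_inf] with [psi = 0]. *)
Lemma lyapunov_drift (phi psi : 'rV[R]_d -> R) n (A : set (past n)) :
  continuous phi -> (forall y, 0 <= phi y) ->
  continuous (psi \o pr) -> (forall x, X x -> 0 <= psi x) ->
  (forall a x y, 0 <= a -> X x ->
    (\int[P]_w (phi (y - a *: H x w))%:E + (2 * a * psi (pr y))%:E <=
     (phi y + 2 * a * L * D * enorm (x - pr y) + a ^+ 2 * M)%:E)%E) ->
  measurable A ->
  (\int[Q]_(o in A) (phi (Y n.+1 o))%:E +
     \int[Q]_(o in A) (2 * u n * psi (pr (Y n o)))%:E <=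
   \int[Q]_(o in A) (phi (Y n o))%:E + (drift_error n)%:E)%E.
Proof.
move=> cphi phi0 cpsi psi0 step mA.
have mAS : measurable (A : set S) by exact: past_measurable mA.
pose f (p : past n * Omega) := (phi (Y n p.1 - u n *: H (pr (Y (s n) p.1)) p.2))%:E.
have f0 p : (0 <= f p)%E by rewrite lee_fin.
have mf : measurable_fun setT f.
  apply/measurable_EFinP; apply: (measurable_fun_continuous_comp phi) => //.
  apply: measurable_rVB; last by apply: measurable_rVZ; exact: measurable_oracle_call.
  exact: (measurable_rV_comp _ _ measurable_fst (measurable_iterate n)).
have -> : (\int[Q]_(o in A) (phi (Y n.+1 o))%:E =
    \int[Q]_(o in A) \int[P]_w f (o, w))%E.
  rewrite -(past_freezing_on n A f) //.
  by apply: eq_integral => o _; rewrite /f /= YS.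
have mF : measurable_fun setT (fun o : S => (\int[P]_w f (o, w))%E).
  apply: (past_measurable_fun v n).
  exact: measurable_fun_fubini_tonelli_F.
have Xpr y : X (pr y) by exact: projX.
have psipr0 y : 0 <= 2 * u n * psi (pr y) by rewrite !mulr_ge0 ?psi0.
have mpsi : measurable_fun setT (fun o => (2 * u n * psi (pr (Y n o)))%:E).
  apply/measurable_EFinP; apply: measurable_funM => //.
  exact: (measurable_fun_continuous_comp (psi \o pr) _ (measurable_S_iterate n)).
have mphi : measurable_fun setT (fun o => (phi (Y n o))%:E).
  apply/measurable_EFinP.
  exact: (measurable_fun_continuous_comp phi _ (measurable_S_iterate n)).
pose e o := enorm (pr (Y (s n) o) - pr (Y n o)).
have me : measurable_fun setT (EFin \o e).
  apply/measurable_EFinP; apply: measurable_enorm.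
  by apply: measurable_rVB; apply: measurable_rV_proj; exact: measurable_S_iterate.
pose c := 2 * u n * L * D.
have c0 : 0 <= c by rewrite /c !mulr_ge0.
pose g o := (c%:E * (e o)%:E + (u n ^+ 2 * M)%:E)%E.
have g0 o : (0 <= g o)%E.
  by rewrite /g -EFinM -EFinD lee_fin addr_ge0 ?mulr_ge0 ?sqr_ge0 ?enorm_ge0 ?M_ge0.
have mg : measurable_fun setT g.
  by apply: emeasurable_funD => //; exact: measurable_funeM.
rewrite -ge0_integralD //; first last.
- exact: measurable_funTS.
- by move=> o _; rewrite lee_fin.
- exact: measurable_funTS.
- by move=> o _; apply: integral_ge0.
apply: (@le_trans _ _ (\int[Q]_(o in A) ((phi (Y n o))%:E + g o))%E).
  apply: ge0_le_integral => //.
  - by move=> o _; rewrite adde_ge0 ?lee_fin ?integral_ge0.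
  - by apply: measurable_funTS; exact: emeasurable_funD.
  - by apply: measurable_funTS; exact: emeasurable_funD.
  move=> o _; apply: le_trans (step _ (pr (Y (s n) o)) (Y n o) (u_ge0 n) (Xpr _)) _.
  by rewrite /g -EFinM -!EFinD addrA.
rewrite ge0_integralD //; first last.
- exact: measurable_funTS.
- exact: measurable_funTS.
- by move=> o _; rewrite lee_fin.
(* The staleness may be correlated with [A] and only its unconditional mean is bounded, so the error
   is integrated over all of [S]. *)
rewrite leeD2l // (@le_trans _ _ (\int[Q]_o g o)%E) //.
  by apply: ge0_subset_integral => //; exact: measurable_funTS.
rewrite ge0_integralD //; first last.
- by move=> o _; rewrite lee_fin mulr_ge0 ?sqr_ge0 ?M_ge0.
- exact: measurable_funeM.
- by move=> o _; rewrite -EFinM lee_fin mulr_ge0 ?enorm_ge0.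
rewrite integral_cst //= probability_setT mule1 /drift_error EFinD [M * _]mulrC.
rewrite leeD2r // ge0_integralZl //; last first.
  by move=> o _; rewrite lee_fin enorm_ge0.
rewrite (_ : 2 * L * D * (1 + M) * _ = c * ((1 + M) * \sum_(s n <= k < n) u k)); last first.
  by rewrite /c; ring.
by rewrite (EFinM c) lee_wpmul2l ?lee_fin // iterate_variation.
Qed.

Hypothesis u_square : square_summable u.
Hypothesis u_divergent : divergent_sum u.
Hypothesis u_stale : staleness_summable s u.

Lemma drift_error_summable : exists B, forall n, \sum_(k < n) drift_error k <= B.
Proof.
have [B1 hB1] := u_square; have [B2 hB2] := u_stale.
exists (2 * L * D * (1 + M) * B2 + M * B1) => n.
have M0 := M_ge0; rewrite big_split /= -!mulr_sumr lerD // ler_wpM2l //.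
  by rewrite !mulr_ge0 // addr_ge0.
  exact: hB2.
exact: hB1.
Qed.

Section descent_gap.
Variable p : 'rV[R]_d.
Hypothesis Xsp : Xs p.
Let gap x := dotp (h x) (x - p).

(** One [L * D] comes from varying [h]; the other, with [enorm (h p)], bounds [h y] itself. *)
Lemma gap_lip x y : X x -> X y ->
  `|gap x - gap y| <= (2 * L * D + enorm (h p)) * enorm (x - y).
Proof.
move=> Xx Xy; have Xp := XsX _ Xsp.
have -> : gap x - gap y = dotp (h x - h y) (x - p) + dotp (h y) (x - y).
  rewrite /gap (_ : y - p = (x - p) - (x - y)); last by rewrite opprB [RHS]addrC addrA subrK.
  by rewrite dotpBl [dotp (h y) (_ - (x - y))]dotpBr; ring.
rewrite (le_trans (ler_normD _ _)) // (_ : (2 * L * D + enorm (h p)) * enorm (x - y) =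
  L * enorm (x - y) * D + (enorm (h p) + L * D) * enorm (x - y)); last by ring.
rewrite lerD // (le_trans (cauchy_schwarz _ _)) //.
  by rewrite ler_pM ?enorm_ge0 // ?h_lip ?XD.
rewrite ler_wpM2r ?enorm_ge0 // -[h y](subrK (h p)) addrC.
rewrite (le_trans (enormD _ _)) // lerD2l (le_trans (h_lip _ _ Xy Xp)) //.
by rewrite ler_wpM2l ?XD.
Qed.

Lemma continuous_gap_proj : continuous (gap \o pr).
Proof.
apply: (lipschitz_continuous (2 * L * D + enorm (h p))) => x y /=.
apply: le_trans (gap_lip _ _ (projX X_nonempty X_compact x)
  (projX X_nonempty X_compact y)) _.
by rewrite ler_wpM2l ?proj_lip // addr_ge0 ?enorm_ge0 ?mulr_ge0.
Qed.

Lemma energy_inf_at_optimum x : Xs x -> energy_inf X Xs x <= 0.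
Proof.
move=> Xsx; rewrite (le_trans (energy_inf_le X_nonempty X_convex X_compact _ XsX x x Xsx)) //.
rewrite /energy_at (proj_id X_nonempty X_convex X_compact) ?subrr ?add0r.
  by rewrite dotpC dotp0l mulr0.
exact: XsX.
Qed.

(** [delta] is the minimum over the compact [X] of [gap + max 0 (eps - E)]. It is positive, because
    where the gap vanishes coherence puts the point in [Xs], and there the energy is at most 0. *)
Lemma small_gap eps : 0 < eps -> exists2 delta : R, 0 < delta &
  forall x, X x -> gap x < delta -> energy_inf X Xs x < eps.
Proof.
move=> e0; pose E := energy_inf X Xs.
have gap0 x : X x -> 0 <= gap x by exact: h_coherent.
pose g x := gap x + Num.max 0 (eps - E x).
have maxl (a b : R) : `|Num.max 0 a - Num.max 0 b| <= `|a - b|.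
  by case: (lerP 0 a); case: (lerP 0 b) => ha hb; rewrite ler_norml; apply/andP; split;
    have := ler_norm (a - b); have := ler_norm (b - a); rewrite (distrC b a); lra.
have cg : {within X, continuous g}.
  apply: (lipschitz_within X (2 * L * D + enorm (h p) + 2 * D)) => x y Xx Xy.
  rewrite /g opprD addrACA (le_trans (ler_normD _ _)) // mulrDl lerD ?gap_lip //.
  rewrite (le_trans (maxl _ _)) // opprB addrC addrA subrK distrC.
  exact: (energy_inf_lip X_nonempty X_convex X_compact).
have [x1 /set_mem Xx1 x1min] := compact_EVT_min X_nonempty X_compact cg.
exists (g x1) => [|x Xx].
  have [g0|g0] := eqVneq (gap x1) 0; last first.
    by rewrite /g ltr_wpDr ?le_max ?lexx // lt_neqAle eq_sym g0 gap0.
  have Xsx1 : Xs x1 by exact: (h_strict _ _ Xsp Xx1 g0).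
  rewrite /g g0 add0r lt_max; apply/orP; right.
  by rewrite subr_gt0 (le_lt_trans (energy_inf_at_optimum _ Xsx1)).
move=> lt; have := x1min _ (mem_set Xx) => /(lt_le_trans lt).
by rewrite /g ltrDl lt_max ltxx /= subr_gt0.
Qed.

Lemma expected_gap_sum n :
  (\int[Q]_o (energy_at X p (Y n o))%:E +
     \sum_(k < n) \int[Q]_o (2 * u k * gap (pr (Y k o)))%:E <=
   (energy_at X p y0 + \sum_(k < n) drift_error k)%:E)%E.
Proof.
have Xp := XsX _ Xsp.
have chain (a b c e g t : \bar R) :
    (a + g <= b + e -> b + t <= c -> a + (t + g) <= c + e)%E.
  move=> ab bc; rewrite addeCA addeC (le_trans (leeD2r t ab)) //.
  by rewrite addeAC leeD2r.
elim: n => [|n IH].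
  rewrite !big_ord0 adde0 addr0 (eq_integral (cst (energy_at X p y0)%:E)); last first.
    by move=> o _; rewrite Y0.
  by rewrite integral_cst //= probability_setT mule1.
have drift : (\int[Q]_o (energy_at X p (Y n.+1 o))%:E +
    \int[Q]_o (2 * u n * gap (pr (Y n o)))%:E <=
    \int[Q]_o (energy_at X p (Y n o))%:E + (drift_error n)%:E)%E.
  apply: lyapunov_drift => //.
  - exact: (lipschitz_continuous (2 * D)) (energy_at_lip _ _ _ _ _ XD Xp).
  - by move=> y; exact: energy_at_ge0.
  - exact: continuous_gap_proj.
  - by move=> x Xx; exact: h_coherent.
  - by move=> a x y a0 Xx; exact: mean_energy_at_descent.
rewrite !big_ord_recr /= [in leRHS]addrA [in leRHS]EFinD.
exact: chain drift IH.
Qed.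

(** For almost every sample the gaps weighted by the steps have bounded sums, whereas a gap bounded
    below from some time on would make them diverge with the step-sizes. *)
Lemma small_gap_often : {ae Q, forall o, forall (delta : R) N, 0 < delta ->
  exists2 n, (N <= n)%N & gap (pr (Y n o)) < delta}.
Proof.
have gap0 y : 0 <= gap (pr y) by apply: h_coherent => //; exact: projX.
have [B hB] := drift_error_summable.
pose f k o := 2 * u k * gap (pr (Y k o)).
have f0 k o : 0 <= f k o by rewrite !mulr_ge0.
have mf k : measurable_fun setT (f k).
  apply: measurable_funM => //.
  exact: (measurable_fun_continuous_comp (gap \o pr) _ (measurable_S_iterate k)
    continuous_gap_proj).
have fB n : (\sum_(k < n) \int[Q]_o (f k o)%:E <= (energy_at X p y0 + B)%:E)%E.
  rewrite (@le_trans _ _ (energy_at X p y0 + \sum_(k < n) drift_error k)%:E) //.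
    apply: le_trans (expected_gap_sum n); rewrite leeDr //.
    by apply: integral_ge0 => o _; rewrite lee_fin energy_at_ge0 //; exact: XsX.
  by rewrite lee_fin lerD2l hB.
apply: filterS (ae_bounded_sums f _ mf f0 fB) => o [C hC] delta N delta0.
apply: contrapT => none.
have gap_ge n : (N <= n)%N -> delta <= gap (pr (Y n o)).
  by move=> Nn; rewrite leNgt; apply/negP => lt; apply: none; exists n.
have unbounded A : exists n, A <= \sum_(k < n) f k o.
  apply: (unbounded_sum_telescope (fun n => f n o)
    (fun n => 2 * delta * \sum_(k < n) u k) N) => // {A}.
- move=> n Nn; rewrite big_ord_recr /= mulrDr addrAC subrr add0r /f mulrAC.
  by rewrite ler_wpM2l ?gap_ge // mulr_ge0.
- move=> A; have [n hn] := u_divergent (A / (2 * delta)).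
  exists (maxn n N); first exact: leq_maxr.
  rewrite mulrC -ler_pdivrMr ?mulr_gt0 // (le_trans hn) //.
  by rewrite (sum_ord_split u n (maxn n N)) ?leq_maxl // lerDl sumr_ge0.
by have [n le1] := unbounded (C + 1); have := le_trans le1 (hC n); lra.
Qed.

End descent_gap.

Lemma edist_cvg0 (y : nat -> 'rV[R]_d) :
  energy_inf X Xs (y n) @[n --> \oo] --> (0 : R) ->
  edist_to (pr (y n)) Xs @[n --> \oo] --> 0%E.
Proof.
move=> y0'; apply: (@squeeze_cvge _ _ _ _ (fun=> 0%E) _
  (fun n => (Num.sqrt (energy_inf X Xs (y n)))%:E)).
- apply: nearW => n; rewrite edist_to_ge0 /=.
  exact: (edist_to_le_energy X_nonempty X_convex X_compact Xs_nonempty XsX).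
- exact: cvg_cst.
apply: cvg_EFin; first exact: nearW.
rewrite -[X in _ --> X]sqrtr0; apply: continuous_cvg => //; exact: sqrt_continuous.
Qed.

Hypothesis RC : reciprocity X Xs.

(** A small gap makes the energy small at the primal point [pr (Y n o)], which controls its distance
    to [Xs]; reciprocity is what passes from there to the energy of the dual point [Y n o]
    itself. *)
Lemma energy_recurrent : {ae Q, forall o, forall (delta : R) N, 0 < delta ->
  exists2 n, (N <= n)%N & energy_inf X Xs (Y n o) < delta}.
Proof.
have [p Xsp] := Xs_nonempty.
apply: filterS (small_gap_often p Xsp) => o often delta N delta0.
apply: contrapT => none.
have E_ge n : (N <= n)%N -> delta <= energy_inf X Xs (Y n o).
  by move=> Nn; rewrite leNgt; apply/negP => lt; apply: none; exists n.
(* The indices [t j] need not increase: reciprocity applies to any sequence of dual points. *)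
have /choice[t ht] : forall j : nat, exists n,
    (N <= n)%N /\ dotp (h (pr (Y n o))) (pr (Y n o) - p) < j.+1%:R^-1.
  by move=> j; have [|n Nn lt] := often j.+1%:R^-1 N; [rewrite invr_gt0 | exists n].
have Xt j : X (pr (Y (t j) o)) by exact: projX.
have E0 : energy_inf X Xs (pr (Y (t j) o)) @[j --> \oo] --> (0 : R).
  apply/cvgr0Pnorm_lt => eps eps0.
  have [delta' delta'0 hd] := small_gap p Xsp eps eps0.
  have := near_infty_natSinv_lt (PosNum delta'0); apply: filterS => j /= lt.
  rewrite ger0_norm; last exact: (energy_inf_ge0 X_nonempty X_convex X_compact).
  by apply: hd => //; apply: lt_trans lt; have [] := ht j.
have := edist_cvg0 _ E0.
under eq_fun do rewrite (proj_id X_nonempty X_convex X_compact) //.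
move=> /RC; under eq_fun do rewrite (energy_infE X_nonempty X_convex X_compact) //.
move=> /fine_cvg /cvgr0Pnorm_lt /(_ _ delta0)[j _ /(_ j (leqnn j))] /=.
rewrite ltNge => /negP; apply; rewrite (le_trans _ (ler_norm _)) // E_ge //.
by have [] := ht j.
Qed.

Theorem iterate_cvg :
  {ae Q, forall o, edist_to (pr (Y n o)) Xs @[n --> \oo] --> 0%E}.
Proof.
have cE := lipschitz_continuous (2 * D) _
  (energy_inf_lip X_nonempty X_convex X_compact Xs_nonempty XsX D XD).
have E0 := energy_inf_ge0 X_nonempty X_convex X_compact Xs_nonempty XsX.
have mV n : measurable_fun setT (fun o : past n => energy_inf X Xs (Y n o)).
  exact: (measurable_fun_continuous_comp _ _ (measurable_iterate n)).
have drift n (A : set (past n)) : measurable A ->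
    (\int[Q]_(o in A) (energy_inf X Xs (Y n.+1 o))%:E <=
     \int[Q]_(o in A) (energy_inf X Xs (Y n o))%:E + (drift_error n)%:E)%E.
  move=> mA.
  have step a x y : 0 <= a -> X x ->
      (\int[P]_w (energy_inf X Xs (y - a *: H x w))%:E + (2 * a * 0)%:E <=
       (energy_inf X Xs y + 2 * a * L * D * enorm (x - pr y) + a ^+ 2 * M)%:E)%E.
    by move=> a0 Xx; rewrite mulr0 adde0; exact: mean_energy_inf_descent.
  have c0 : continuous ((fun=> 0 : R) \o pr) by exact: cst_continuous.
  have psi_int : (\int[Q]_(o in A) (2 * u n * 0)%:E = 0)%E.
    by rewrite mulr0; exact: integral0.
  have drop (a b z : \bar R) : z = 0%E -> (a + z <= b -> a <= b)%E.
    by move=> ->; rewrite adde0.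
  exact: drop psi_int
    (lyapunov_drift _ (fun=> 0) n A cE E0 c0 (fun _ _ => lexx 0) step mA).
have := supermartingale_cvg0 v (fun n o => energy_inf X Xs (Y n o)) drift_error
  mV (fun n o => E0 _) drift drift_error_summable energy_recurrent.
by apply: filterS => o; exact: edist_cvg0.
Qed.

End recursion.

(** * The auxiliary iterates and their comparison with the given ones *)

(** The step from [n] may look back to any earlier index, so the recursion builds tables: [hist n]
    holds the right values at all indices up to [n]. *)
Lemma delayed_recursion (A I : Type) (a0 : I -> A) (step : nat -> A -> A -> I -> A)
    (s : nat -> nat) : (forall n, (s n <= n)%N) ->
  exists Y : nat -> I -> A, (forall i, Y 0%N i = a0 i) /\
    forall n i, Y n.+1 i = step n (Y n i) (Y (s n) i) i.
Proof.
move=> s_le.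
pose hist := fix hist n : nat -> I -> A := if n is m.+1 then
  fun k i => if (k <= m)%N then hist m k i
             else step m (hist m m i) (hist m (s m) i) i
  else fun _ => a0.
have histE n m k : (k <= n)%N -> (k <= m)%N -> hist n k = hist m k.
  suff up j : (k <= j)%N -> hist j k = hist k k by move=> /up -> /up ->.
  elim: j => [|j IH]; first by rewrite leqn0 => /eqP ->.
  rewrite leq_eqVlt => /orP[/eqP -> //|kj]; rewrite -IH //.
  by apply/funext => i; rewrite /= -ltnS kj.
exists (fun n => hist n n); split=> // n i /=.
by rewrite ltnn (histE n (s n) (s n)).
Qed.

Section tangent_iterates.
Context {R : realType} {d : nat} {X : set 'rV[R]_d}.
Hypothesis X_nonempty : X !=set0.
Hypothesis X_convex : convex_set (X : set (convex_lmodType 'rV[R]_d)).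
Hypothesis X_compact : compact X.
Variables (x0 : 'rV[R]_d) (T : 'M[R]_d).
Hypothesis TT : T^T = T.
Hypothesis T_tangent : forall x, X x -> (x - x0) *m T = x - x0.

(** The variational inequality that characterizes the projection tests [y] only against differences
    of points of [X], which [T] fixes. *)
Lemma proj_mulmx y : Defs.proj X (y *m T) = Defs.proj X y.
Proof.
have Xp := projX X_nonempty X_compact y.
apply: (proj_unique X_nonempty X_convex X_compact) => // z Xz.
have zpT : (z - Defs.proj X y) *m T = z - Defs.proj X y.
  rewrite (_ : z - _ = (z - x0) - (Defs.proj X y - x0)); last first.
    by rewrite opprB addrA subrK.
  by rewrite mulmxBl !T_tangent.
apply: le_trans (proj_obtuse X_nonempty X_convex X_compact y z Xz).
by rewrite !dotpBl dotp_mulmx TT zpT.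
Qed.

End tangent_iterates.

Lemma ae_samples {R : realType} {dO dS : measure_display}
    {Omega : measurableType dO} {S : measurableType dS} {P : probability Omega R}
    {Q : probability S R} (v : nat -> {mfun S >-> Omega}) (N : set Omega) :
  iid_from P Q v -> measurable N -> P N = 0%E ->
  {ae Q, forall o, forall n, ~ N (v n o)}.
Proof.
move=> [vP _] mN PN; apply: ae_foralln => n; exists (v n @^-1` N); split.
- exact: measurable_funPTI.
- by rewrite -[LHS]/(distribution Q (v n) N) vP.
- by move=> o /= /contrapT.
Qed.

Lemma second_moment_bound {R : realType} {d : nat} {dO : measure_display}
    {Omega : measurableType dO} {P : probability Omega R} (X : set 'rV[R]_d)
    (G : 'rV[R]_d -> Omega -> 'rV[R]_d) : X !=set0 ->
  (ereal_sup [set 'E_P[(fun o => enorm (G x o) ^+ 2)%R] | x in X] < +oo)%E ->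
  exists M, forall x, X x -> (\int[P]_u (enorm (G x u) ^+ 2)%:E <= M%:E)%E.
Proof.
move=> [x0 Xx0]; set E := ereal_sup _ => Eoo.
have le_E x : X x -> (\int[P]_u (enorm (G x u) ^+ 2)%:E <= E)%E.
  by move=> Xx; apply: ereal_sup_ubound; exists x => //; rewrite unlock.
exists (fine E) => x Xx; rewrite fineK ?le_E // ge0_fin_numE //.
apply: le_trans (le_E _ Xx0); apply: integral_ge0 => u _.
by rewrite lee_fin sqr_ge0.
Qed.

Theorem theorem3 (R : realType) (d : nat)
  (dO dS : measure_display)
  (Omega : measurableType dO) (P : probability Omega R)
  (P_complete : measure_is_complete P)
  (X : set 'rV[R]_d)
  (X_nonempty : X !=set0)
  (X_convex : convex_set (X : set (convex_lmodType 'rV[R]_d)))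
  (X_compact : compact X)
  (F : 'rV[R]_d -> Omega -> R)
  (F_integrable : forall x, X x -> P.-integrable setT (EFin \o F x))
  (G : 'rV[R]_d -> Omega -> 'rV[R]_d)
  (G_measurable : forall x i, X x -> measurable_fun setT (fun o => G x o 0 i))
  (R1 : {ae P, forall o, forall x, X x ->
           gradient_within X (fun z => F z o) x (G x o)})
  (R2 : (ereal_sup [set 'E_P[(fun o => enorm (G x o) ^+ 2)%R] | x in X] < +oo)%E)
  (R3 : elipschitz_on X (fun x => Evec P (G x)))
  (VC : variationally_coherent P X (argmin X (objective P F)) G)
  (RC : reciprocity X (argmin X (objective P F)))
  (S : measurableType dS) (Q : probability S R)
  (w : nat -> {mfun S >-> Omega})
  (w_iid : iid_from P Q (fun n => w n.+1))
  (s : nat -> nat)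
  (s_le : forall n, (s n <= n)%N)
  (delays_finite : forall k, has_ubound (delays R s k))
  (alpha : nat -> R)
  (alpha_gt0 : forall n, 0 < alpha n.+1)
  (delay_step : delay_step_condition s alpha)
  (y0 : 'rV[R]_d) (Xn Yn : nat -> S -> 'rV[R]_d)
  (Xn_dasgd : dasgd X G s alpha w y0 Xn Yn) :
  {ae Q, forall o,
     edist_to (Xn n o) (argmin X (objective P F)) @[n --> \oo] --> 0%E}.
Proof.
have [S1 S2 S3] := step_conditions_of_delay_step s alpha s_le delays_finite
  alpha_gt0 delay_step.
have [N [mN PN subN]] := R1.
have F_gradient u : ~ N u -> forall x, X x -> gradient_within X (F^~ u) x (G x u).
  move=> Nu; have := contra_not (subN u) Nu; exact: contrapT.
have [M G_bounded] := second_moment_bound X G X_nonempty R2.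
have [x0 Xx0] := X_nonempty.
have [T [TT T2 T_tangent T_span]] := tangent_projector X x0.
set Xs := argmin X (objective P F) in VC RC *.
have XsX : Xs `<=` X by move=> x [].
have Xs_nonempty : Xs !=set0.
  exact: (argmin_objective_nonempty X_nonempty X_convex X_compact F_integrable
    G_measurable mN PN F_gradient M G_bounded x0 T Xx0 TT T2 T_tangent T_span).
have [D /ltW D0 XD] := diameter X_compact.
have [L0 hL0] := R3.
have h_lip x y : X x -> X y ->
    enorm (Evec P (G x) - Evec P (G y)) <= `|L0| * enorm (x - y).
  move=> Xx Xy; rewrite (le_trans (hL0 _ _ Xx Xy)) // ler_wpM2r ?enorm_ge0 //.
  exact: ler_norm.
have EG x p : X x -> ('E_P[(fun o => dotp (G x o) (x - p))%R] =
    (dotp (Evec P (G x)) (x - p))%:E)%E.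
  move=> Xx; rewrite unlock; apply: (integral_dotp _ M) (G_bounded _ Xx).
  by move=> i; exact: G_measurable.
pose H := offnull_gradient X G N T.
(* An auxiliary measurable process, started at the image of [y0] under [T]. The samples are
   renumbered as [v n = w n.+1], so that [Y n] depends on those of index below [n]. *)
have [Y [Y0 YS]] := delayed_recursion _ _ (fun _ : S => y0 *m T)
  (fun n y z o => y - alpha n.+1 *: H (Defs.proj X z) (w n.+1 o)) s s_le.
have Y_cvg := iterate_cvg X_nonempty X_convex X_compact Xs_nonempty XsX
  (fun n => w n.+1) w_iid H (fun x => Evec P (G x)) M `|L0|
  (fun dT T' xi => measurable_oracle X_nonempty X_convex X_compact F_integrable
     mN F_gradient x0 T Xx0 TT T_span dT T' xi)
  (measurable_oracle_at X_nonempty X_convex X_compact F_integrable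
     mN F_gradient x0 T Xx0 TT T_span)
  (oracle_bounded X_nonempty X_convex X_compact F_integrable G_measurable
     mN F_gradient M G_bounded x0 T Xx0 TT T2 T_span)
  (integral_oracle X_nonempty X_convex X_compact F_integrable G_measurable
     mN PN F_gradient M G_bounded x0 T Xx0 TT T_tangent T_span)
  (normr_ge0 _) h_lip _ _ D D0 XD (fun k => alpha k.+1) s Y (y0 *m T)
  (fun n => ltW (alpha_gt0 n)) s_le Y0 YS S1 S2 S3 RC.
have ae_cvg := Y_cvg
  (fun p x Xsp Xx => ltac:(by have [] := VC p x Xsp Xx; rewrite EG // lee_fin))
  (fun p x Xsp Xx e => ltac:(by have [_] := VC p x Xsp Xx; apply; rewrite EG // e)).
apply: filterS2 ae_cvg (ae_samples _ _ w_iid mN PN) => o cvgY Nw.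
have [Yn0 XnE YnS] := Xn_dasgd o.
(* [T] carries the given recursion to the auxiliary one: the update is linear in the gradient, the
   projections agree by [proj_mulmx], and the samples avoid [N]. *)
have YnT n : Yn n o *m T = Y n o.
  elim/ltn_ind: n => -[_|n IH]; first by rewrite Yn0 Y0.
  rewrite YnS YS mulmxBl -scalemxAl (IH n) // XnE.
  rewrite -(proj_mulmx X_nonempty X_convex X_compact _ _ TT T_tangent) IH ?ltnS //.
  rewrite /H /offnull_gradient ifF; last by apply/negbTE/negP => /set_mem; exact: Nw.
  rewrite (proj_id X_nonempty X_convex X_compact (Defs.proj X (Y (s n) o))) //.
  exact: projX.
under eq_fun do rewrite XnE
  -(proj_mulmx X_nonempty X_convex X_compact _ _ TT T_tangent) YnT.
exact: cvgY.
Qed.
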